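(* Let $\gamma>0$ be fixed, $\tau=\gamma\epsilon$ and $\alpha_{hex}=\frac{16}{9}$. Let $E_0$ be a fixed origin-symmetric convex Wulff-like hexagon. For all $\epsilon>0$ let $E_0^\epsilon\in\widetilde{\mathcal D}_\epsilon$ be a discrete origin-symmetric convex Wulff-like hexagon such that its Wulff-like envelope $\mathcal W(E_0^\epsilon)$ satisfies $\mathrm d_{\mathcal H}(\mathcal W(E_0^\epsilon),E_0)<\epsilon$. For $k\ge1$ let $E_k^\epsilon\in\mathcal D_\epsilon$ be a minimizer of $\mathcal F_{\tau,\epsilon}(\cdot,E_{k-1}^\epsilon)$ on $\mathcal D_\epsilon$, and let $E^\epsilon(t):=\mathcal W\big(E^\epsilon_{\lfloor t/(\gamma\epsilon)\rfloor}\big)$ be the Wulff-like envelope of the piecewise-constant motion with initial datum $E_0^\epsilon$. Then there exists $T>0$ such that $E^\epsilon(t)$ converges, up to a subsequence, as $\epsilon\to0$, in the Hausdorff topology and locally uniformly on $[0,T)$, to an origin-symmetric convex Wulff-like hexagon $E(t)$ with sides $S_i(t)$ (with exterior unit normal $n_i$), $i=1,\dots,6$, such that $E(0)=E_0$. The distance $s_i(t)$ of the side $S_i(t)$ from the origin reduces with a velocity $v_i(t)$, i.e. $\dot s_i(t)=-v_i(t)$ for almost every $t\in[0,T)$, satisfying $$v_i(t)\ \begin{cases}=\dfrac{\sqrt3}{2}\Big(\dfrac1\gamma\Big\lfloor\dfrac{\alpha_{hex}\gamma}{L_i(t)}\Big\rfloor\Big),&\text{if }\dfrac{\alpha_{hex}\gamma}{L_i(t)}\notin\mathbb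 N,\\[3mm] \in\dfrac{\sqrt3}{2}\Big[\dfrac1\gamma\Big(\dfrac{\alpha_{hex}\gamma}{L_i(t)}-1\Big),\ \dfrac{\alpha_{hex}}{L_i(t)}\Big],&\text{if }\dfrac{\alpha_{hex}\gamma}{L_i(t)}\in\mathbb N,\end{cases}$$ where $L_i(t)=\mathcal H^1(S_i(t))$ is the length of $S_i(t)$. Accordingly, the law for each $L_i(t)$ is $$\dot L_i(t)=\frac{2}{\sqrt3}\big[v_i(t)-\big(v_{i-1}(t)+v_{i+1}(t)\big)\big],\qquad i=1,\dots,6,$$ for almost every $t\in[0,T)$, with indices taken modulo $6$.
   Context: Lattice. Let $\eta_1=(1,0)$, $\eta_2=(1/2,\sqrt3/2)$, $\eta_3=\eta_1-\eta_2$, and let $\mathbb T=\{a\eta_1+b\eta_2:\ a,b\in\mathbb Z\}$ be the triangular lattice. For $e=(e^1,e^2)\in\mathbb R^2$ put $e^\perp=(-e^2,e^1)$. Let $\mathcal R=\{\pm\eta_1^\perp,\pm\eta_2^\perp,\pm\eta_3^\perp\}$ and let $H=\frac{\sqrt3}{3}\,\mathrm{conv}(\mathcal R)$ (a closed regular hexagon of side length $\sqrt3/3$, the cell of the dual lattice). For $\epsilon>0$ and $i\in\epsilon\mathbb T$ put $H_\epsilon(i)=i+\epsilon H$. Admissible sets. For $\mathcal I\subset\epsilon\mathbb T$ let $E_{\mathcal I}=\bigcup_{i\in\mathcal I}H_\epsilon(i)$, and $\mathcal D_\epsilon=\{E\subseteq\mathbb R^2:\ E=E_{\mathcal I}\text{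 for some }\mathcal I\subseteq\epsilon\mathbb T\}$. Perimeter energy. For $E=E_{\mathcal I}\in\mathcal D_\epsilon$, $P_\epsilon(E)=\mathcal H^1(\partial E)$; equivalently, $P_\epsilon(E)$ is $\frac{\sqrt3}{3}\epsilon$ times the number of nearest-neighbour pairs ($|i-j|=\epsilon$) of points $i,j\in\epsilon\mathbb T$ with $i\in\mathcal I$, $j\notin\mathcal I$. Norms. $\varphi_{hex}(\nu)=\frac23\sum_{k=1}^3|\langle\nu,\eta_k\rangle|$, with dual norm $\varphi_{hex}^\circ(\xi)=\frac{\sqrt3}{2}\max_{k=1,2,3}|\langle\xi,\eta_k^\perp\rangle|$. Discrete distance. For $F\in\mathcal D_\epsilon$ and $x\in\mathbb R^2$ (defined uniquely up to a Lebesgue-null set), $$d^\epsilon(x,\partial F)=\begin{cases}\inf\{\varphi^\circ_{hex}(i-j):\ i,j\in\epsilon\mathbb T,\ x\in H_\epsilon(i),\ H_\epsilon(j)\subset F\},& x\notin F,\\ \inf\{\varphi^\circ_{hex}(i-j):\ i,j\in\epsilon\mathbb T,\ x\in H_\epsilon(i),\ H_\epsilon(j)\not\subset F\},& x\in F.\end{cases}$$ Energy. For $E,F\in\mathcal D_\epsilon$ and $\tau>0$, $$\mathcal F_{\tau,\epsilon}(E,F)=P_\epsilon(E)+\frac1\tau\int_{E\triangle F}d^\epsilon(x,\partial F)\,dx .$$ Wulff-like sets. Let $n_1,\dots,n_6$ be the six unit vectors in $\mathcal R$ listed in cyclic (angular) order, consecutive ones forming an angle $\pi/3$: $n_1=\eta_1^\perp$,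 $n_2=\eta_2^\perp$, $n_3=-\eta_3^\perp$, $n_4=-n_1$, $n_5=-n_2$, $n_6=-n_3$, indices modulo $6$; they are the exterior unit normals of the Wulff shape $\{\varphi_{hex}^\circ\le1\}$, a regular hexagon. A bounded set $E\subset\mathbb R^2$ is Wulff-like if $\partial E$ is a polygonal closed curve whose consecutive sides $S_1,\dots,S_m$ have exterior unit normals $\nu_1,\dots,\nu_m$ (indices modulo $m$) such that (1) $\nu_i\in\{n_1,\dots,n_6\}$ for every $i$, and (2) if $\nu_i=n_j$ then $\nu_{i+1}\in\{n_{j-1},n_{j+1}\}$. A convex Wulff-like set is automatically a hexagon and is called a convex Wulff-like hexagon; its sides are labelled so that the $i$-th side has exterior normal $n_i$. Discrete hexagons. $E\in\mathcal D_\epsilon$ is a discrete convex Wulff-like hexagon if there is a convex Wulff-like hexagon $K$ with $E=\bigcup\{H_\epsilon(i):\ i\in\epsilon\mathbb T,\ H_\epsilon(i)\subset K\}$; the class of these sets is $\widetilde{\mathcal D}_\epsilon$. For $E\in\widetilde{\mathcal D}_\epsilon$, the Wulff-like envelope $\mathcal W(E)$ is the smallest convex Wulff-like hexagon containing $E$. A set $E$ is origin-symmetric if $E=-E$. Hausdorff distance: $\mathrm d_{\mathcal H}(A,B)=\max\{\sup_{a\in A}\mathrm{dist}(a,B),\ \sup_{b\in B}\mathrm{dist}(b,A)\}$ with the Euclidean distance; limits in the Hausdorff sense are taken to be closed sets. *)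

(* Defs.v *)
From HB Require Import structures.
From mathcomp Require Import all_boot all_order all_algebra.
From mathcomp Require Import all_classical all_reals all_analysis.

Set Implicit Arguments.
Unset Strict Implicit.
Unset Printing Implicit Defensive.

Import Order.TTheory GRing.Theory Num.Theory.
Import numFieldNormedType.Exports.

Local Open Scope classical_set_scope.
Local Open Scope ring_scope.

Definition dot (R : realType) (x y : R * R) : R := x.1 * y.1 + x.2 * y.2.

(* The library norm on [R * R] is the sup norm; it induces the usual topology
   and bounded sets, but every metric notion below uses [enorm]. *)
Definition enorm (R : realType) (x : R * R) : R := Num.sqrt (dot x x).

Definition perp (R : realType) (e : R * R) : R * R := (- e.2, e.1).

Definition boundary (R : realType) (A : set (R * R)) : set (R * R) :=
  closure A `\` interior A.

Definition origin_symmetric (R : realType) (A : set (R * R)) : Prop :=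
  [set - x | x in A] = A.

Definition edist_set (R : realType) (x : R * R) (A : set (R * R)) : \bar R :=
  ereal_inf [set (enorm (x - a))%:E | a in A].

Definition hausdorff_dist (R : realType) (A B : set (R * R)) : \bar R :=
  Order.max (ereal_sup [set edist_set a B | a in A])
            (ereal_sup [set edist_set b A | b in B]).

(* [0] is added to the supremum so that the empty set has diameter [0]. *)
Definition ediam (R : realType) (A : set (R * R)) : \bar R :=
  ereal_sup (0%E |` [set (enorm (x - y))%:E | x in A & y in A]).

Definition hausdorff1_pre (R : realType) (delta : R) (A : set (R * R)) :
    \bar R :=
  ereal_inf [set (\sum_(0 <= n <oo) ediam (U n))%E
            | U in [set U : nat -> set (R * R) |
                    A `<=` \bigcup_n U n /\
                    forall n, (ediam (U n) <= delta%:E)%E]].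

(* One-dimensional Hausdorff (outer) measure; with this normalization a segment
   has measure equal to its length. *)
Definition hausdorff1 (R : realType) (A : set (R * R)) : \bar R :=
  ereal_sup [set hausdorff1_pre delta A | delta in [set d : R | 0 < d]].

Definition segment (R : realType) (a b : R * R) : set (R * R) :=
  [set a + r *: (b - a) | r in [set r : R | 0 <= r <= 1]].

Definition segment_co (R : realType) (a b : R * R) : set (R * R) :=
  [set a + r *: (b - a) | r in [set r : R | 0 <= r < 1]].

Definition segment_oo (R : realType) (a b : R * R) : set (R * R) :=
  [set a + r *: (b - a) | r in [set r : R | 0 < r < 1]].

Definition eta1 (R : realType) : R * R := (1, 0).
Definition eta2 (R : realType) : R * R := (1 / 2, Num.sqrt 3 / 2).
Definition eta3 (R : realType) : R * R := eta1 R - eta2 R.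

(* The scaled lattice [eps T]. *)
Definition lattice (R : realType) (eps : R) : set (R * R) :=
  [set eps *: (ab.1%:~R *: eta1 R + ab.2%:~R *: eta2 R)
  | ab in [set: int * int]].

(* The normals [n_1, ..., n_6], indexed by the integers modulo 6, so that
   [n_6] is [nrm R 0]. Note that [n_6 = - n_3 = eta3^perp]. Their values are
   exactly the six elements of [{+- eta_k^perp}]. *)
Definition nrm (R : realType) (j : 'Z_6) : R * R :=
  nth 0 [:: perp (eta3 R); perp (eta1 R); perp (eta2 R);
            - perp (eta3 R); - perp (eta1 R); - perp (eta2 R)] j.

(* The dual cell [H], a multiple of the convex hull of the six [nrm R j]. *)
Definition cell (R : realType) : set (R * R) :=
  [set (Num.sqrt 3 / 3) *: (\sum_(j : 'Z_6) w j *: nrm R j)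
  | w in [set w : 'Z_6 -> R | (forall j, 0 <= w j) /\ \sum_j w j = 1]].

Definition cell_at (R : realType) (eps : R) (i : R * R) : set (R * R) :=
  [set i + eps *: y | y in @cell R].

Definition cells (R : realType) (eps : R) (I : set (R * R)) : set (R * R) :=
  \bigcup_(i in I) cell_at eps i.

Definition admissible (R : realType) (eps : R) (E : set (R * R)) : Prop :=
  exists2 I : set (R * R), I `<=` lattice eps & E = cells eps I.

Definition perimeter (R : realType) (E : set (R * R)) : \bar R :=
  hausdorff1 (boundary E).

Definition dual_norm (R : realType) (x : R * R) : R :=
  Num.sqrt 3 / 2 *
  Num.max `|dot x (perp (eta1 R))|
    (Num.max `|dot x (perp (eta2 R))| `|dot x (perp (eta3 R))|).

(* On the null set of points lying in several cells, the infimum runs over all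
   of these cells. It is [+oo] when there is no admissible [j]. *)
Definition discrete_dist (R : realType) (eps : R) (F : set (R * R))
    (x : R * R) : \bar R :=
  ereal_inf [set d : \bar R | exists i j : R * R,
    [/\ lattice eps i, lattice eps j, cell_at eps i x,
        (~ F x -> cell_at eps j `<=` F) /\
        (F x -> ~ (cell_at eps j `<=` F))
      & d = (dual_norm (i - j))%:E]].

Definition lebesgue2 (R : realType) :
    set (measurableTypeR R * measurableTypeR R)%type -> \bar R :=
  ((@lebesgue_measure R) \x (@lebesgue_measure R))%E.

Definition energy (R : realType) (tau eps : R) (E F : set (R * R)) : \bar R :=
  (perimeter E +
   (tau^-1)%:E *
   \int[@lebesgue2 R]_(x in (E `\` F) `|` (F `\` E)) discrete_dist eps F x)%E.

Definition minimizer (R : realType) (tau eps : R) (F E : set (R * R)) : Prop :=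
  admissible eps E /\
  forall G, admissible eps G -> (energy tau eps E F <= energy tau eps G F)%E.

(* [nu] is the exterior unit normal of [A] along the side from [a] to [b]. *)
Definition exterior_normal (R : realType) (A : set (R * R)) (a b nu : R * R) :
    Prop :=
  [/\ enorm nu = 1, dot (b - a) nu = 0 &
    forall x, segment_oo a b x ->
      exists2 d : R, 0 < d &
        forall r, 0 < r < d -> ~ A (x + r *: nu) /\ A (x - r *: nu)].

(* The boundary of [A] is the simple closed polygon with vertices
   [p 0, ..., p (m - 1)] in this cyclic order; simplicity is expressed by the
   disjointness of the half-open sides. The [k]-th side goes from [p k] to
   [p (ordS k)] and has normal [nu k]. *)
Definition wulff_polygon (R : realType) (A : set (R * R)) (m : nat)
    (p nu : 'I_m -> R * R) : Prop :=
  [/\ (2 < m)%N /\ (forall k, p k <> p (ordS k)),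
      boundary A = \bigcup_(k in [set: 'I_m]) segment (p k) (p (ordS k)),
      trivIset [set: 'I_m] (fun k => segment_co (p k) (p (ordS k))),
      forall k, exterior_normal A (p k) (p (ordS k)) (nu k) &
      (forall k, exists j, nu k = nrm R j) /\
      (forall k j, nu k = nrm R j ->
         nu (ordS k) = nrm R (j - 1) \/ nu (ordS k) = nrm R (j + 1))].

Definition wulff_like (R : realType) (A : set (R * R)) : Prop :=
  bounded_set A /\ exists m (p nu : 'I_m -> R * R), wulff_polygon A p nu.

(* Being Wulff-like determines a bounded set only up to boundary points; the
   hexagons are taken closed. *)
Definition wulff_hexagon (R : realType) (A : set (R * R)) : Prop :=
  [/\ closed A, convex_set (A : set (convex_lmodType (R * R)%type))
    & wulff_like A].

(* [S i] is the side of [A] with exterior normal [n_i]. *)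
Definition wulff_sides (R : realType) (A : set (R * R))
    (S : 'Z_6 -> set (R * R)) : Prop :=
  exists m (p nu : 'I_m -> R * R), wulff_polygon A p nu /\
    forall i, exists2 k, nu k = nrm R i & S i = segment (p k) (p (ordS k)).

Definition discrete_hexagon (R : realType) (eps : R) (E : set (R * R)) : Prop :=
  exists2 K, wulff_hexagon K &
    E = cells eps [set i | lattice eps i /\ cell_at eps i `<=` K].

(* [W] is the Wulff-like envelope of [E], i.e. the least hexagon containing it. *)
Definition wulff_envelope (R : realType) (E W : set (R * R)) : Prop :=
  [/\ wulff_hexagon W, E `<=` W
    & forall K, wulff_hexagon K -> E `<=` K -> W `<=` K].

(* Distance from the origin of a side [S] with normal [nu], i.e. of the straight
   line containing it: the orthogonal projection of the origin onto this line
   need not belong to [S]. *)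
Definition side_dist (R : realType) (nu : R * R) (S : set (R * R)) : R :=
  fine (edist_set 0 [set x | exists2 y, S y & dot (x - y) nu = 0]).

Definition side_length (R : realType) (S : set (R * R)) : R :=
  fine (hausdorff1 S).

Definition alpha_hex (R : realType) : R := 16 / 9.

Definition velocity_law (R : realType) (gam L v : R) : Prop :=
  let q := alpha_hex R * gam / L in
  (q \isn't a Num.nat ->
     v = Num.sqrt 3 / 2 * (gam^-1 * (Num.floor q)%:~R)) /\
  (q \is a Num.nat ->
     Num.sqrt 3 / 2 * (gam^-1 * (q - 1)) <= v <=
     Num.sqrt 3 / 2 * (alpha_hex R / L)).

(* Main.v *)
Require Import Defs.
From HB Require Import structures.
From mathcomp Require Import all_boot all_order all_algebra.
From mathcomp Require Import all_classical all_reals all_analysis.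
From mathcomp Require Import measurable_realfun finmap zify ring lra.

Set Implicit Arguments.
Unset Strict Implicit.
Unset Printing Implicit Defensive.

Import Order.TTheory GRing.Theory Num.Theory.
Import numFieldNormedType.Exports.

Local Open Scope classical_set_scope.
Local Open Scope ring_scope.

(** The problem is first made combinatorial. Write a lattice point as a pair of
    integers. On a union of cells indexed by a finite set [Z], the energy with
    respect to the cells indexed by [F] is [eps * sqrt 3 / 3] times
    [B(Z) + lam * C(Z)] with [lam = 9 eps / (8 gam)]: [B] counts the boundary
    edges ([perimeter_reg]) and [C] sums over the symmetric difference of [Z] and
    [F] the number of rows separating a cell from the other side
    ([integral_discrepancy], [minimizer_minimal]). An infinite [Z] has infinite
    energy.

    Let [F] be a lattice hexagon such that [lam] times the number of points of each
    side is bounded below, and let [lam] be small. A minimizer is again a hexagon,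
    with each side moved inwards by a bounded number of rows ([minimal_hexset]).
    Indeed [B(Z)] is at least the number of lattice lines meeting [Z], with
    equality for hexagons; so a minimizer pays at most one edge for every line of
    [F] that it misses, and lines lying deep inside [F] are too heavy to be missed;
    a missed line near a side isolates a thin piece that is cheaper to delete;
    finally the smallest hexagon around [Z] has no more edges than [Z].
    Adding or removing one row at the side [j] of such a hexagon changes [B] by 2
    and [C] by about [k] times the number [N] of cells of this side, [k] being the
    number of rows that the side has moved. Hence [k] is the integer part of
    [2 / (lam N)] up to the boundedly many cells lost at the corners
    ([minimal_rate]). Since [eps * N] is the length [L] up to [O(eps)],
    [2 / (lam N)] tends to [16 gam / (9 L)], which is where [alpha_hex] comes from.

    Origin symmetry is the delicate hypothesis to propagate, because a
    minimizer need not be unique. If [Z] is one, so is [- Z], and submodularity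
    makes their intersection and their union minimizers as well. When [lam] is
    irrational, two minimizers have the same [C], so that intersection and union
    coincide ([minimal_opp]). As the convergence is claimed along a sequence of
    scales only, these are chosen with [lam] a rational multiple of [sqrt 2]
    ([irrational_scales]).

    Each side then moves by a bounded number of rows per step, so that lengths stay
    bounded below until some time [T] independent of [eps] ([evolution]). The
    positions of the sides are monotone in time and Lipschitz up to [O(eps)], hence
    converge uniformly along a subsequence ([helly_selection]). Near a given time
    the lengths hardly vary, so the number of rows per step is pinned between two
    integers which agree unless [alpha_hex * gam / L] is an integer
    ([limit_speed]); this passes to the limit and gives the velocity law wherever
    the positions are differentiable, that is almost everywhere
    ([lipschitz_ae_derivable]). The law of the lengths is linear in that of the
    positions. *)

Local Notation s3 := (Num.sqrt 3).

(** * Hexagons of lattice points *)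

(** In lattice units and in the basis [eta1], [eta2], this is the coordinate in the
    direction of the normal [nrm j], multiplied by [2 / sqrt 3] to be an integer. *)
Definition hform (j : 'Z_6) (x : int * int) : int :=
  nth 0 [:: x.1 + x.2; x.2; - x.1; - (x.1 + x.2); - x.2; x.1] j.

(** The step along the side with normal [nrm j]. The six steps are the neighbours
    of the origin. *)
Definition dirv (j : 'Z_6) : int * int :=
  nth 0 [:: (-1, 1); (-1, 0); (0, -1); (1, -1); (1, 0); (0, 1)] j.

Definition ptof (j : 'Z_6) (u w : int) : int * int :=
  nth 0 [:: (u - w, w); (- w, u); (- u, u - w); (w - u, - w); (w, - u);
            (u, w - u)] j.

Arguments hform j%_R x%_R.
Arguments dirv j%_R.

Lemma Z6_ind (P : 'Z_6 -> Prop) :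
  P 0 -> P 1 -> P 2 -> P 3 -> P 4 -> P 5 -> forall j, P j.
Proof.
move=> P0 P1 P2 P3 P4 P5 j.
have : j \in [:: 0; 1; 2; 3; 4; 5 : 'Z_6] by case: j => [[|[|[|[|[|[|]]]]]]].
by rewrite !inE => /orP[/eqP->//|/orP[/eqP->//|/orP[/eqP->//|/orP[/eqP->//|
  /orP[/eqP->//|/eqP->//]]]]].
Qed.

(** Case analysis relative to [j], which avoids splitting on the value of [j]. *)
Lemma Z6_all (P : 'Z_6 -> Prop) (j : 'Z_6) :
  P j -> P (j + 1) -> P (j + 2) -> P (j + 3) -> P (j + 4) -> P (j + 5) ->
  forall i, P i.
Proof.
move=> P0 P1 P2 P3 P4 P5 i; rewrite -(subrK j i) addrC.
by move: (i - j); apply: Z6_ind => //; rewrite addr0.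
Qed.

Lemma form1 j x : hform (j - 1) x = hform j x - hform (j + 1) x.
Proof. by move: j; apply: Z6_ind; rewrite /hform /=; lia. Qed.
Lemma form2 j x : hform (j + 2) x = hform (j + 1) x - hform j x.
Proof. by move: j; apply: Z6_ind; rewrite /hform /=; lia. Qed.
Lemma form3 j x : hform (j + 3) x = - hform j x.
Proof. by move: j; apply: Z6_ind; rewrite /hform /=; lia. Qed.
Lemma form4 j x : hform (j + 4) x = - hform (j + 1) x.
Proof. by move: j; apply: Z6_ind; rewrite /hform /=; lia. Qed.
Lemma form5 j x : hform (j + 5) x = hform j x - hform (j + 1) x.
Proof. by move: j; apply: Z6_ind; rewrite /hform /=; lia. Qed.

Lemma formD j x y : hform j (x + y) = hform j x + hform j y.
Proof. by move: j; apply: Z6_ind; rewrite /hform /=; lia. Qed.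
Lemma formN j x : hform j (- x) = - hform j x.
Proof. by move: j; apply: Z6_ind; rewrite /hform /=; lia. Qed.
Lemma form_dir j : hform j (dirv j) = 0.
Proof. by move: j; apply: Z6_ind. Qed.
Lemma form_dir1 j : hform (j + 1) (dirv j) = 1.
Proof. by move: j; apply: Z6_ind. Qed.
Lemma dirv3 j : dirv (j + 3) = - dirv j.
Proof. by move: j; apply: Z6_ind. Qed.

Lemma form_ptof j u w : hform j (ptof j u w) = u.
Proof. by move: j; apply: Z6_ind; rewrite /hform /=; lia. Qed.
Lemma form_ptof1 j u w : hform (j + 1) (ptof j u w) = w.
Proof. by move: j; apply: Z6_ind; rewrite /hform /=; lia. Qed.

(** Two consecutive normals are a basis, so all identities between the forms can be
    checked on the forms [j] and [j + 1]. *)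
Lemma form_inj j x y :
  hform j x = hform j y -> hform (j + 1) x = hform (j + 1) y -> x = y.
Proof.
case: x => a b; case: y => c d; move: j; apply: Z6_ind;
  rewrite /hform /= => e1 e2; congr pair; lia.
Qed.

Definition inhex (m : 'Z_6 -> int) (x : int * int) := [forall j, hform j x <= m j].

Lemma inhexP m x : reflect (forall j, hform j x <= m j) (inhex m x).
Proof. exact: forallP. Qed.

Lemma inhex_at j m x : inhex m x <->
  [/\ hform j x <= m j /\ - hform j x <= m (j + 3),
      hform (j + 1) x <= m (j + 1) /\ - hform (j + 1) x <= m (j + 4) &
      hform (j + 1) x - hform j x <= m (j + 2) /\
      hform j x - hform (j + 1) x <= m (j + 5)].
Proof.
split=> [/inhexP h|[[h0 h3] [h1 h4] [h2 h5]]].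
  have [h3 h4] := (h (j + 3), h (j + 4)); have [h2 h5] := (h (j + 2), h (j + 5)).
  by move: h2 h3 h4 h5; rewrite form2 form3 form4 form5; split; split.
by apply/inhexP; apply: (@Z6_all _ j) => //;
  rewrite ?form2 ?form3 ?form4 ?form5.
Qed.

Definition hexbox (m : 'Z_6 -> int) : seq (int * int) :=
  [seq (- m 2 + i%:Z, - m 4 + k%:Z) | i <- iota 0 (absz (m 2 + m 5 + 1)),
                                     k <- iota 0 (absz (m 4 + m 1 + 1))].

(** Locked, since unfolding the enumeration is never wanted. *)
HB.lock Definition hexset (m : 'Z_6 -> int) : {fset int * int} :=
  [fset x in hexbox m | inhex m x]%fset.

Lemma in_hexset m x : (x \in hexset m) = inhex m x.
Proof.
rewrite hexset.unlock !inE/=; case: (boolP (inhex m x)) => [/inhexP h|_]; last first.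
  by rewrite andbF.
rewrite andbT; case: x h => a b h; apply/allpairsPdep.
have [h1 h2 h4 h5] := And4 (h 1) (h 2) (h 4) (h 5).
move: h1 h2 h4 h5; rewrite /hform/= => h1 h2 h4 h5.
exists (absz (a + m 2)), (absz (b + m 4)); rewrite !mem_iota; split; [lia|lia|].
congr pair; lia.
Qed.

Section Counts.
Local Open Scope fset_scope.
Implicit Types (I A G : {fset int * int}) (j : 'Z_6).

(** An element of [exits j I] together with [j] is a boundary edge of [I], so
    that [bsize I] is the perimeter in numbers of edges. *)
Definition exits j I : {fset int * int} := [fset x in I | (x + dirv j)%R \notin I].
Definition lines j I : {fset int} := [fset hform j x | x in I].
Definition bsize I : nat := \sum_(j : 'Z_6) #|` exits j I|.

Lemma in_exits j I x : (x \in exits j I) = (x \in I) && ((x + dirv j)%R \notin I).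
Proof. by rewrite !inE. Qed.

Lemma exits_exist j I x : x \in I -> exists2 y, y \in exits j I & hform j y = hform j x.
Proof.
move=> xI.
pose P (y : I) := hform j (val y) == hform j x.
pose x0 : I := [` xI].
have Px0 : P x0 by rewrite /P.
have [y /eqP yx ymax] := @Order.TotalTheory.arg_maxP _ _ I x0 P (fun y => hform (j + 1) (val y)) Px0.
exists (val y) => //; rewrite !inE/= (valP y)/=; apply/negP => yI.
have /ymax : P [` yI] by rewrite /P/= formD form_dir addr0 yx.
by rewrite /= formD form_dir1; lia.
Qed.

Lemma lines_exits j I : lines j I = lines j (exits j I).
Proof.
apply/fsetP => c; apply/imfsetP/imfsetP => -[x /= xI ->].
  by have [y yI <-] := exits_exist j xI; exists y.
by exists x => //; move: xI; rewrite !inE => /andP[].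
Qed.

(** The last point of [I] on a line parallel to [dirv j] exits through [j]. *)
Lemma card_lines j I : (#|` lines j I| <= #|` exits j I|)%N.
Proof. by rewrite lines_exits; exact: leq_imfset_card. Qed.

(** A line meets a convex set in an interval, which has only one exit. *)
Lemma card_exits_hexset j m : #|` exits j (hexset m)| = #|` lines j (hexset m)|.
Proof.
have inj : {in exits j (hexset m) &, injective (hform j)}; last first.
  by rewrite lines_exits; move/card_in_imfsetP/eqP: inj => /esym.
move=> x y; rewrite !in_exits !in_hexset => /andP[xm xn] /andP[ym yn] exy.
have key u v : hform j u = hform j v -> inhex m u -> inhex m v ->
    ~~ inhex m (u + dirv j)%R -> hform (j + 1) v <= hform (j + 1) u.
  move=> uv um vm; apply: contraNT; rewrite -ltNge => lt.
  apply/(inhex_at j); rewrite !formD form_dir form_dir1.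
  move/(inhex_at j) : um => [[? ?] [? ?] [? ?]].
  move/(inhex_at j) : vm => [[? ?] [? ?] [? ?]].
  by split; split; lia.
apply: (@form_inj j) => //; apply/eqP; rewrite eq_le.
by rewrite (key _ _ exy)// (key _ _ (esym exy)).
Qed.

(** Holds pointwise: an edge that leaves the union or the intersection leaves one of
    the two sets, and an edge leaving both leaves both sets. *)
Lemma exits_submod j A G :
  (#|` exits j (A `&` G)| + #|` exits j (A `|` G)| <=
   #|` exits j A| + #|` exits j G|)%N.
Proof.
have H (I U : {fset int * int}) : I `<=` U -> #|` exits j I| =
    (\sum_(x <- U) ((x \in I) && ((x + dirv j)%R \notin I) : nat))%N.
  move=> /fsubsetP IU; rewrite -big_mkcond/= big_fset_condE -card_fset_sum1.
  congr #|` _|; apply/fsetP => x; rewrite !inE/=.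
  by have [/IU ->|] := boolP (x \in I); rewrite ?andbF.
rewrite (H A (A `|` G)) ?fsubsetUl// (H G (A `|` G)) ?fsubsetUr//.
rewrite (H (A `&` G) (A `|` G)); last by rewrite fsubIset// fsubsetUl.
rewrite (H (A `|` G) (A `|` G))// -!big_split/=.
apply: leq_sum => x _; rewrite !inE.
by do ![case: (_ \in _)].
Qed.

Lemma bsize_submod A G :
  (bsize (A `&` G) + bsize (A `|` G) <= bsize A + bsize G)%N.
Proof. by rewrite -!big_split/=; apply: leq_sum => j _; exact: exits_submod. Qed.

Lemma bsize_lines I : (\sum_(j : 'Z_6) #|` lines j I| <= bsize I)%N.
Proof. by apply: leq_sum => j _; exact: card_lines. Qed.

Lemma bsize_hexset m : bsize (hexset m) = (\sum_(j : 'Z_6) #|` lines j (hexset m)|)%N.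
Proof. by apply: eq_bigr => j _; exact: card_exits_hexset. Qed.

Lemma linesS j A G : A `<=` G -> lines j A `<=` lines j G.
Proof.
move=> /fsubsetP AG; apply/fsubsetP => c /imfsetP[x /= xA ->].
by apply/imfsetP; exists x => //; exact: AG.
Qed.

(** The hexagon minimizes the number of edges among the sets containing it, since it
    has only one exit per line. *)
Lemma bsize_hexset_sub m A : hexset m `<=` A -> (bsize (hexset m) <= bsize A)%N.
Proof.
move=> mA; rewrite bsize_hexset (leq_trans _ (bsize_lines _))//.
by apply: leq_sum => j _; apply: fsubset_leq_card; exact: linesS.
Qed.

(** Submodularity and the minimality of the hexagon for its edges. *)
Lemma bsizeI_hexset m A : (bsize (A `&` hexset m) <= bsize A)%N.
Proof.
have := bsize_submod A (hexset m).
by have := @bsize_hexset_sub m (A `|` hexset m) (fsubsetUr _ _); lia.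
Qed.

(** Two sets without neighbouring points share no edge. *)
Lemma bsizeU A G : (forall x j, x \in A -> (x + dirv j)%R \in G -> false) ->
  [disjoint A & G] ->
  (forall x j, x \in G -> (x + dirv j)%R \in A -> false) ->
  bsize (A `|` G) = (bsize A + bsize G)%N.
Proof.
move=> AG dis GA; rewrite -big_split/=; apply: eq_bigr => j _.
rewrite -cardfsUI [X in (_ + #|` X|)%N](_ : _ = fset0); last first.
  apply/fsetP => x; rewrite !inE.
  have /fdisjointP/(_ x) := dis.
  by case: (x \in A) => //= /(_ isT) /negbTE ->; rewrite ?andbF.
rewrite cardfs0 addn0; congr #|` _|; apply/fsetP => x; rewrite !inE.
have : ~~ ((x \in A) && ((x + dirv j)%R \in G)) by apply/negP => /andP[/AG/[apply]].
have : ~~ ((x \in G) && ((x + dirv j)%R \in A)) by apply/negP => /andP[/GA/[apply]].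
move: (x \in A) (x \in G) ((x + dirv j)%R \in A) ((x + dirv j)%R \in G).
by do 4 case.
Qed.
End Counts.

(** The number of points of the side [j] of the lattice hexagon when this is at least
    1, in which case all six constraints are tight. *)
Definition slen (m : 'Z_6 -> int) (j : 'Z_6) : int := m (j - 1) + m (j + 1) - m j + 1.

(** A multirule computing indices modulo 6, where [addrA] would also regroup the
    numerals. *)
Lemma Z6E (j : 'Z_6) : (j + 5 = j - 1) * (j + 1 + 1 = j + 2) * (j + 1 - 1 = j) *
  (j + 2 - 1 = j + 1) * (j + 2 + 1 = j + 3) * (j + 3 - 1 = j + 2) *
  (j + 3 + 1 = j + 4) * (j + 4 - 1 = j + 3) * (j + 4 + 1 = j + 5) *
  (j + 5 - 1 = j + 4) * (j + 5 + 1 = j) * (j + 3 + 3 = j) * (j + 3 + 4 = j + 1)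
  * (j + 3 + 2 = j + 5) * (j + 3 + 5 = j + 2) * (j - 1 - 1 = j + 4) * (j - 1 + 1 = j).
Proof. by move: j; apply: Z6_ind; do !split; apply/eqP. Qed.

Section Lines.

(** The four bounds on [p] say that the line meets the hexagon [mu] in at least
    [p] points: each end of the interval is the binding one of two constraints. *)
Lemma line_sum (mu : 'Z_6 -> int) (j : 'Z_6) (c : int) (p r : nat)
    (A : {fset int * int}) (d : int * int -> nat) :
  c <= mu j -> - c <= mu (j + 3) ->
  p%:Z <= mu (j + 1) + mu (j + 4) + 1 ->
  p%:Z <= mu (j + 1) + mu (j - 1) - c + 1 ->
  p%:Z <= mu (j + 2) + mu (j + 4) + c + 1 ->
  p%:Z <= mu (j + 2) + mu (j - 1) + 1 ->
  (forall x, inhex mu x -> hform j x = c -> (x \in A) && (r <= d x)%N) ->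
  (r * p <= \sum_(x <- A) d x)%N.
Proof.
move=> c1 c2 h1 h2 h3 h4 hA.
pose lo := Num.max (- mu (j + 4)) (c - mu (j - 1)).
pose f (i : nat) := ptof j c (lo + i%:Z).
have fi (i : nat) : (i < p)%N -> (f i \in A) && (r <= d (f i))%N.
  move=> ip; apply: hA; last by rewrite form_ptof.
  apply/(inhex_at j); rewrite form_ptof form_ptof1 (Z6E j) /lo.
  by split; split=> //; lia.
have finj : {in iota 0 p &, injective f}.
  by move=> i k _ _ /(congr1 (hform (j + 1))); rewrite !form_ptof1 => /addrI[].
pose J := [fset f i | i in iota 0 p]%fset.
have cJ : #|` J| = p.
  by rewrite card_in_imfset//= undup_id ?iota_uniq// size_iota.
have JA x : x \in J -> (x \in A) && (r <= d x)%N.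
  by move=> /imfsetP[i /=]; rewrite mem_iota => /andP[_ ip] ->; exact: fi.
rewrite (big_fsetID _ (fun x => x \in J))/= -[leqLHS]addn0 leq_add//.
rewrite (_ : [fset x in A | x \in J]%fset = J); last first.
  apply/fsetP => x; rewrite !inE/= andb_idl//.
  by move=> /JA/andP[].
rewrite -cJ card_fset_sum1 big_distrr/= !big_seq.
by apply: leq_sum => x /JA/andP[_]; rewrite muln1.
Qed.

(** Since all sides are nonempty, no line between two parallel sides is missed. *)
Lemma lines_hexset (mu : 'Z_6 -> int) (j : 'Z_6) c :
  (forall i, 1 <= slen mu i) ->
  (c \in lines j (hexset mu)) = (- mu (j + 3) <= c <= mu j).
Proof.
move=> hl; apply/imfsetP/idP => [[x /= + ->]|/andP[c1 c2]].
  by rewrite in_hexset => /(inhex_at j)[[? ?] _ _]; lia.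
pose lo := Num.max (- mu (j + 4)) (c - mu (j - 1)).
exists (ptof j c lo); last by rewrite form_ptof.
have := hl j; have := hl (j + 1); have := hl (j + 2); have := hl (j + 3).
have := hl (j + 4); have := hl (j + 5).
rewrite /= in_hexset /slen !(Z6E j) => *.
apply/(inhex_at j); rewrite form_ptof form_ptof1 (Z6E j) /lo.
by split; split=> //; lia.
Qed.

Lemma card_lines_hexset (mu : 'Z_6 -> int) (j : 'Z_6) :
  (forall i, 1 <= slen mu i) ->
  (#|` lines j (hexset mu)|%:Z = mu j + mu (j + 3) + 1).
Proof.
move=> hl; have := hl (j + 1); have := hl (j + 2).
rewrite /slen !(Z6E j) => l1 l2.
pose n := absz (mu j + mu (j + 3) + 1).
have nE : n%:Z = mu j + mu (j + 3) + 1.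
  by have := hl (j + 4); have := hl (j + 5); rewrite /slen !(Z6E j) /n; lia.
rewrite -nE; congr Posz.
pose g (i : nat) := - mu (j + 3) + i%:Z.
rewrite (_ : lines _ _ = [fset g i | i in iota 0 n]%fset).
  rewrite card_imfset/=; first by rewrite undup_id ?iota_uniq// size_iota.
  by move=> a b /addrI[].
apply/fsetP => c; rewrite lines_hexset//; apply/idP/imfsetP => /=.
  move=> /andP[c1 c2]; exists (absz (c + mu (j + 3))); last by rewrite /g; lia.
  by rewrite mem_iota; lia.
by move=> [i]; rewrite mem_iota /g => ? ->; lia.
Qed.

Lemma card_lines_le (I : {fset int * int}) (j : 'Z_6) (a b : int) (n : nat) :
  (forall x, x \in I -> a <= hform j x <= b) -> b - a + 1 <= n%:Z ->
  (#|` lines j I| <= n)%N.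
Proof.
move=> h hn.
pose g (i : nat) := a + i%:Z.
apply: (@leq_trans #|` [fset g i | i in iota 0 n]%fset|).
  apply: fsubset_leq_card; apply/fsubsetP => c /imfsetP[x /= /h xab ->].
  apply/imfsetP; exists (absz (hform j x - a)) => /=; last by rewrite /g; lia.
  by rewrite mem_iota; lia.
by rewrite (leq_trans (leq_imfset_card _ _ _))//= undup_id ?iota_uniq// size_iota.
Qed.

Lemma sum_Z6 (V : nmodType) (f : 'Z_6 -> V) : \sum_(j : 'Z_6) f j = f 0 + f 1 + f 2 + f 3 + f 4 + f 5.
Proof.
rewrite /= !big_ord_recl big_ord0 !addrA addr0.
by do ![congr (_ + _)]; congr f; apply: val_inj.
Qed.

Lemma sum_Z6_shift (V : nmodType) (f : 'Z_6 -> V) (k : 'Z_6) :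
  \sum_(j : 'Z_6) f (j + k) = \sum_(j : 'Z_6) f j.
Proof.
rewrite [RHS](reindex_inj (h := fun j => j + k))//.
exact: addIr.
Qed.

(** A perimeter counted by lines is a sum of widths. It grows by 2 whenever one
    side moves outwards by one row. *)
Lemma bsize_hexsetE (mu : 'Z_6 -> int) :
  (forall i, 1 <= slen mu i) ->
  ((bsize (hexset mu))%:Z = (\sum_j mu j) *+ 2 + 6).
Proof.
move=> hl; rewrite bsize_hexset -natz natr_sum mulr2n.
rewrite (eq_bigr (fun j => mu j + mu (j + 3) + 1)); last first.
  by move=> j _; rewrite natz card_lines_hexset.
by rewrite !big_split/= sum_Z6_shift sumr_const card_ord.
Qed.

End Lines.

Lemma top_line (m : 'Z_6 -> int) j : (forall i, 1 <= slen m i) -> m j \in lines j (hexset m).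
Proof.
move=> ml; have := ml (j + 4); have := ml (j + 5); rewrite /slen !(Z6E j) => h4 h5.
by rewrite lines_hexset// lexx andbT; move: h4 h5; clear; lia.
Qed.

(** * Minimizers of the discrete functional *)

Section Minimizers.
Context {R : realFieldType}.
Variables (lam : R) (m : 'Z_6 -> int) (d : int * int -> nat).
Hypothesis lam0 : 0 < lam.
Hypothesis d1 : forall x, (1 <= d x)%N.
Hypothesis dP : forall x (r : nat), inhex m x ->
  reflect (forall j, hform j x + r%:Z <= m j + 1) (r <= d x)%N.
Local Notation F := (hexset m).

Definition cost (I : {fset int * int}) : nat :=
  (\sum_(x <- (I `\` F)%fset) d x + \sum_(x <- (F `\` I)%fset) d x)%N.

Definition total (I : {fset int * int}) : R := (bsize I)%:R + lam * (cost I)%:R.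

Lemma sum_d_eq0 (A : {fset int * int}) : (\sum_(x <- A) d x)%N = 0%N -> A = fset0.
Proof.
have [->//|[x xA]] := fset_0Vmem A.
rewrite (big_fsetD1 x xA)/= => /eqP; rewrite addn_eq0 => /andP[+ _].
by have := d1 x; lia.
Qed.

Lemma cost_sub I : (I `<=` F)%fset -> cost I = (\sum_(x <- (F `\` I)%fset) d x)%N.
Proof.
rewrite -fsetD_eq0 => /eqP IF.
by rewrite /cost IF big_seq_fset0 add0n.
Qed.

Lemma cost_nest I G : (I `<=` G)%fset -> (G `<=` F)%fset ->
  cost I = (cost G + \sum_(x <- (G `\` I)%fset) d x)%N.
Proof.
move=> IG GF; rewrite !cost_sub//; last exact: fsubset_trans GF.
rewrite (big_fsetID _ (fun x => x \notin G) (F `\` I)%fset)/=; congr addn.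
  apply: eq_fbigl => x; rewrite !inE/=.
  move/fsubsetP : IG => /(_ x) /implyP.
  by move: (x \in I) (x \in G) (x \in F) => [] [] [].
apply: eq_fbigl => x; rewrite !inE/=.
move/fsubsetP : GF => /(_ x) /implyP.
by move: (x \in I) (x \in G) (x \in F) => [] [] [].
Qed.

Definition minimal (I : {fset int * int}) := forall G, total I <= total G.

Variable I : {fset int * int}.
Hypothesis Imin : minimal I.

(** The cost is strictly monotone between [I] and [F]. *)
Lemma minimal_eq G : (I `<=` G)%fset -> (G `<=` F)%fset ->
  (bsize G <= bsize I)%N -> I = G.
Proof.
move=> IG GF B; have := Imin G; rewrite /total (cost_nest IG GF) natrD mulrDr.
move=> h; have : lam * (\sum_(x <- (G `\` I)%fset) d x)%N%:R <= 0.
  have : ((bsize G)%:R <= (bsize I)%:R :> R) by rewrite ler_nat.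
  lra.
rewrite pmulr_rle0// lern0 => /eqP/sum_d_eq0/eqP; rewrite fsetD_eq0 => GI.
by apply/eqP; rewrite eqEfsubset IG.
Qed.

(** Intersecting with the hexagon [F] does not increase the number of edges and
    strictly decreases the cost of what lies outside. *)
Lemma minimal_sub : (I `<=` F)%fset.
Proof.
have := Imin (I `&` F)%fset; rewrite /total /cost.
have -> : ((I `&` F) `\` F = fset0)%fset.
  by apply/eqP; rewrite fsetD_eq0 fsubsetIr.
have -> : (F `\` (I `&` F) = F `\` I)%fset.
  by apply/fsetP => x; rewrite !inE negb_and; case: (x \in F); rewrite ?orbF ?andbF.
rewrite big_seq_fset0 add0n natrD mulrDr => h.
have : lam * (\sum_(x <- (I `\` F)%fset) d x)%N%:R <= 0.
  have : ((bsize (I `&` F)%fset)%:R <= (bsize I)%:R :> R).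
    by rewrite ler_nat bsizeI_hexset.
  lra.
by rewrite pmulr_rle0// lern0 => /eqP/sum_d_eq0/eqP; rewrite fsetD_eq0.
Qed.

Let IF := minimal_sub.

Definition lweight j c : nat := (\sum_(x <- F | hform j x == c) d x)%N.
Definition missed j : {fset int} := (lines j F `\` lines j I)%fset.

(** The points of [F] on the missed lines are all deleted. *)
Lemma missed_weight j : (\sum_(c <- missed j) lweight j c <= cost I)%N.
Proof.
rewrite cost_sub// /lweight (exchange_big_dep xpredT)//=.
have -> : (F `\` I = [fset x in F | x \notin I])%fset.
  by apply/fsetP => x; rewrite !inE/= andbC.
rewrite -(big_fset_condE _ F (fun x => x \notin I))/= [leqRHS]big_mkcond/=.
rewrite !big_seq; apply: leq_sum => x xF.
have [xI|xI] /= := boolP (x \in I).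
  rewrite big1_seq// => c /andP[/eqP <-]; rewrite !inE => /andP[/negP[]].
  by apply/imfsetP; exists x.
have [xm|xm] := boolP (hform j x \in missed j).
  rewrite (eq_bigl (fun c => c == hform j x)); last by move=> c; rewrite eq_sym.
  by rewrite (@fbig_pred1_inj _ _ _ _ _ _ id).
by rewrite big1_seq// => c /andP[/eqP <-]; rewrite (negPf xm).
Qed.

(** [F] has exactly one edge for each pair of a direction and a line, and [I] at least
    one for each line that it meets. *)
Lemma bsize_missed : (bsize F <= bsize I + \sum_(j : 'Z_6) #|` missed j|)%N.
Proof.
rewrite bsize_hexset (leq_trans _ (leq_add (bsize_lines I) (leqnn _)))//.
rewrite -big_split/=; apply: leq_sum => j _.
by rewrite addnC cardfsD (fsetIidPr _) ?linesS// subnK// fsubset_leq_card// linesS.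
Qed.

(** Comparison with [F] itself: the six families of missed lines may overlap, whence
    the factor 6. *)
Lemma missed_ineq :
  lam * (\sum_(j : 'Z_6) \sum_(c <- missed j) lweight j c)%N%:R <=
  6%:R * (\sum_(j : 'Z_6) #|` missed j|)%N%:R.
Proof.
have h1 : (\sum_(j : 'Z_6) \sum_(c <- missed j) lweight j c <= 6 * cost I)%N.
  rewrite (@leq_trans (\sum_(j : 'Z_6) cost I))//.
    by apply: leq_sum => j _; exact: missed_weight.
  by rewrite sum_nat_const card_ord.
have h2 := bsize_missed.
have := Imin F; rewrite /total (cost_sub (fsubset_refl F)) fsetDv big_seq_fset0 mulr0 addr0.
move: h1 h2; rewrite -!(ler_nat R) natrM natrD => h1 h2 h3.
apply: (@le_trans _ _ (lam * (6 * (cost I)%:R))); first by rewrite ler_pM2l.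
by rewrite mulrCA ler_pM2l//; lra.
Qed.

Section Symmetry.
Hypothesis notie : forall a b : int, a%:~R + lam * b%:~R = 0 -> b = 0.
Hypothesis msym : forall j, m (j + 3) = m j.

Let N (A : {fset int * int}) : {fset int * int} := [fset (- x)%R | x in A]%fset.

Let inN A x : (x \in N A) = (- x \in A).
Proof.
apply/imfsetP/idP => [[y /= yA ->]|xA]; first by rewrite opprK.
by exists (- x) => //=; rewrite opprK.
Qed.

Let inFN x : (- x \in F) = (x \in F).
Proof.
rewrite !in_hexset; apply/inhexP/inhexP => h j; have := h (j + 3); rewrite msym formN form3; lia.
Qed.

Let dN x : x \in F -> d (- x) = d x.
Proof.
move=> xF; have nxF : - x \in F by rewrite inFN.
rewrite !in_hexset in xF nxF.
apply/eqP; rewrite eqn_leq; apply/andP; split; apply/dP => // j.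
  by have /(dP _ nxF)/(_ (j + 3)) := leqnn (d (- x)); rewrite msym formN form3 opprK.
by have /(dP _ xF)/(_ (j + 3)) := leqnn (d x); rewrite msym form3 formN.
Qed.

Let bsizeN A : bsize (N A) = bsize A.
Proof.
rewrite /bsize [RHS](reindex_inj (h := fun j : 'Z_6 => j + 3)) /=; last exact: addIr.
apply: eq_bigr => j _.
have -> : exits j (N A) = N (exits (j + 3) A).
  by apply/fsetP => x; rewrite in_exits !inN in_exits dirv3 opprD.
by rewrite card_imfset //; exact: oppr_inj.
Qed.

Let NIF : (N I `<=` F)%fset.
Proof. by apply/fsubsetP => x; rewrite inN => /(fsubsetP IF); rewrite inFN. Qed.

Let costN : cost (N I) = cost I.
Proof.
rewrite !cost_sub//.
have -> : (F `\` N I)%fset = N (F `\` I)%fset.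
  by apply/fsetP => x; rewrite inN !in_fsetD inN inFN.
rewrite big_imfset/=; last by move=> x y _ _ /oppr_inj.
by rewrite !big_seq; apply: eq_bigr => x; rewrite in_fsetD => /andP[_ /dN].
Qed.

(** Submodularity makes [I :&: - I] and [I :|: - I] minimal. The four totals being
    equal, irrationality of [lam] makes all costs equal. Since cost is strictly
    monotone, the intersection and the union agree. *)
Lemma minimal_opp x : (- x \in I) = (x \in I).
Proof.
suff : (I `&` N I = I `|` N I)%fset.
  move=> /fsetP/(_ x); rewrite in_fsetI in_fsetU inN.
  by case: (x \in I); case: (- x \in I).
have IUF : (I `|` N I `<=` F)%fset by rewrite fsubUset IF NIF.
have AU : (I `&` N I `<=` I `|` N I)%fset by rewrite fsubIset// fsubsetUl.
have AI : (I `&` N I `<=` I)%fset by exact: fsubsetIl.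
have IU : (I `<=` I `|` N I)%fset by exact: fsubsetUl.
have cA : (cost (I `&` N I)%fset + cost (I `|` N I)%fset = cost I + cost I)%N.
  rewrite -[X in (_ = _ + X)%N]costN (cost_nest AI IF).
  rewrite (cost_nest (fsubsetUr I (N I)) IUF) -addnA [X in (_ + X)%N]addnC.
  do 2 congr addn; apply: eq_fbigl => y.
  rewrite !in_fsetD in_fsetI in_fsetU.
  by case: (y \in I); case: (y \in N I).
have bA := bsize_submod I (N I); rewrite bsizeN in bA.
have h1 := Imin (I `&` N I)%fset; have h2 := Imin (I `|` N I)%fset.
rewrite /total in h1 h2.
have bA' : (bsize (I `&` N I)%fset)%:R + (bsize (I `|` N I)%fset)%:R <= (bsize I)%:R + (bsize I)%:R :> R.
  by rewrite -!natrD ler_nat.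
have cA' : (cost (I `&` N I)%fset)%:R + (cost (I `|` N I)%fset)%:R = (cost I)%:R + (cost I)%:R :> R.
  by rewrite -!natrD cA.
have eq0 : ((bsize (I `&` N I)%fset)%:Z - (bsize I)%:Z)%:~R +
    lam * ((cost (I `&` N I)%fset)%:Z - (cost I)%:Z)%:~R = 0 :> R.
  rewrite !intrB -!pmulrn mulrBr.
  have e : lam * (cost (I `|` N I)%fset)%:R = lam * (cost I)%:R + lam * (cost I)%:R - lam * (cost (I `&` N I)%fset)%:R.
    by rewrite -mulrDr -cA' mulrDr; lra.
  lra.
have cE : (cost (I `&` N I)%fset = cost I) by move: (notie eq0); clear; lia.
have cE' : cost (I `&` N I)%fset = cost (I `|` N I)%fset by move: cE cA; clear; lia.
move: cE'; rewrite (cost_nest AU IUF) => /eqP; rewrite -[X in _ == X]addn0 eqn_add2l.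
move=> /eqP/sum_d_eq0/eqP; rewrite fsetD_eq0 => UA.
by apply/eqP; rewrite eqEfsubset AU.
Qed.

Lemma minimal_sym M : I = hexset M -> (forall i, 1 <= slen M i) -> forall j, M (j + 3) = M j.
Proof.
move=> IM lM.
have le j : M j <= M (j + 3).
  have : M j \in lines j (hexset M).
    rewrite lines_hexset// lexx andbT.
    by have := lM (j + 1); have := lM (j + 2); rewrite /slen !(Z6E j); lia.
  case/imfsetP => x /=; rewrite -IM -minimal_opp IM in_hexset => /inhexP/(_ (j + 3)).
  by rewrite formN form3 opprK => + ->.
move=> j; apply/eqP; rewrite eq_le le andbT.
by have := le (j + 3); rewrite (Z6E j).
Qed.
End Symmetry.

Variables (n R0 R1 : nat).
Hypothesis len : forall j, n%:Z <= slen m j.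
Hypothesis R0_gt0 : (0 < R0)%N.
Hypothesis R01 : (R0 <= R1)%N.
Hypothesis R1n : (2 * R1 + 1 < n)%N.

(** Putting back the last deleted row costs 2 edges and saves [k = m j - M j] for
    each of its cells; deleting one more row saves 2 edges and costs at most [k + 1]
    for each of its cells. The shifts by multiples of [R1] account for the corners. *)
Lemma minimal_rate M j : I = hexset M -> (forall i, m i - R1%:Z < M i <= m i) ->
  lam * ((m j - M j)%:~R * (slen m j - 2 * R1%:Z)%:~R) <= 2 /\
  2 <= lam * ((m j - M j + 1)%:~R * (slen m j + R1%:Z)%:~R).
Proof.
move=> IM Mb.
have lM i : 1 <= slen M i.
  have := len i; have := Mb i; have := Mb (i - 1); have := Mb (i + 1).
  by rewrite /slen; lia.
split.
- have [k0|k0] := leP (m j - M j) 0.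
    have -> : m j - M j = 0 by have := Mb j; lia.
    by rewrite mul0r mulr0.
  pose M' (i : 'Z_6) : int := if i == j then M j + 1 else M i.
  have M'j : M' j = M j + 1 by rewrite /M' eqxx.
  have M'i (i : 'Z_6) : i != j -> M' i = M i by rewrite /M' => /negPf ->.
  have M'b i : M i <= M' i <= M i + 1 by rewrite /M'; case: eqP => [->|_]; lia.
  have lM' i : 1 <= slen M' i.
    have := len i; have := Mb i; have := Mb (i - 1); have := Mb (i + 1).
    have := M'b i; have := M'b (i - 1); have := M'b (i + 1).
    by rewrite /slen; lia.
  have IG : (I `<=` hexset M')%fset.
    apply/fsubsetP => x; rewrite IM !in_hexset => /inhexP h; apply/inhexP => i.
    by have := h i; have := M'b i; lia.
  have GF : (hexset M' `<=` F)%fset.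
    apply/fsubsetP => x; rewrite !in_hexset => /inhexP h; apply/inhexP => i.
    have := h i; have := Mb i; have [->|ij] := eqVneq i j; first by rewrite M'j; lia.
    by rewrite M'i//; lia.
  have SE : \sum_(i : 'Z_6) M' i = \sum_(i : 'Z_6) M i + 1.
    rewrite [LHS](bigD1 j)//= [in RHS](bigD1 j)//= M'j.
    by rewrite (eq_bigr (F1 := M') M); [rewrite addrAC | move=> i ij; rewrite M'i].
  have bG : bsize (hexset M') = (bsize I + 2)%N.
    move: (bsize_hexsetE lM') (bsize_hexsetE lM); rewrite -IM SE !mulr2n.
    move: (\sum_(i : 'Z_6) M i) (bsize _) (bsize _) => S a b; clear; lia.
  have := Imin (hexset M'); rewrite /total (cost_nest IG GF) bG !natrD mulrDr.
  set S := (\sum_(x <- (hexset M' `\` I)%fset) d x)%N => h.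
  have h2 : lam * S%:R <= 2 by lra.
  apply: le_trans h2; rewrite ler_pM2l//.
  have [p0|p0] := leP (slen m j - 2 * R1%:Z) 0.
    rewrite (@le_trans _ _ 0)// -intrM -[0]/(0%:~R) ler_int.
    by rewrite pmulr_rle0.
  have [k kE] : exists k : nat, m j - M j = k%:Z.
    by exists (absz (m j - M j)%R); move: k0; clear; lia.
  have [p pE] : exists p : nat, slen m j - 2 * R1%:Z = p%:Z.
    by exists (absz (slen m j - 2 * R1%:Z)%R); move: p0; clear; lia.
  rewrite kE pE -!pmulrn -natrM ler_nat.
  have Mbj := Mb j; have Mb1 := Mb (j + 1); have Mb2 := Mb (j + 2).
  have Mb3 := Mb (j + 3); have Mb4 := Mb (j + 4); have Mb5 := Mb (j - 1).
  have l0 := len j; have l1 := len (j + 1); have l2 := len (j + 2).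
  have l3 := len (j + 3); have l4 := len (j + 4); have l5 := len (j - 1).
  rewrite /slen !(Z6E j) in pE l0 l1 l2 l3 l4 l5.
  (* the points of the row that are deep with respect to the other sides *)
  pose mu (i : 'Z_6) : int := if i == j then M j + 1 else m i - R1%:Z + 1.
  have muj : mu j = M j + 1 by rewrite /mu eqxx.
  have mui (i : 'Z_6) : i != j -> mu i = m i - R1%:Z + 1 by rewrite /mu => /negPf ->.
  have nj1 : j + 1 != j by move: (j); apply: Z6_ind.
  have nj2 : j + 2 != j by move: (j); apply: Z6_ind.
  have nj3 : j + 3 != j by move: (j); apply: Z6_ind.
  have nj4 : j + 4 != j by move: (j); apply: Z6_ind.
  have nj5 : j - 1 != j by move: (j); apply: Z6_ind.
  have [c1 c2] : M j + 1 <= mu j /\ - (M j + 1) <= mu (j + 3).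
    rewrite muj mui//; split; move: Mbj Mb3 kE k0 l1 l2 l4 R1n; clear; lia.
  have h1 : p%:Z <= mu (j + 1) + mu (j + 4) + 1.
    rewrite !mui//; move: Mbj Mb1 Mb2 Mb3 Mb4 Mb5 kE pE k0 l0 l1 l2 l3 l4 l5 R1n; clear; lia.
  have h2' : p%:Z <= mu (j + 1) + mu (j - 1) - (M j + 1) + 1.
    rewrite !mui//; move: Mbj Mb1 Mb2 Mb3 Mb4 Mb5 kE pE k0 l0 l1 l2 l3 l4 l5 R1n; clear; lia.
  have h3 : p%:Z <= mu (j + 2) + mu (j + 4) + (M j + 1) + 1.
    rewrite !mui//; move: Mbj Mb1 Mb2 Mb3 Mb4 Mb5 kE pE k0 l0 l1 l2 l3 l4 l5 R1n; clear; lia.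
  have h4 : p%:Z <= mu (j + 2) + mu (j - 1) + 1.
    rewrite !mui//; move: Mbj Mb1 Mb2 Mb3 Mb4 Mb5 kE pE k0 l0 l1 l2 l3 l4 l5 R1n; clear; lia.
  apply: (line_sum c1 c2 h1 h2' h3 h4).
  move=> x /inhexP hx xj; rewrite in_fsetD IM !in_hexset.
  have xM' : inhex M' x.
    apply/inhexP => i; have := hx i; have [->|ij] := eqVneq i j; first by rewrite muj M'j.
    by rewrite mui// M'i//; move: (Mb i); clear; lia.
  rewrite xM' andbT; apply/andP; split.
    by apply/negP => /inhexP/(_ j); move: xj; clear; lia.
  apply/dP.
    by have /fsubsetP/(_ x) := GF; rewrite !in_hexset; exact.
  move=> i; have := hx i; have [->|ij] := eqVneq i j; first by rewrite muj; move: kE; clear; lia.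
  by rewrite mui//; move: kE Mbj; clear; lia.
- pose M' (i : 'Z_6) : int := if i == j then M j - 1 else M i.
  have M'j : M' j = M j - 1 by rewrite /M' eqxx.
  have M'i (i : 'Z_6) : i != j -> M' i = M i by rewrite /M' => /negPf ->.
  have M'b i : M i - 1 <= M' i <= M i by rewrite /M'; case: eqP => [->|_]; lia.
  have lM' i : 1 <= slen M' i.
    have := len i; have := Mb i; have := Mb (i - 1); have := Mb (i + 1).
    have := M'b i; have := M'b (i - 1); have := M'b (i + 1).
    by rewrite /slen; lia.
  have GI : (hexset M' `<=` I)%fset.
    apply/fsubsetP => x; rewrite IM !in_hexset => /inhexP h; apply/inhexP => i.
    by have := h i; have := M'b i; lia.
  have SE : \sum_(i : 'Z_6) M' i = \sum_(i : 'Z_6) M i - 1.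
    rewrite [LHS](bigD1 j)//= [in RHS](bigD1 j)//= M'j.
    by rewrite (eq_bigr (F1 := M') M); [rewrite addrAC | move=> i ij; rewrite M'i].
  have bG : (bsize (hexset M') + 2 = bsize I)%N.
    move: (bsize_hexsetE lM') (bsize_hexsetE lM); rewrite -IM SE !mulr2n.
    move: (\sum_(i : 'Z_6) M i) (bsize _) (bsize _) => S a b; clear; lia.
  have := Imin (hexset M'); rewrite /total (cost_nest GI IF) -bG !natrD mulrDr.
  set S := (\sum_(x <- (I `\` hexset M')%fset) d x)%N => h.
  have h2 : 2 <= lam * S%:R by lra.
  apply: (le_trans h2); rewrite ler_pM2l//.
  have [k kE] : exists k : nat, m j - M j + 1 = k%:Z.
    by exists (absz (m j - M j + 1)%R); move: (Mb j); clear; lia.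
  have [p pE] : exists p : nat, slen m j + R1%:Z = p%:Z.
    by exists (absz (slen m j + R1%:Z)%R); move: (len j); clear; lia.
  rewrite kE pE -!pmulrn -natrM ler_nat.
  have row x : x \in (I `\` hexset M')%fset -> hform j x = M j.
    rewrite in_fsetD IM !in_hexset => /andP[xM' /inhexP hx].
    apply/eqP; rewrite eq_le hx/= leNgt; apply/negP => lt; case/negP : xM'.
    apply/inhexP => i; have [->|ij] := eqVneq i j; first by rewrite M'j; move: lt; clear; lia.
    by rewrite M'i.
  apply: (@leq_trans (k * #|` (I `\` hexset M')%fset|)).
    rewrite /S card_fset_sum1 big_distrr/= !big_seq; apply: leq_sum => x xG.
    rewrite muln1 leqNgt; apply/negP => /dP.
    have xI : x \in I by move: xG; rewrite in_fsetD => /andP[].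
    have /fsubsetP/(_ x xI) := IF; rewrite in_hexset => xF /(_ xF)/(_ j).
    by rewrite (row x xG); move: kE; clear; lia.
  rewrite leq_mul2l; apply/orP; right.
  have rinj : {in (I `\` hexset M')%fset &, injective (hform (j + 1))}.
    by move=> x y /row xj /row yj; apply: form_inj; rewrite xj yj.
  move/card_in_imfsetP/eqP : rinj => <-.
  apply: (@card_lines_le _ (j + 1) (M j - M (j - 1)) (M (j + 1))).
    move=> x xG; have := row x xG; move: xG; rewrite in_fsetD IM !in_hexset.
    move=> /andP[_ /(inhex_at j)[_ [h1 _] [_]]]; rewrite (Z6E j) => h5 e; move: h1 h5 e; clear; lia.
  by rewrite -pE /slen; move: (Mb j) (Mb (j - 1)) (Mb (j + 1)); clear; lia.
Qed.

Hypothesis hR0 : 6 <= lam * (R0 * (n + 1 - R0))%N%:R.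
Hypothesis hR1 : 6 * (12 * R0%:R + 1) < lam * (R1 * (n + 1 - R1))%N%:R.
Hypothesis hlam : lam * (R1 * R1)%N%:R < 1.

(** Such a line meets the hexagon obtained by peeling [r - 1] rows from all sides in
    at least [n + 1 - r] points, which all have depth at least [r]. *)
Lemma lweight_deep j c (r : nat) : (0 < r <= R1)%N ->
  c <= m j - r%:Z + 1 -> - c <= m (j + 3) - r%:Z + 1 ->
  (r * (n + 1 - r) <= lweight j c)%N.
Proof.
move=> /andP[r0 rR1] c1 c2.
rewrite /lweight big_fset_condE.
apply: (@line_sum (fun i => m i - r%:Z + 1) j c) => //.
- by have := len (j + 2); have := len (j + 3); rewrite /slen !(Z6E j); lia.
- by have := len j; have := len (j + 3); rewrite /slen !(Z6E j); lia.
- by have := len j; have := len (j + 3); rewrite /slen !(Z6E j); lia.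
- by have := len (j + 3); have := len (j + 4); rewrite /slen !(Z6E j); lia.
move=> x /inhexP h hx; have xF : inhex m x.
  by apply/inhexP => i; have := h i; lia.
rewrite !inE/= in_hexset xF hx eqxx/=; apply/dP => // i; have := h i; lia.
Qed.

(** The line lies at least at depth [r] from the two sides parallel to it. *)
Definition deep (r : nat) j c := (c <= m j - r%:Z + 1) && (- c <= m (j + 3) - r%:Z + 1).

Let shallow i : {fset int} := [fset c in missed i | ~~ deep R0 i c]%fset.
Let profound i : {fset int} := [fset c in missed i | deep R0 i c]%fset.

Let in_profound i c : (c \in profound i) = (c \in missed i) && deep R0 i c.
Proof. by rewrite !inE. Qed.

(** There are [R0] lines near each of the two parallel sides. *)
Lemma card_shallow i : (#|` shallow i| <= 2 * R0)%N.
Proof.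
pose f (k : nat) := m i - k%:Z; pose g (k : nat) := k%:Z - m (i + 3).
pose A : {fset int} := [fset f k | k in iota 0 R0]%fset.
pose B : {fset int} := [fset g k | k in iota 0 R0]%fset.
have cA (h : nat -> int) : (#|` [fset h k | k in iota 0 R0]%fset| <= R0)%N.
  by rewrite (leq_trans (leq_imfset_card _ _ _))//= undup_id ?iota_uniq// size_iota.
apply: (@leq_trans #|` A `|` B|%fset).
  apply/fsubset_leq_card/fsubsetP => c; rewrite !inE/= => /andP[/andP[_ +]].
  case/imfsetP => x /= + ->; rewrite in_hexset => /(inhex_at i)[[c1 c2] _ _].
  rewrite /deep negb_and -!ltNge => /orP[?|?]; apply/orP; [left|right]; apply/imfsetP.
    by exists (absz (m i - hform i x)); rewrite /= ?mem_iota /f; lia.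
  by exists (absz (m (i + 3) + hform i x)); rewrite /= ?mem_iota /g; lia.
rewrite cardfsU (leq_trans (leq_subr _ _))//.
by have := cA f; have := cA g; rewrite -/A -/B; lia.
Qed.

Lemma missed_split i : (#|` missed i| = #|` shallow i| + #|` profound i|)%N.
Proof.
rewrite !card_fset_sum1 (big_fsetID _ (deep R0 i) (missed i))/= addnC.
by [].
Qed.

Lemma profound_weight i :
  (R0 * (n + 1 - R0) * #|` profound i| <= \sum_(c <- missed i) lweight i c)%N.
Proof.
rewrite (big_fsetID _ (deep R0 i) (missed i))/= -[leqLHS]addn0 leq_add//.
rewrite card_fset_sum1 big_distrr/= !big_seq; apply: leq_sum => c.
rewrite in_profound muln1 => /andP[_ /andP[c1 c2]].
by apply: lweight_deep; rewrite ?R0_gt0 ?R01.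
Qed.

(** A missed line at depth [R0] costs at least as much as the gain of 6 edges allotted
    to it. So only the at most [12 * R0] shallow lines leave some slack, which is
    less than the cost of a single line at depth [R1]. *)
Lemma missed_shallow j c : c \in missed j -> ~~ deep R1 j c.
Proof.
move=> cm; apply/negP => dp.
have dp0 : deep R0 j c by move: dp; rewrite /deep => /andP[? ?]; apply/andP; split; lia.
set w0 := (R0 * (n + 1 - R0))%N; set w1 := (R1 * (n + 1 - R1))%N.
have cp : c \in profound j by rewrite in_profound cm.
have pj : (w0 * (#|` profound j| - 1) + w1 <= \sum_(c <- missed j) lweight j c)%N.
  rewrite (big_fsetD1 c)//= addnC leq_add//.
    by move: dp => /andP[? ?]; apply: lweight_deep; rewrite ?(leq_trans R0_gt0)/=.
  rewrite (_ : (#|` profound j| - 1)%N = #|` profound j `\ c|%fset); last first.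
    by rewrite (cardfsD1 c (profound j)) cp addKn.
  rewrite (big_fsetID _ (deep R0 j))/= -[leqLHS]addn0 leq_add//.
  rewrite (_ : [fset _ in _ | _]%fset = (profound j `\ c)%fset); last first.
    by apply/fsetP => x; rewrite /profound !inE/= -!andbA.
  rewrite card_fset_sum1 big_distrr/= !big_seq; apply: leq_sum => x.
  rewrite in_fsetD1 in_profound muln1 => /andP[_ /andP[_ /andP[c1 c2]]].
  by apply: lweight_deep; rewrite ?R0_gt0 ?R01.
have pj0 : (0 < #|` profound j|)%N by rewrite cardfs_gt0; apply/fset0Pn; exists c.
have tot : (w0 * (\sum_(i : 'Z_6) #|` profound i| - 1) + w1 <=
    \sum_(i : 'Z_6) \sum_(c <- missed i) lweight i c)%N.
  rewrite (bigD1 j)//= [leqRHS](bigD1 j)//=.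
  have : (w0 * \sum_(i < 6 | i != j) #|` profound i| <=
    \sum_(i < 6 | i != j) \sum_(c <- missed i) lweight i c)%N.
    by rewrite big_distrr/=; apply: leq_sum => i _; exact: profound_weight.
  by move=> h; rewrite -addnBAC// mulnDr addnAC leq_add.
have sh : (\sum_(i : 'Z_6) #|` shallow i| <= 12 * R0)%N.
  rewrite (@leq_trans (\sum_(i : 'Z_6) (2 * R0))%N)//.
    by apply: leq_sum => i _; exact: card_shallow.
  by rewrite sum_nat_const card_ord mulnA.
have mi := missed_ineq.
have sE : (\sum_(i : 'Z_6) #|` missed i| =
    \sum_(i : 'Z_6) #|` shallow i| + \sum_(i : 'Z_6) #|` profound i|)%N.
  by rewrite -big_split; apply: eq_bigr => i _; rewrite missed_split.
rewrite sE natrD in mi.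
set S := (\sum_(i < _) #|` profound i|)%N in mi tot.
have S1 : (1 <= S)%N by rewrite /S (bigD1 j)//= (leq_trans pj0)// leq_addr.
move: tot sh; rewrite -!(ler_nat R) natrD natrM natrB// natrM => tot sh.
have : lam * (w0%:R * (S%:R - 1) + w1%:R) <= 6 * ((12 * R0%:R) + S%:R).
  apply: (le_trans _ (le_trans mi _)); first by rewrite ler_pM2l.
  by rewrite ler_pM2l// lerD2r.
have : 6 * (S%:R - 1) <= lam * w0%:R * (S%:R - 1).
  by rewrite ler_wpM2r// subr_ge0 -[1]/(1%:R) ler_nat.
move: hR1; rewrite -/w1.
set a := lam * w1%:R; set b := lam * w0%:R.
by rewrite (mulrDr lam) (mulrA lam) -/a -/b; lra.
Qed.

Lemma hform_dir_le j i : -1 <= hform j (dirv i) <= 1.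
Proof. by move: j; apply: (@Z6_all _ i); rewrite ?form2 ?form3 ?form4 ?form5 ?form_dir ?form_dir1. Qed.

(** What lies beyond a missed row has no neighbour in the rest. It is at most [R1]
    rows thick, hence has at most [R1] points on each transversal line and a cost of
    at most [R1 ^ 2] for each; deleting it gains at least one edge per transversal
    line. *)
Lemma row_cut j (r : nat) : (0 < r <= R1)%N -> m j - r%:Z + 1 \notin lines j I ->
  forall x, x \in I -> hform j x <= m j - r%:Z.
Proof.
move=> /andP[r0 rR1] rI.
set c := m j - r%:Z + 1 in rI.
pose J : {fset int * int} := [fset x in I | c < hform j x]%fset.
pose K : {fset int * int} := [fset x in I | hform j x < c]%fset.
have neq x : x \in I -> hform j x != c.
  by move=> xI; apply: contraNneq rI => <-; apply/imfsetP; exists x.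
have IJK : I = (J `|` K)%fset.
  apply/fsetP => x; rewrite !inE/= -andb_orr.
  by have [/neq|//] := boolP (x \in I); lia.
have bI : bsize I = (bsize J + bsize K)%N.
  rewrite IJK; apply: bsizeU.
  - move=> x i; rewrite !inE/= => /andP[xI h1] /andP[yI]; rewrite formD => h2.
    by have := hform_dir_le j i; have := neq _ yI; rewrite formD; lia.
  - by apply/fdisjointP => x; rewrite !inE/= => /andP[-> h]/=; lia.
  - move=> x i; rewrite !inE/= => /andP[xI h1] /andP[yI]; rewrite formD => h2.
    by have := hform_dir_le j i; have := neq _ yI; rewrite formD; lia.
have KI : (K `<=` I)%fset by rewrite [in X in (_ `<=` X)%fset]IJK fsubsetUr.
have dJ : (\sum_(x <- J) d x <= r * #|` J|)%N.
  rewrite card_fset_sum1 big_distrr/= !big_seq; apply: leq_sum => x.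
  rewrite !inE/= muln1 => /andP[xI h].
  have /fsubsetP/(_ _ xI) := IF; rewrite in_hexset => xF.
  rewrite leqNgt; apply/negP => /(dP _ xF)/(_ j).
  by rewrite /c in h; lia.
have cJ : (#|` J| <= r * #|` lines (j + 1)%R J|)%N.
  (* a point of [J] is determined by its row beyond [c] and its transversal line *)
  pose g (x : int * int) := (absz (hform j x - c), hform (j + 1) x).
  have ginj : {in J &, injective g}.
    move=> x y; rewrite !inE/= => /andP[_ hx] /andP[_ hy] [e1 e2].
    by apply: (@form_inj j) => //; lia.
  have uJ : uniq [seq g x | x <- J] by rewrite map_inj_in_uniq ?fset_uniq.
  rewrite -(size_map g J) -[r in leqRHS](size_iota 0) -(size_allpairs pair).
  apply: uniq_leq_size => // _ /mapP[x xJ ->]; apply/allpairsP.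
  exists (g x); split => //=; last by apply/imfsetP; exists x.
  move: xJ; rewrite !inE/= mem_iota => /andP[/(fsubsetP IF)].
  by rewrite in_hexset => /inhexP/(_ j); rewrite /c; lia.
have [J0|J0] := eqVneq J fset0.
  move=> x; rewrite IJK J0 fset0U !inE/= => /andP[_]; rewrite /c; lia.
exfalso.
have Jpos : (0 < #|` lines (j + 1)%R J|)%N.
  have [x xJ] := fset0Pn _ J0.
  by rewrite cardfs_gt0; apply/fset0Pn; exists (hform (j + 1) x); apply/imfsetP; exists x.
have bJ : (#|` lines (j + 1)%R J| <= bsize J)%N.
  by rewrite (leq_trans (card_lines _ _))// /bsize (bigD1 (j + 1))//= leq_addr.
have cK : cost K = (cost I + \sum_(x <- J) d x)%N.
  rewrite (cost_nest KI IF); congr addn; apply: eq_fbigl => x; rewrite !inE/=.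
  by have [/neq/=|] := boolP (x \in I); rewrite ?andbF//= andbT; lia.
have := Imin K; rewrite /total cK bI !natrD mulrDr.
have : lam * (\sum_(x <- J) d x)%N%:R < (bsize J)%:R.
  apply: (@le_lt_trans _ _ (lam * (r * r * #|` lines (j + 1)%R J|)%N%:R)).
    rewrite ler_pM2l// ler_nat (leq_trans dJ)// -mulnA leq_mul2l cJ orbT//.
  rewrite natrM mulrA (@lt_le_trans _ _ (#|` lines (j + 1)%R J|%:R))//; last by rewrite ler_nat.
  rewrite gtr_pMl ?ltr0n// (le_lt_trans _ hlam)// ler_pM2l// ler_nat.
  by rewrite leq_mul.
lra.
Qed.

(** The first row that can no longer be missed is met on every side. *)
Lemma row_R1 j : m j - R1%:Z + 1 \in lines j I.
Proof.
have l1 i : 1 <= slen m i by have := len i; lia.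
have l4 := len (j + 4); have l5 := len (j + 5).
rewrite /slen !(Z6E j) in l4 l5.
apply/negPn/negP => no.
have /missed_shallow : m j - R1%:Z + 1 \in missed j.
  by rewrite /missed in_fsetD no lines_hexset//=; apply/andP; split; lia.
by rewrite /deep negb_and => /orP[]; lia.
Qed.

Lemma ex_top j : exists M : int, (forall x, x \in I -> hform j x <= M) /\
  exists2 x, x \in I & hform j x = M.
Proof.
have /imfsetP[x /= xI _] := row_R1 j.
pose x0 : I := [` xI]%fset.
have [y _ ymax] := @Order.TotalTheory.arg_maxP _ _ I x0 xpredT (fun y => hform j (val y)) isT.
exists (hform j (val y)); split; last by exists (val y) => //; exact: valP.
by move=> z zI; exact: (ymax [` zI]%fset).
Qed.

(** Compare [I] with the smallest hexagon [hexset M] containing it. By [row_cut] and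
    [missed_shallow], [I] meets every line that meets [hexset M]. Then [bsize I]
    is at least the number of these lines, which is the size of [hexset M]. *)
Lemma minimal_hexset : exists M : 'Z_6 -> int,
  [/\ I = hexset M, forall j, m j - R1%:Z < M j <= m j &
      forall j, exists2 x, x \in I & hform j x = M j].
Proof.
have [M /all_and2[Mub Mat]] := choice ex_top.
have Mb j : m j - R1%:Z < M j <= m j.
  have /imfsetP[x /= xI e] := row_R1 j.
  have := Mub j _ xI; have [y yI <-] := Mat j.
  by move/fsubsetP : IF => /(_ _ yI); rewrite in_hexset => /inhexP/(_ j); lia.
exists M; split => //.
have IM : (I `<=` hexset M)%fset.
  by apply/fsubsetP => x xI; rewrite in_hexset; apply/inhexP => j; exact: Mub.
have MF : (hexset M `<=` F)%fset.
  apply/fsubsetP => x; rewrite !in_hexset => /inhexP h; apply/inhexP => j.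
  by have := h j; have := Mb j; lia.
apply: minimal_eq => //; rewrite bsize_hexset (leq_trans _ (bsize_lines I))//.
apply: leq_sum => j _; apply: fsubset_leq_card; apply/fsubsetP => c cM.
apply/negPn/negP => cI.
have cF : c \in missed j.
  by rewrite /missed in_fsetD cI/=; move/fsubsetP : (linesS j MF); exact.
have [cM1 cM2] : c <= M j /\ - c <= M (j + 3).
  by case/imfsetP : cM => x /=; rewrite in_hexset => /(inhex_at j)[[? ?] _ _] ->.
have Mb0 := Mb j; have Mb3 := Mb (j + 3).
have := missed_shallow cF; rewrite /deep negb_and -!ltNge => /orP[lt|lt].
  have [x xI xM] := Mat j.
  have [r [rE r01]] : exists r : nat, c = m j - r%:Z + 1 /\ (0 < r <= R1)%N.
    by exists (absz (m j - c + 1)); move: lt Mb0 cM1; clear; split; lia.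
  have := row_cut r01; move=> /(_ j); rewrite -rE => /(_ cI)/(_ x xI).
  by move: rE cM1 xM; clear; lia.
have [x xI xM] := Mat (j + 3).
have [r [rE r01]] : exists r : nat, - c = m (j + 3) - r%:Z + 1 /\ (0 < r <= R1)%N.
  by exists (absz (m (j + 3) + c + 1)); move: lt Mb3 cM2; clear; split; lia.
have := row_cut r01; move=> /(_ (j + 3)); rewrite -rE => h.
have cI3 : - c \notin lines (j + 3) I.
  apply: contra cI => /imfsetP[y /= yI]; rewrite form3 => /oppr_inj ->.
  by apply/imfsetP; exists y.
by move: (h cI3 x xI) rE cM2 xM; clear; lia.
Qed.

End Minimizers.

(** * Hexagons in the plane *)

Section Hexagons.
Context {R : realType}.
Implicit Types (x y : R * R) (j : 'Z_6) (h : 'Z_6 -> R).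
Local Notation s3 := (Num.sqrt (3 : R)).

Lemma s3_gt0 : 0 < s3. Proof. by rewrite sqrtr_gt0. Qed.
Lemma s3_sq : s3 * s3 = 3. Proof. by rewrite -expr2 sqr_sqrtr. Qed.

(** The continuous analogue of [hform]. *)
Definition lin j x : R := dot x (nrm R j).

Lemma nrmE : [/\ nrm R 0 = (s3 / 2, 1 / 2), nrm R 1 = (0, 1),
  nrm R 2 = (- (s3 / 2), 1 / 2), nrm R 3 = (- (s3 / 2), - (1 / 2)) &
  nrm R 4 = (0, - 1) /\ nrm R 5 = (s3 / 2, - (1 / 2))].
Proof.
rewrite /nrm /perp /eta3 /eta1 /eta2 /=.
by split; [..|split]; congr pair => /=; lra.
Qed.

Lemma linE x : [/\ lin 0 x = s3 / 2 * x.1 + x.2 / 2, lin 1 x = x.2,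
  lin 2 x = - (s3 / 2 * x.1) + x.2 / 2, lin 3 x = - (s3 / 2 * x.1) - x.2 / 2 &
  lin 4 x = - x.2 /\ lin 5 x = s3 / 2 * x.1 - x.2 / 2].
Proof.
have [n0 n1 n2 n3 [n4 n5]] := nrmE.
by rewrite /lin n0 n1 n2 n3 n4 n5 /dot /=; split; [..|split]; lra.
Qed.

Lemma lin1 j x : lin (j - 1) x = lin j x - lin (j + 1) x.
Proof.
have [n0 n1 n2 n3 [n4 n5]] := linE x.
by move: j; apply: Z6_ind; rewrite /= ?n0 ?n1 ?n2 ?n3 ?n4 ?n5; lra.
Qed.

Lemma lin2 j x : lin (j + 2) x = lin (j + 1) x - lin j x.
Proof.
have [n0 n1 n2 n3 [n4 n5]] := linE x.
by move: j; apply: Z6_ind; rewrite /= ?n0 ?n1 ?n2 ?n3 ?n4 ?n5; lra.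
Qed.
Lemma lin3 j x : lin (j + 3) x = - lin j x.
Proof.
have [n0 n1 n2 n3 [n4 n5]] := linE x.
by move: j; apply: Z6_ind; rewrite /= ?n0 ?n1 ?n2 ?n3 ?n4 ?n5; lra.
Qed.
Lemma lin4 j x : lin (j + 4) x = - lin (j + 1) x.
Proof. by rewrite (_ : j + 4 = j + 1 + 3) ?lin3//; move: j; apply: Z6_ind; apply/eqP. Qed.
Lemma lin5 j x : lin (j + 5) x = lin j x - lin (j + 1) x.
Proof. by rewrite (Z6E j) lin1. Qed.

Lemma linD j x y : lin j (x + y) = lin j x + lin j y.
Proof. by rewrite /lin /dot /=; ring. Qed.
Lemma linZ j (c : R) x : lin j (c *: x) = c * lin j x.
Proof. by rewrite /lin /dot /= /GRing.scale /=; ring. Qed.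
Lemma linN j x : lin j (- x) = - lin j x.
Proof. by rewrite /lin /dot /=; ring. Qed.
Lemma linB j x y : lin j (x - y) = lin j x - lin j y.
Proof. by rewrite linD linN. Qed.
Lemma lin_nrm j : lin j (nrm R j) = 1.
Proof.
have [n0 n1 n2 n3 [n4 n5]] := nrmE; have sq := s3_sq.
by move: j; apply: Z6_ind; rewrite /lin /dot /= ?n0 ?n1 ?n2 ?n3 ?n4 ?n5 /=; lra.
Qed.
Lemma lin_nrm1 j : lin j (nrm R (j + 1)) = 1 / 2.
Proof.
have [n0 n1 n2 n3 [n4 n5]] := nrmE; have sq := s3_sq.
by move: j; apply: Z6_ind; rewrite /lin /dot /= ?n0 ?n1 ?n2 ?n3 ?n4 ?n5 /=; lra.
Qed.
Lemma lin1_nrm j : lin (j + 1) (nrm R j) = 1 / 2.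
Proof. by rewrite -(lin_nrm1 j) /lin /dot; ring. Qed.

Definition rpt j (u w : R) : R * R :=
  ((4 * u - 2 * w) / 3) *: nrm R j + ((4 * w - 2 * u) / 3) *: nrm R (j + 1).

Lemma lin_rpt j u w : lin j (rpt j u w) = u.
Proof. by rewrite /rpt linD !linZ lin_nrm lin_nrm1; field. Qed.
Lemma lin1_rpt j u w : lin (j + 1) (rpt j u w) = w.
Proof. by rewrite /rpt linD !linZ lin1_nrm lin_nrm; field. Qed.

Lemma lin_inj j x y : lin j x = lin j y -> lin (j + 1) x = lin (j + 1) y -> x = y.
Proof.
move=> e0 e1; have e i : lin i x = lin i y.
  by move: i; apply: (@Z6_all _ j); rewrite // ?lin2 ?lin3 ?lin4 ?lin5 ?e0 ?e1.
have [n0 n1 _ _ _] := linE x; have [m0 m1 _ _ _] := linE y.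
have h1 := e 1; have h0 := e 0; rewrite n0 n1 m0 m1 in h0 h1 *.
case: x y h0 h1 {e e0 e1 n0 n1 m0 m1} => [a b] [c d] /= h0 h1; congr pair => //.
have : s3 / 2 * a = s3 / 2 * c by lra.
by apply: mulfI; rewrite mulf_neq0 ?invr_eq0 ?pnatr_eq0// gt_eqF// s3_gt0.
Qed.

Lemma dotxx_ge0 x : 0 <= dot x x.
Proof. by rewrite /dot; nra. Qed.

Lemma enorm_sq x : enorm x * enorm x = dot x x.
Proof. by rewrite -expr2 sqr_sqrtr// dotxx_ge0. Qed.

Lemma enorm_ge0 x : 0 <= enorm x. Proof. exact: sqrtr_ge0. Qed.

Lemma cauchy x y : `|dot x y| <= enorm x * enorm y.
Proof.
rewrite -(@ler_pXn2r _ 2)// ?nnegrE ?mulr_ge0 ?enorm_ge0//.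
rewrite real_normK ?num_real// exprMn !expr2 !enorm_sq /dot.
have : 0 <= (x.1 * y.2 - x.2 * y.1) ^+ 2 by exact: sqr_ge0.
by rewrite expr2; nra.
Qed.

Lemma enorm_nrm j : enorm (nrm R j) = 1.
Proof. by rewrite /enorm -/(lin j (nrm R j)) lin_nrm sqrtr1. Qed.

Lemma lin_enorm j x : `|lin j x| <= enorm x.
Proof. by rewrite (le_trans (cauchy _ _))// enorm_nrm mulr1. Qed.

Lemma enormZ (c : R) x : enorm (c *: x) = `|c| * enorm x.
Proof.
rewrite /enorm (_ : dot (c *: x) (c *: x) = c ^+ 2 * dot x x).
  by rewrite sqrtrM ?sqr_ge0// sqrtr_sqr.
by rewrite /dot /= /GRing.scale /=; ring.
Qed.

Lemma enormN x : enorm (- x) = enorm x.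
Proof. by rewrite -scaleN1r enormZ normrN1 mul1r. Qed.

Lemma enorm_le x : enorm x <= `|x.1| + `|x.2|.
Proof.
rewrite -(@ler_pXn2r _ 2)// ?nnegrE ?enorm_ge0 ?addr_ge0//.
rewrite expr2 enorm_sq /dot sqrrD -!expr2 !real_normK ?num_real//.
by rewrite addrAC lerDl mulrn_wge0// mulr_ge0.
Qed.

Lemma fst_enorm x : `|x.1| <= enorm x.
Proof.
rewrite -(@ler_pXn2r _ 2)// ?nnegrE ?enorm_ge0//.
by rewrite real_normK ?num_real// (expr2 (enorm x)) enorm_sq /dot -!expr2 lerDl sqr_ge0.
Qed.
Lemma snd_enorm x : `|x.2| <= enorm x.
Proof.
rewrite -(@ler_pXn2r _ 2)// ?nnegrE ?enorm_ge0//.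
by rewrite real_normK ?num_real// (expr2 (enorm x)) enorm_sq /dot -!expr2 lerDr sqr_ge0.
Qed.

Definition hexagon h : set (R * R) := [set x | forall j, lin j x <= h j].
(** Proportional to the length of the side with normal [nrm j], see
    [vertex_diff]. *)
Definition rlen h j : R := h (j - 1) + h (j + 1) - h j.

Lemma hexagon_at j h x : hexagon h x <->
  [/\ lin j x <= h j /\ - lin j x <= h (j + 3),
      lin (j + 1) x <= h (j + 1) /\ - lin (j + 1) x <= h (j + 4) &
      lin (j + 1) x - lin j x <= h (j + 2) /\
      lin j x - lin (j + 1) x <= h (j + 5)].
Proof.
split=> [H|[[h0 h3] [h1 h4] [h2 h5]]].
  by have := (H (j + 2), H (j + 3), H (j + 4), H (j + 5)) => -[[[]]];
    rewrite lin2 lin3 lin4 lin5; split; split.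
by apply: (@Z6_all _ j) => //; rewrite ?lin2 ?lin3 ?lin4 ?lin5.
Qed.

Lemma lin_continuous j : continuous (lin j).
Proof.
move=> x; rewrite /lin /dot; apply: cvgD.
  by apply: cvgM; [exact: cvg_fst|exact: cvg_cst].
by apply: cvgM; [exact: cvg_snd|exact: cvg_cst].
Qed.

Lemma hexagon_closed h : closed (hexagon h).
Proof.
rewrite (_ : hexagon h = \bigcap_(j in [set: 'Z_6]) (lin j @^-1` [set r | r <= h j])).
  apply: closed_bigI => j _; apply: closed_comp => [x _|]; first exact: lin_continuous.
  exact: closed_le.
by apply/seteqP; split => x /= H j; [move=> _|]; exact: H.
Qed.

Lemma convex_setP (A : set (R * R)) :
  convex_set (A : set (convex_lmodType (R * R)%type)) <->
  (forall x y (t : R), A x -> A y -> 0 <= t <= 1 -> A (t *: x + (1 - t) *: y)).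
Proof.
split=> [cA x y t xA yA /andP[t0 t1]|H x y k].
  apply: set_mem; exact: (cA x y (Itv01 t0 t1) (mem_set xA) (mem_set yA)).
move=> /set_mem xA /set_mem yA; apply/mem_set; apply: (H x y k%:num) => //.
by apply/andP; split.
Qed.

Lemma hexagon_convex h : convex_set (hexagon h : set (convex_lmodType (R * R)%type)).
Proof.
apply/convex_setP => x y t hx hy /andP[t0 t1] j; rewrite linD !linZ.
by have := hx j; have := hy j; nra.
Qed.

Lemma nbhs_ray (A : set (R * R)) x v : nbhs x A ->
  exists2 e : R, 0 < e & forall r, `|r| < e -> A (x + r *: v).
Proof.
move=> xA.
have : (fun r : R => x + r *: v) r @[r --> (0 : R)] --> x + 0 *: v.
  by apply: cvgD; [exact: cvg_cst | apply: cvgZr_tmp; exact: cvg_id].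
rewrite scale0r addr0 => /(_ _ xA)/nbhs_ballP[e /= e0 eA].
exists e => // r re; apply: eA; rewrite /ball/= sub0r normrN//.
Qed.

(** A point with [lin j x = h j] leaves the hexagon when pushed along [nrm j]. *)
Lemma interior_hexagon h : interior (hexagon h) = [set x | forall j, lin j x < h j].
Proof.
apply/seteqP; split => x /= H.
  move=> j; have [e e0 H1] := nbhs_ray (nrm R j) H.
  have /(_ j) : hexagon h (x + (e / 2) *: nrm R j).
    by apply: H1; rewrite gtr0_norm ?divr_gt0// ltr_pdivrMr// ltr_pMr// ltr1n.
  rewrite linD linZ lin_nrm; have : 0 < e / 2 by rewrite divr_gt0.
  lra.
suff : \forall y \near x, forall j, lin j y < h j.
  by apply: filterS => y hy j; exact: ltW.
have H1 j : \forall y \near x, lin j y < h j.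
  exact: (cvgr_lt (lin j x) (@lin_continuous j x)).
near=> y; apply: Z6_ind; near: y; exact: H1.
Unshelve. all: by end_near. Qed.

Lemma boundary_hexagon h : boundary (hexagon h) =
  [set x | hexagon h x /\ exists j, lin j x = h j].
Proof.
rewrite /boundary interior_hexagon; have /closure_id <- := hexagon_closed (h := h).
apply/seteqP; split => x /= [hx].
  move=> /existsNP[j /negP]; rewrite -leNgt => hj; split => //.
  by exists j; apply/eqP; rewrite eq_le hx.
by move=> [j hj]; split => // /(_ j); rewrite hj ltxx.
Qed.

Definition vertex h j : R * R := rpt j (h j) (h (j + 1)).

Lemma lin_vertex h j : lin j (vertex h j) = h j. Proof. exact: lin_rpt. Qed.
Lemma lin1_vertex h j : lin (j + 1) (vertex h j) = h (j + 1). Proof. exact: lin1_rpt. Qed.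

Definition tang j : R * R := perp (nrm R j).

Lemma lin_tang j : lin j (tang j) = 0.
Proof. by rewrite /lin /tang /perp /dot /=; ring. Qed.

Lemma lin1_tang j : lin (j + 1) (tang j) = s3 / 2.
Proof.
have [n0 n1 n2 n3 [n4 n5]] := nrmE; have sq := s3_sq.
by move: j; apply: Z6_ind;
  rewrite /lin /tang /perp /dot /= ?n0 ?n1 ?n2 ?n3 ?n4 ?n5 /=; lra.
Qed.

Lemma vertex_diff h j :
  vertex h j - vertex h (j - 1) = (2 / s3 * rlen h j) *: tang j.
Proof.
apply: (@lin_inj j); rewrite linB linZ ?lin_tang ?lin1_tang.
  have := lin1_vertex h (j - 1); rewrite (Z6E j) => ->.
  by rewrite lin_vertex mulr0 subrr.
have := lin1_vertex h (j - 1); have := lin_vertex h (j - 1); rewrite (Z6E j) => e1 e2.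
have := lin1 j (vertex h (j - 1)); rewrite e1 e2 => e3.
have -> : lin (j + 1) (vertex h (j - 1)) = h j - h (j - 1) by lra.
by rewrite lin1_vertex /rlen; field; rewrite gt_eqF// s3_gt0.
Qed.

Lemma lin_vertexB h j : lin (j + 1) (vertex h (j - 1)) = h j - h (j - 1).
Proof.
have := lin1_vertex h (j - 1); have := lin_vertex h (j - 1); rewrite (Z6E j) => e1 e2.
by have := lin1 j (vertex h (j - 1)); rewrite e1 e2; lra.
Qed.

Lemma lin_vertexB0 h j : lin j (vertex h (j - 1)) = h j.
Proof. by have := lin1_vertex h (j - 1); rewrite (Z6E j). Qed.

(** Given [lin j x = h j], only the constraints [j - 1] and [j + 1] matter, because
    the lengths of the other sides are positive; they bound the form [j + 1] between its
    values at the two vertices. *)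
Lemma hexagon_side h j x : (forall i, 0 < rlen h i) ->
  (hexagon h x /\ lin j x = h j) <-> segment (vertex h (j - 1)) (vertex h j) x.
Proof.
move=> hl; split=> [[/(hexagon_at j)[[_ _] [h1 h4] [h2 h5]] hj]|].
  exists ((lin (j + 1) x - (h j - h (j - 1))) / rlen h j) => /=.
    have := hl j; rewrite /rlen => l0; rewrite (Z6E j) in h5; apply/andP; split.
      by apply: divr_ge0; lra.
    by rewrite ler_pdivrMr//; lra.
  apply: (@lin_inj j); rewrite linD linZ linB.
    by rewrite lin_vertexB0 lin_vertex subrr mulr0 addr0 hj.
  rewrite lin_vertexB lin1_vertex.
  have -> : h (j + 1) - (h j - h (j - 1)) = rlen h j by rewrite /rlen; ring.
  by rewrite divfK ?gt_eqF//; ring.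
move=> [r /andP[r0 r1] <-].
have lj : lin j (vertex h (j - 1) + r *: (vertex h j - vertex h (j - 1))) = h j.
  by rewrite linD linZ linB lin_vertexB0 lin_vertex subrr mulr0 addr0.
have lj1 : lin (j + 1) (vertex h (j - 1) + r *: (vertex h j - vertex h (j - 1))) =
    h j - h (j - 1) + r * rlen h j.
  by rewrite linD linZ linB lin_vertexB lin1_vertex /rlen; ring.
split => //; apply/(hexagon_at j); rewrite lj lj1 (Z6E j).
have l0 := hl j; have l1 := hl (j + 1); have l2 := hl (j + 2).
have l5 := hl (j - 1).
have rl0 : 0 <= r * rlen h j by rewrite mulr_ge0// ltW.
have rl1 : r * rlen h j <= rlen h j by rewrite ler_piMl// ltW.
rewrite /rlen !(Z6E j) in l0 l1 l2 l5 rl0 rl1 *.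
by split; split; lra.
Qed.

Lemma boundary_hexagon_sides h : (forall i, 0 < rlen h i) ->
  boundary (hexagon h) = \bigcup_(j in [set: 'Z_6]) segment (vertex h (j - 1)) (vertex h j).
Proof.
move=> hl; rewrite boundary_hexagon; apply/seteqP; split => [x [hx [j hj]]|x [j _ /(hexagon_side _ _ hl)[hx hj]]].
  by exists j => //; apply/hexagon_side.
by split => //; exists j.
Qed.

Lemma rlen_pos_width h j : (forall i, 0 < rlen h i) -> 0 < h j + h (j + 3).
Proof.
by move=> hl; have := hl (j + 1); have := hl (j + 2); rewrite /rlen !(Z6E j); lra.
Qed.
End Hexagons.

Section Wulff.
Context {R : realType}.
Implicit Types (x y : R * R) (j : 'Z_6) (h : 'Z_6 -> R).
Local Notation s3 := (Num.sqrt (3 : R)).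

Lemma lin_nrmC (i j : 'Z_6) : lin i (nrm R j) = lin j (nrm R i).
Proof. by rewrite /lin /dot; ring. Qed.

Lemma nrm_inj : injective (nrm R).
Proof.
move=> i j; move: j; apply: (@Z6_all _ i) => //.
- by move=> e; exfalso; have := lin_nrm1 (R := R) i; rewrite -e lin_nrm; lra.
- move=> e; exfalso; have := lin_nrm (R := R) i; rewrite e lin_nrmC lin2 lin1_nrm lin_nrm; lra.
- move=> e; exfalso; have := lin_nrm (R := R) i; rewrite e lin_nrmC lin3 lin_nrm; lra.
- move=> e; exfalso; have := lin_nrm (R := R) i; rewrite e lin_nrmC lin4 lin1_nrm; lra.
- move=> e; exfalso; have := lin_nrm (R := R) i; rewrite e lin_nrmC lin5 lin1_nrm lin_nrm; lra.
Qed.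

(** Inside the side [j] the five other constraints are strict, so that a small
    neighbourhood of the point is cut by the constraint [j] only. *)
Lemma side_strict h j x : (forall i, 0 < rlen h i) -> lin j x = h j ->
  h j - h (j - 1) < lin (j + 1) x -> lin (j + 1) x < h (j + 1) ->
  forall i, i != j -> lin i x < h i.
Proof.
move=> hl hj l1 l2; apply: (@Z6_all _ j); rewrite ?eqxx//.
- by move=> _; rewrite lin2 hj; have := hl (j + 1); rewrite /rlen !(Z6E j); lra.
- by move=> _; rewrite lin3 hj; have := rlen_pos_width j hl; lra.
- by move=> _; rewrite lin4; have := hl (j - 1); rewrite /rlen !(Z6E j); lra.
- by move=> _; rewrite lin5 hj (Z6E j); lra.
Qed.

Lemma segment_coord h j (r : R) (x := vertex h (j - 1) + r *: (vertex h j - vertex h (j - 1))) :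
  lin j x = h j /\ lin (j + 1) x = h j - h (j - 1) + r * rlen h j.
Proof.
split; first by rewrite linD linZ linB lin_vertexB0 lin_vertex subrr mulr0 addr0.
by rewrite linD linZ linB lin_vertexB lin1_vertex /rlen; ring.
Qed.

Section hexagon_is_wulff.
Variable h : 'Z_6 -> R.
Hypothesis hl : forall i, 0 < rlen h i.

Let p (k : 'I_6) : R * R := vertex h ((k : 'Z_6) - 1).
Let nu (k : 'I_6) : R * R := nrm R (k : 'Z_6).

Let pS (k : 'I_6) : p (ordS k) = vertex h (k : 'Z_6).
Proof.
rewrite /p; congr (vertex h _).
by move: k; apply: Z6_ind; apply/eqP.
Qed.

Let pE (k : 'I_6) : p k = vertex h ((k : 'Z_6) - 1). Proof. by []. Qed.

Let co_strict (k : 'Z_6) x : segment_co (vertex h (k - 1)) (vertex h k) x ->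
  [/\ lin k x = h k, h k - h (k - 1) <= lin (k + 1) x & lin (k + 1) x < h (k + 1)].
Proof.
move=> [r /andP[r0 r1] <-].
have [-> ->] := segment_coord h k r; split => //.
  by rewrite lerDl mulr_ge0// ltW.
have := hl k; have : 0 < (1 - r) * rlen h k by rewrite mulr_gt0// subr_gt0.
by rewrite /rlen; lra.
Qed.

Lemma hexagon_polygon : wulff_polygon (hexagon h) p nu.
Proof.
split.
- split => // k; rewrite pS pE => /(congr1 (lin ((k : 'Z_6) + 1))).
  by rewrite lin_vertexB lin1_vertex; have := hl k; rewrite /rlen; lra.
- rewrite boundary_hexagon_sides//; apply/seteqP; split => x [k _ kx]; exists k => //.
    by rewrite pS.
  by move: kx; rewrite pS.
- move=> i k _ _ [x []]; rewrite !pS !pE.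
  move=> /co_strict[i1 i2 i3] /co_strict[k1 k2 k3]; apply/eqP.
  move: k i1 i2 i3 k1 k2 k3; apply: (@Z6_all _ (i : 'Z_6)); first by rewrite eqxx.
  + by move=> _ _ H1 H2; rewrite H2 ltxx in H1.
  + move=> H0 _ H1; rewrite lin2 => H2; have := hl ((i : 'Z_6) + 1); rewrite /rlen !(Z6E (i : 'Z_6)); lra.
  + move=> H0 _ _; rewrite lin3 => H2; have := rlen_pos_width (i : 'Z_6) hl; lra.
  + rewrite !(Z6E (i : 'Z_6)) => H0 H1 H2; rewrite lin4 lin1 => H3 H4 H5.
    have := hl ((i : 'Z_6) - 1); rewrite /rlen !(Z6E (i : 'Z_6)); lra.
  + rewrite !(Z6E (i : 'Z_6)) => H0 H1 H2 H3 H4 H5; lra.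
- move=> k; rewrite pS pE; split.
  + exact: enorm_nrm.
  + by rewrite -/(lin _ _) linB lin_vertex lin_vertexB0 subrr.
  + move=> x [r /andP[r0 r1] <-].
    set x' := (vertex h ((k : 'Z_6) - 1) + r *: _); have [e0 e1] := segment_coord h (k : 'Z_6) r.
    rewrite -/x' in e0 e1.
    have st := @side_strict h (k : 'Z_6) x' hl e0.
    have {}st : forall i, i != k -> lin i x' < h i.
      apply: st; rewrite e1; first by rewrite ltrDl mulr_gt0.
      have : 0 < (1 - r) * rlen h (k : 'Z_6) by rewrite mulr_gt0// subr_gt0.
      by have := hl k; rewrite /rlen; lra.
    have near1 : nbhs x' [set y | forall i : 'Z_6, i != k -> lin i y < h i].
      have H1 (i : 'Z_6) : \forall y \near x', i != k -> lin i y < h i.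
        have [->|ik] := eqVneq i k; first by near=> y.
        have H2 := cvgr_lt (lin i x') (@lin_continuous R i x') (h i) (st i ik).
        by near=> y; move=> _; near: y; exact: H2.
      near=> y; rewrite /=; apply: (@Z6_ind (fun i : 'Z_6 => i != k -> lin i y < h i)); near: y; exact: H1.
    have [d d0 dA] := nbhs_ray (- nrm R (k : 'Z_6)) near1.
    exists d => // t /andP[t0 td]; split.
      by move=> /(_ (k : 'Z_6)); rewrite linD linZ lin_nrm e0 mulr1; lra.
    move=> i; have [->|ik] := eqVneq i k.
      by rewrite linB linZ lin_nrm e0; lra.
    by rewrite -scalerN; apply/ltW/dA => //; rewrite gtr0_norm.
- split=> [k|k j /nrm_inj <-]; first by exists k.
  right; congr (nrm R _); rewrite /=.
  by move: k; apply: Z6_ind; apply/eqP.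
Unshelve. all: by end_near. Qed.

Lemma hexagon_enorm (x : R * R) : hexagon h x ->
  enorm x <= 4 * (\sum_(j : 'Z_6) `|h j|).
Proof.
move=> hx; apply: (le_trans (enorm_le x)).
have hS j : `|h j| <= \sum_(j : 'Z_6) `|h j|.
  by rewrite (bigD1 j)//= lerDl sumr_ge0.
have S0 := le_trans (normr_ge0 _) (hS 0).
have H j : lin j x <= \sum_(j : 'Z_6) `|h j|.
  by rewrite (le_trans (hx j))// (le_trans (ler_norm _))// hS.
have [n0 n1 n2 n3 [n4 n5]] := linE x.
have := H 0; have := H 1; have := H 2; have := H 3; have := H 4; have := H 5.
rewrite n0 n1 n2 n3 n4 n5; set S := \sum_(_ < _) _ => h5 h4 h3 h2 h1 h0.
have s1 : 1 <= s3 by have := @s3_sq R; have := @s3_gt0 R; nra.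
have b2 : `|x.2| <= S by rewrite ler_norml; apply/andP; split; lra.
have b1 : `|s3 * x.1| <= 2 * S by rewrite ler_norml; apply/andP; split; lra.
have : `|x.1| <= 2 * S.
  by apply: le_trans b1; rewrite normrM ler_peMl// (le_trans s1)// ler_norm.
rewrite -/S in S0 *; lra.
Qed.

Lemma hexagon_bounded : bounded_set (hexagon h).
Proof.
exists (4 * (\sum_(j : 'Z_6) `|h j|)); split; first exact: num_real.
move=> M hM x /= /hexagon_enorm hx; rewrite prod_normE ge_max.
by rewrite (le_trans (fst_enorm x)) ?(le_trans (snd_enorm x))//; exact: le_trans hx (ltW hM).
Qed.

Lemma hexagon_wulff : wulff_hexagon (hexagon h).
Proof.
split; [exact: hexagon_closed|exact: hexagon_convex|split; first exact: hexagon_bounded].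
by exists 6, p, nu; exact: hexagon_polygon.
Qed.

Lemma hexagon_wulff_sides :
  wulff_sides (hexagon h) (fun i => segment (vertex h (i - 1)) (vertex h i)).
Proof.
exists 6, p, nu; split; first exact: hexagon_polygon.
by move=> i; exists i => //; rewrite pS.
Qed.

End hexagon_is_wulff.
End Wulff.

(** * Convex Wulff-like sets are hexagons *)

Section Converse.
Context {R : realType}.
Implicit Types (x y : R * R) (j : 'Z_6) (h : 'Z_6 -> R).
Local Notation s3 := (Num.sqrt (3 : R)).

Section convex_hexagon.
Variables (A : set (R * R)) (h : 'Z_6 -> R).
Hypothesis cA : forall x y (t : R), A x -> A y -> 0 <= t <= 1 -> A (t *: x + (1 - t) *: y).
Hypothesis hl : forall i, 0 < rlen h i.
Hypothesis vA : forall j, A (vertex h j).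

Let side_in j x : hexagon h x -> lin j x = h j -> A x.
Proof.
move=> hx hj; have /hexagon_side-/(_ hl)[r /andP[r0 r1] <-] := conj hx hj.
have -> : vertex h (j - 1) + r *: (vertex h j - vertex h (j - 1)) =
    r *: vertex h j + (1 - r) *: vertex h (j - 1).
  by rewrite scalerBr scalerBl scale1r addrCA addrA.
by apply: cA => //; apply/andP.
Qed.

Let ex_v : exists v : R * R, [/\ lin 0 v = 0, lin 1 v = 1, lin 2 v = 1 &
  [/\ lin 3 v = 0, lin 4 v = - 1 & lin 5 v = - 1]].
Proof.
pose v : R * R := (2 / s3) *: tang 0; exists v.
have e0 : lin 0 v = 0 by rewrite linZ lin_tang mulr0.
have e1 : lin 1 v = 1.
  rewrite linZ (_ : lin 1 (tang 0) = s3 / 2); last by rewrite -(lin1_tang 0) add0r.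
  by field; rewrite gt_eqF// s3_gt0.
have := lin2 0 v; have := lin3 0 v; have := lin4 0 v; have := lin5 0 v.
by rewrite !add0r e0 e1 => -> -> -> ->; split; [..|split]; lra.
Qed.

Let hexagon6 x : hexagon h x <->
  [/\ lin 0 x <= h 0, lin 1 x <= h 1, lin 2 x <= h 2 &
    [/\ lin 3 x <= h 3, lin 4 x <= h 4 & lin 5 x <= h 5]].
Proof.
by split=> [H|[? ? ? [? ? ?]]]; [split; [..|split]; exact: H|apply: Z6_ind].
Qed.

(** Through a point of the hexagon take the chord in a direction where the form 0
    vanishes. Its two ends lie on sides, which are segments between points of [A]. *)
Lemma hexagon_sub_convex : hexagon h `<=` A.
Proof.
move=> x /hexagon6[h0 h1 h2 [h3 h4 h5]].
have [v [l0 l1 l2 [l3 l4 l5]]] := ex_v.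
pose t1 := Num.min (h 1 - lin 1 x) (h 2 - lin 2 x).
pose t2 := Num.min (h 4 - lin 4 x) (h 5 - lin 5 x).
have t1_ge0 : 0 <= t1 by rewrite le_min; apply/andP; split; lra.
have t2_ge0 : 0 <= t2 by rewrite le_min; apply/andP; split; lra.
have t1a : t1 <= h 1 - lin 1 x by rewrite ge_min lexx.
have t1b : t1 <= h 2 - lin 2 x by rewrite ge_min lexx orbT.
have t2a : t2 <= h 4 - lin 4 x by rewrite ge_min lexx.
have t2b : t2 <= h 5 - lin 5 x by rewrite ge_min lexx orbT.
have A1 : A (x + t1 *: v).
  have hx1 : hexagon h (x + t1 *: v).
    apply/hexagon6; rewrite !linD !linZ l0 l1 l2 l3 l4 l5.
    by split; [..|split]; lra.
  have : t1 = h 1 - lin 1 x \/ t1 = h 2 - lin 2 x.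
    by rewrite /t1; case: leP => _; [left|right].
  by case=> e; [apply: (side_in (j := 1))|apply: (side_in (j := 2))] => //;
    rewrite linD linZ ?l1 ?l2 e; ring.
have A2 : A (x - t2 *: v).
  have hx1 : hexagon h (x - t2 *: v).
    apply/hexagon6; rewrite !linD !linN !linZ l0 l1 l2 l3 l4 l5.
    by split; [..|split]; lra.
  have : t2 = h 4 - lin 4 x \/ t2 = h 5 - lin 5 x.
    by rewrite /t2; case: leP => _; [left|right].
  by case=> e; [apply: (side_in (j := 4))|apply: (side_in (j := 5))] => //;
    rewrite linD linN linZ ?l4 ?l5 e; ring.
have [t0|t0] := eqVneq (t1 + t2) 0.
  have t10 : t1 = 0 by lra.
  by move: A1; rewrite t10 scale0r addr0.
have -> : x = (t2 / (t1 + t2)) *: (x + t1 *: v) + (1 - t2 / (t1 + t2)) *: (x - t2 *: v).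
  have [a b] := (x, v).
  apply: (@lin_inj R 0); rewrite !(linD, linB, linZ, linN); field; exact: t0.
apply: cA => //; apply/andP; split; first by rewrite divr_ge0// addr_ge0.
by rewrite ler_pdivrMr ?mul1r ?lerDr// lt_neqAle eq_sym t0 addr_ge0.
Qed.
End convex_hexagon.

Section wulff_is_hexagon.
Variables (A : set (R * R)) (m : nat) (p nu : 'I_m -> R * R).
Hypothesis clA : closed A.
Hypothesis cA : forall x y (t : R), A x -> A y -> 0 <= t <= 1 -> A (t *: x + (1 - t) *: y).
Hypothesis poly : wulff_polygon A p nu.

Let pneq k : p k <> p (ordS k). Proof. by case: poly => -[]. Qed.

Let segA k x : segment (p k) (p (ordS k)) x -> A x.
Proof.
move=> kx; case: poly => _ bd _ _ _.
have : boundary A x by rewrite bd; exists k.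
by move=> [+ _]; have /closure_id <- := clA.
Qed.

Let pA k : A (p k).
Proof. by apply: (@segA k); exists 0; [by rewrite /= lexx ler01|by rewrite scale0r addr0]. Qed.

Let lin_side k j : nu k = nrm R j -> lin j (p (ordS k)) = lin j (p k).
Proof.
move=> kj; case: poly => _ _ _ /(_ k)[_ + _] _.
by rewrite kj -/(lin _ _) linB => /eqP; rewrite subr_eq0 => /eqP.
Qed.

Let support k j y : nu k = nrm R j -> A y -> lin j y <= lin j (p k).
Proof.
move=> kj Ay; rewrite leNgt; apply/negP => lt.
set a := p k in lt *; set b := p (ordS k).
have ab : lin j b = lin j a by exact: lin_side.
pose D := lin (j + 1) (b - a); pose H := lin j y - lin j a.
have H0 : 0 < H by rewrite subr_gt0.
have D0 : D != 0.
  apply/eqP => D0; apply: (@pneq k); apply: (@lin_inj R j) => //.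
  by move: D0; rewrite /D linB => /eqP; rewrite subr_eq0 => /eqP.
pose x := a + (1 / 2) *: (b - a).
have [d d0 dA] : exists2 d : R, 0 < d & forall r, 0 < r < d -> ~ A (x + r *: nu k) /\ A (x - r *: nu k).
  case: poly => _ _ _ /(_ k)[_ _ +] _; apply; exists (1 / 2) => //=.
  by apply/andP; split; lra.
pose c := (H / 2 - lin (j + 1) y + lin (j + 1) a) / D.
pose s := (2 * (`|c| + 1) + 2 * (H / d))^-1.
have Hd : 0 < H / d by rewrite divr_gt0.
have c1 : 0 < `|c| + 1 by rewrite ltr_wpDl.
have s0 : 0 < s by rewrite invr_gt0; lra.
have sE : s * (2 * (`|c| + 1) + 2 * (H / d)) = 1.
  by rewrite mulVf// gt_eqF//; lra.
have sc : s * (`|c| + 1) <= 1 / 2.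
  have : 0 < s * (H / d) by rewrite mulr_gt0.
  by lra.
have sc0 : 0 < s * (`|c| + 1) by rewrite mulr_gt0.
have sH : s * H < d.
  have : s * (H / d) < 1 by lra.
  by rewrite mulrA ltr_pdivrMr// mul1r.
have s1 : s <= 1 / 2.
  have : 0 <= s * `|c| by rewrite mulr_ge0// ltW.
  by move: sc; rewrite mulrDr mulr1; lra.
have scn : `|s * c| <= s * `|c| by rewrite normrM gtr0_norm.
have : s * `|c| + s <= 1 / 2 by move: sc; rewrite mulrDr mulr1.
move: scn; rewrite ler_norml => /andP[sc1 sc2] sc3.
pose t := (1 / 2 + s * c) / (1 - s).
have s1' : 0 < 1 - s by lra.
have t01 : 0 <= t <= 1.
  apply/andP; split; first by rewrite divr_ge0//; lra.
  by rewrite ler_pdivrMr//; lra.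
have Aq : A (a + t *: (b - a)) by apply: (@segA k); exists t.
have [+ _] := dA (s * H) ltac:(by apply/andP; split => //; exact: mulr_gt0).
apply; rewrite (_ : x + _ = s *: y + (1 - s) *: (a + t *: (b - a))).
  by apply: cA => //; apply/andP; split; lra.
rewrite kj; apply: (@lin_inj R j).
  by rewrite /x !(linD, linZ, linN) lin_nrm ab /H; ring.
have bE : lin (j + 1) b = lin (j + 1) a + D by rewrite /D linB; ring.
have cE : c * D = H / 2 - lin (j + 1) y + lin (j + 1) a by rewrite /c divfK.
rewrite /x /t !(linD, linZ, linN) lin1_nrm bE; apply: subr0_eq.
rewrite [LHS](_ : _ = s * (H / 2 - lin (j + 1) y + lin (j + 1) a - c * D)).
  by rewrite cE subrr mulr0.
by field; rewrite gt_eqF.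
Qed.

Let no_turn k j (e : 'Z_6) : (forall x y, lin j x = lin j y -> lin (j + e) x = lin (j + e) y -> x = y) ->
  nu k = nrm R j -> nu (ordS k) = nrm R (j + e) -> nu (ordS (ordS k)) <> nrm R j.
Proof.
move=> inj k1 k2 k3; apply: (@pneq (ordS k)); apply: inj; last first.
  by apply/esym; exact: lin_side.
apply/eqP; rewrite eq_le; apply/andP; split; first exact: support k3 (pA _).
by rewrite (lin_side k1) (support k1).
Qed.

Let steps : exists e : 'Z_6, (e = 1 \/ e = - 1) /\
  forall j, exists k, nu k = nrm R j /\ nu (ordS k) = nrm R (j + e).
Proof.
case: poly => -[m2 _] _ _ _ [ex st].
have m0 : (0 < m)%N by exact: leq_trans m2.
pose k0 := Ordinal m0.
have [j0 kj0] := ex k0.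
have [e [e1 he]] : exists e : 'Z_6, (e = 1 \/ e = - 1) /\ nu (ordS k0) = nrm R (j0 + e).
  by case: (st _ _ kj0) => h; [exists (-1)|exists 1]; split => //; [right|left].
exists e; split => //.
have inj j x y : lin j x = lin j y -> lin (j + e) x = lin (j + e) y -> x = y.
  case: e1 => ->; first exact: lin_inj.
  by move=> h1 h2; apply: (@lin_inj R (j - 1)) => //; rewrite subrK.
have H i : nu (iter i (@ordS m) k0) = nrm R (j0 + e * i%:R) /\
    nu (iter i.+1 (@ordS m) k0) = nrm R (j0 + e * i%:R + e).
  elim: i => [|i [IH1 IH2]]; first by rewrite mulr0 addr0.
  split; first by rewrite IH2 -addrA -[X in _ + X]mulr1n -natr1 mulrDr mulr1.
  have := no_turn (@inj _) IH1 IH2; case: (st _ _ IH2) => /=.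
  - case: e1 => -> E; first by rewrite E addrK.
    by move=> _; rewrite E; congr nrm; rewrite -natr1 mulrDr mulr1 addrA.
  - case: e1 => -> E; last by rewrite E subrK.
    by move=> _; rewrite E; congr nrm; rewrite -natr1 mulrDr mulr1 addrA.
move=> j; pose i : nat := (e * (j - j0) : 'Z_6)%R.
have ij : j = j0 + e * i%:R.
  rewrite /i natr_Zp mulrA (_ : e * e = 1) ?mul1r ?subrKC//.
  by case: e1 => ->; rewrite ?mulrNN ?mulr1.
by exists (iter i (@ordS m) k0); rewrite ij; exact: H.
Qed.

(** Each side lies on a supporting line of the convex set. Turning by [e] from one
    side to the next and back again would put both neighbours of a side on the same supporting
    line, and this side would be a point. So all turns have the same sign, all six normals occur, and
    consecutive supporting lines meet at a vertex of [A]. Hence [A] is the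
    intersection of the six half-planes. *)
Lemma wulff_polygon_hexagon : exists2 h, (forall j, 0 < rlen h j) & A = hexagon h.
Proof.
have [e [e1 ek]] := steps.
have [K KP] := choice ek.
pose h j := lin j (p (K j)).
have Ah : A `<=` hexagon h.
  by move=> y Ay j; exact: (support (KP j).1).
have vA j : A (vertex h j).
  case: e1 => E.
    have [k1 k2] := KP j; rewrite (_ : vertex h j = p (ordS (K j))) //.
    apply: (@lin_inj R j); first by rewrite lin_vertex (lin_side k1).
    rewrite lin1_vertex; apply/eqP; rewrite eq_le; apply/andP; split; last exact: Ah.
    by rewrite E in k2; exact: support k2 (pA _).
  have [k1 k2] := KP (j + 1); rewrite (_ : vertex h j = p (ordS (K (j + 1)))) //.
  apply: (@lin_inj R j); last by rewrite lin1_vertex (lin_side k1).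
  rewrite lin_vertex; apply/eqP; rewrite eq_le; apply/andP; split; last exact: Ah.
  by rewrite E addrK in k2; exact: support k2 (pA _).
have l0 j : 0 <= rlen h j.
  have := Ah _ (vA j) (j - 1); rewrite lin1 lin_vertex lin1_vertex /rlen; lra.
have hl j : 0 < rlen h j.
  rewrite lt_neqAle l0 andbT; apply/eqP => r0; apply: (@pneq (K j)).
  have [k1 _] := KP j.
  apply: (@lin_inj R j); first by rewrite (lin_side k1).
  have H k : lin j (p k) = h j -> lin (j + 1) (p k) = h (j + 1).
    move=> kj; have := Ah _ (pA k) (j - 1); have := Ah _ (pA k) (j + 1).
    by move: r0; rewrite lin1 kj /rlen; lra.
  by rewrite !H// (lin_side k1).
exists h => //; apply/seteqP; split => //.
exact: hexagon_sub_convex.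
Qed.
End wulff_is_hexagon.

(** The reduction of the geometric definition to six real numbers. *)
Lemma wulff_hexagonP (A : set (R * R)) :
  wulff_hexagon A <-> exists2 h, (forall j, 0 < rlen h j) & A = hexagon h.
Proof.
split=> [[cl cv [_ [m [p [nu pol]]]]]|[h hl ->]]; last exact: hexagon_wulff.
by apply: wulff_polygon_hexagon pol => //; exact/convex_setP.
Qed.
End Converse.

(** * Hausdorff measure of segments *)

Section HausdorffMeasure.
Context {R : realType}.
Implicit Types (A B : set (R * R)) (x y : R * R).

Lemma ediam_ge0 A : (0 <= ediam A)%E.
Proof. by apply: ereal_sup_ubound; left. Qed.

Lemma ediam0 : ediam (set0 : set (R * R)) = 0%E.
Proof.
apply/eqP; rewrite eq_le ediam_ge0 andbT; apply: ub_ereal_sup.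
by move=> _ [->//|[x []]].
Qed.

Lemma ediam_ub A x y : A x -> A y -> ((enorm (x - y))%:E <= ediam A)%E.
Proof. by move=> Ax Ay; apply: ereal_sup_ubound; right; exists x => //; exists y. Qed.

Lemma ediam_le A (r : R) : 0 <= r -> (forall x y, A x -> A y -> enorm (x - y) <= r) ->
  (ediam A <= r%:E)%E.
Proof.
move=> r0 H; apply: ub_ereal_sup => _ [->|[x Ax [y Ay <-]]]; first by rewrite lee_fin.
by rewrite lee_fin H.
Qed.

(** A finite cover is completed by empty sets to a sequence. *)
Lemma pre_list (delta : R) A (l : seq (set (R * R))) : 0 <= delta ->
  (forall x, A x -> exists2 X, X \in l & X x) ->
  (forall X, X \in l -> (ediam X <= delta%:E)%E) ->
  (hausdorff1_pre delta A <= \sum_(X <- l) ediam X)%E.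
Proof.
move=> d0 cov dl; apply: ereal_inf_lbound.
exists (fun n => nth set0 l n).
  split=> [x /cov[X Xl Xx]|n].
    by exists (index X l) => //; rewrite nth_index.
  have [nl|nl] := ltnP n (size l); first by apply: dl; exact: mem_nth.
  by rewrite nth_default// ediam0 lee_fin.
rewrite (nneseries_split 0 (size l))//; last by move=> n _; exact: ediam_ge0.
rewrite add0n eseries0 ?adde0.
  by rewrite (big_nth set0).
by move=> n /= ln _; rewrite nth_default// ediam0.
Qed.

Lemma pre_ge0 delta A : (0 <= hausdorff1_pre delta A)%E.
Proof.
apply: le_ereal_inf_tmp => _ [U _ <-]; apply: nneseries_ge0 => n _ _; exact: ediam_ge0.
Qed.

Lemma pre_mono delta A B : A `<=` B -> (hausdorff1_pre delta A <= hausdorff1_pre delta B)%E.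
Proof.
move=> AB; apply: le_ereal_inf => _ [U [BU dU] <-]; exists U => //.
by split => //; exact: subset_trans BU.
Qed.

Lemma pre_le_hausdorff1 delta A : 0 < delta -> (hausdorff1_pre delta A <= hausdorff1 A)%E.
Proof. by move=> d0; apply: ereal_sup_ubound; exists delta. Qed.

(** A set of diameter at most [delta] cannot meet both [A] and [B], so that a cover of
    the union splits into covers of the two. *)
Lemma pre_sep (delta : R) A B :
  (forall x y, A x -> B y -> delta < enorm (x - y)) ->
  (hausdorff1_pre delta A + hausdorff1_pre delta B <= hausdorff1_pre delta (A `|` B))%E.
Proof.
move=> sep; apply: le_ereal_inf_tmp => _ [U [ABU dU] <-].
pose UA n := if pselect (exists2 x, A x & U n x) then U n else set0.
pose UB n := if pselect (exists2 x, B x & U n x) then U n else set0.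
have hA : (hausdorff1_pre delta A <= \sum_(0 <= n <oo) ediam (UA n))%E.
  apply: ereal_inf_lbound; exists UA => //; split=> [x Ax|n].
    have [n _ Unx] := ABU x (or_introl Ax); exists n => //.
    by rewrite /UA; case: pselect => /= [_ //|[]]; exists x.
  rewrite /UA; case: pselect => //= _; rewrite ediam0.
  exact: le_trans (ediam_ge0 _) (dU n).
have hB : (hausdorff1_pre delta B <= \sum_(0 <= n <oo) ediam (UB n))%E.
  apply: ereal_inf_lbound; exists UB => //; split=> [x Ax|n].
    have [n _ Unx] := ABU x (or_intror Ax); exists n => //.
    by rewrite /UB; case: pselect => /= [_ //|[]]; exists x.
  rewrite /UB; case: pselect => //= _; rewrite ediam0.
  exact: le_trans (ediam_ge0 _) (dU n).
apply: (le_trans (leeD hA hB)).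
rewrite -nneseriesD; [|by move=> *; exact: ediam_ge0..].
apply: lee_nneseries; first by move=> *; rewrite adde_ge0 ?ediam_ge0.
move=> n _.
rewrite /UA /UB; case: pselect => /= [[x Ax Ux]|_]; last first.
  by rewrite ediam0 add0e; case: pselect => //= _; rewrite ediam0 ediam_ge0.
case: pselect => /= [[y By Uy]|_]; last by rewrite ediam0 adde0.
have := le_trans (ediam_ub Ux Uy) (dU n); rewrite lee_fin => h.
by have := lt_le_trans (sep _ _ Ax By) h; rewrite ltxx.
Qed.

(** A cover of the segment by sets of diameters [d_n] yields a cover of an interval of
    parameters by intervals that are not longer, to which countable subadditivity of the
    Lebesgue measure applies. *)
Lemma segment_pre_ge (delta : R) (a b : R * R) :
  ((enorm (b - a))%:E <= hausdorff1_pre delta (segment a b))%E.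
Proof.
have [ab|ab] := eqVneq (enorm (b - a)) 0; first by rewrite ab pre_ge0.
have L0 : 0 < enorm (b - a) by rewrite lt_neqAle eq_sym ab enorm_ge0.
set L := enorm (b - a) in ab L0 *.
pose t (x : R * R) : R := dot (x - a) (b - a) / L.
have tlip x y : `|t x - t y| <= enorm (x - y).
  rewrite /t -mulrBl normrM normfV (gtr0_norm L0) ler_pdivrMr//.
  rewrite (_ : dot (x - a) (b - a) - dot (y - a) (b - a) = dot (x - y) (b - a)).
    exact: cauchy.
  by rewrite /dot /=; ring.
apply: le_ereal_inf_tmp => _ [U [abU dU] <-].
pose I n : set R := if pselect (U n !=set0) then `[inf (t @` U n), sup (t @` U n)]%classic else set0.
have cov : `[0, L]%classic `<=` \bigcup_n I n.
  move=> r /=; rewrite in_itv/= => /andP[r0 rL].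
  have : segment a b (a + (r / L) *: (b - a)).
    exists (r / L) => //=; rewrite divr_ge0 ?(ltW L0)//= ler_pdivrMr// mul1r//.
  move=> /abU[n _ Un]; exists n => //.
  have tr : t (a + (r / L) *: (b - a)) = r.
    rewrite /t addrC addKr (_ : dot _ _ = r / L * (L * L)).
      by field.
    rewrite enorm_sq /dot /= /GRing.scale/=; ring.
  rewrite /I; case: pselect => /= [_|[]]; last by eexists; exact: Un.
  have bd x : U n x -> `|t x - r| <= delta.
    move=> Ux; rewrite -tr (le_trans (tlip _ _))//.
    by rewrite -lee_fin (le_trans _ (dU n))//; exact: ediam_ub.
  rewrite /= in_itv/=; apply/andP; split.
    apply: ge_inf; last by exists (a + (r / L) *: (b - a)).
    exists (r - delta) => _ [x Ux <-]; have := bd _ Ux; rewrite ler_norml => /andP[]; lra.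
  apply: ub_le_sup; last by exists (a + (r / L) *: (b - a)).
  exists (r + delta) => _ [x Ux <-]; have := bd _ Ux; rewrite ler_norml => /andP[]; lra.
have mI n : measurable (I n).
  by rewrite /I; case: pselect => /= _; [exact: measurable_itv|exact: measurable0].
have -> : L%:E = lebesgue_measure (`[0, L]%classic : set R).
  by rewrite lebesgue_measure_itv/= lte_fin L0 oppr0 adde0.
apply: (@le_trans _ _ (\sum_(0 <= n <oo) lebesgue_measure (I n))%E).
  by apply: measure_sigma_subadditive => //; exact: measurable_itv.
apply: lee_nneseries => // n _.
rewrite /I; case: pselect => /= [[u Uu]|_]; last by rewrite measure0 ediam_ge0.
rewrite lebesgue_measure_itv/=; case: ifPn => _; last exact: ediam_ge0.
have dfin : ediam (U n) \is a fin_num.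
  by rewrite ge0_fin_numE ?ediam_ge0// (le_lt_trans (dU n))// ltry.
rewrite -(fineK dfin) -EFinB lee_fin lerBlDr.
have H x y : U n x -> U n y -> t x <= fine (ediam (U n)) + t y.
  move=> Ux Uy; rewrite -lerBlDr (le_trans (ler_norm _))// (le_trans (tlip _ _))//.
  by rewrite -lee_fin fineK// ediam_ub.
have ne : t @` U n !=set0 by exists (t u), u.
apply: ge_sup => // _ [x Ux <-]; rewrite -lerBlDl.
by apply: lb_le_inf => // _ [y Uy <-]; rewrite lerBlDl H.
Qed.

Lemma segment_diam (a b : R * R) (s t : R) : 0 <= t - s ->
  (ediam [set (a + r *: (b - a))%R | r in `[s, t]] <= ((t - s) * enorm (b - a))%:E)%E.
Proof.
move=> st; apply: ediam_le; first by rewrite mulr_ge0// enorm_ge0.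
move=> _ _ [r /= + <-] [r' /= + <-]; rewrite !in_itv/= => /andP[r0 r1] /andP[r'0 r'1].
rewrite opprD addrACA subrr add0r -scalerBl enormZ ler_wpM2r ?enorm_ge0//.
by rewrite ler_norml; apply/andP; split; lra.
Qed.

(** Cutting into equal pieces shorter than [delta]. *)
Lemma segment_pieces (delta : R) (a b : R * R) : 0 < delta ->
  exists l : seq (set (R * R)), [/\ forall x, segment a b x -> exists2 X, X \in l & X x,
    forall X, X \in l -> (ediam X <= delta%:E)%E &
    (\sum_(X <- l) ediam X <= (enorm (b - a))%:E)%E].
Proof.
move=> d0; set L := enorm (b - a).
have L0 : 0 <= L := enorm_ge0 _.
pose N := (Num.truncn (L / delta)).+1.
have N0 : 0 < N%:R :> R by rewrite ltr0n.
have LN : L / N%:R <= delta.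
  by rewrite ler_pdivrMr// mulrC -ler_pdivrMr//; apply/ltW; exact: truncnS_gt.
pose piece (k : nat) : set (R * R) :=
  [set (a + r *: (b - a))%R | r in `[k%:R / N%:R, k.+1%:R / N%:R]].
have dk k : (ediam (piece k) <= (L / N%:R)%:E)%E.
  have kk : k.+1%:R / N%:R - k%:R / N%:R = 1 / N%:R :> R.
    by rewrite -mulrBl -natr1 addrAC subrr add0r.
  apply: (le_trans (segment_diam _ _ _)); rewrite kk ?divr_ge0//.
  by rewrite lee_fin mul1r mulrC.
exists [seq piece k | k <- iota 0 N]; split.
- move=> x [r /andP[r0 r1] <-].
  pose k := minn (Num.truncn (r * N%:R)) N.-1.
  exists (piece k); first by apply: map_f; rewrite mem_iota /k; lia.
  exists r => //=; rewrite in_itv/= ler_pdivrMr// ler_pdivlMr//.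
  have rN0 : 0 <= r * N%:R by rewrite mulr_ge0// ltW.
  have [t1 t2] := andP (truncn_itv rN0); apply/andP; split.
    by apply: le_trans t1; rewrite ler_nat geq_minl.
  rewrite /k; have [kl|kl] := leqP (Num.truncn (r * N%:R)) N.-1; first exact: ltW.
  by rewrite /= ler_piMl// ltW.
- by move=> _ /mapP[k _ ->]; apply: (le_trans (dk k)); rewrite lee_fin.
- rewrite big_map; apply: (@le_trans _ _ (\sum_(k <- iota 0 N) (L / N%:R)%:E)%E).
    by apply: lee_sum => k _; exact: dk.
  rewrite sumEFin lee_fin big_const_seq count_predT size_iota iter_addr_0 -[leLHS]mulr_natr.
  by rewrite divfK// gt_eqF.
Qed.

Lemma hausdorff1_upper (T : eqType) (s : seq T) (a b : T -> R * R) A :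
  (forall x, A x -> exists2 e, e \in s & segment (a e) (b e) x) ->
  (hausdorff1 A <= (\sum_(e <- s) enorm (b e - a e))%:E)%E.
Proof.
move=> cov; apply: ub_ereal_sup => _ [delta d0 <-].
have [l /all_and3[l1 l2 l3]] := choice (fun e : T => segment_pieces (a e) (b e) d0).
apply: (@le_trans _ _ (\sum_(X <- flatten [seq l e | e <- s]) ediam X)%E).
  apply: pre_list; first exact: ltW.
  - move=> x /cov[e es /l1[X Xl Xx]]; exists X => //.
    by apply/flatten_mapP; exists e.
  - by move=> X /flatten_mapP[e es Xl]; exact: l2 Xl.
rewrite big_flatten big_map -sumEFin; apply: lee_sum => e _; exact: l3.
Qed.

(** Segments at mutual distance larger than [delta] contribute additively to the
    premeasure at scale [delta]. The lemma is applied to slightly shortened edges, since adjacent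
    edges touch. *)
Lemma hausdorff1_lower (T : eqType) (s : seq T) (a b : T -> R * R) (delta : R) A :
  0 < delta -> uniq s ->
  (forall e x, e \in s -> segment (a e) (b e) x -> A x) ->
  (forall e e' x y, e \in s -> e' \in s -> e != e' -> segment (a e) (b e) x ->
     segment (a e') (b e') y -> delta < enorm (x - y)) ->
  ((\sum_(e <- s) enorm (b e - a e))%:E <= hausdorff1 A)%E.
Proof.
move=> d0; pose S (s : seq T) := [set x | exists2 e, e \in s & segment (a e) (b e) x].
move=> us sA sep; apply: le_trans (pre_le_hausdorff1 A d0).
apply: (@le_trans _ _ (hausdorff1_pre delta (S s))); last first.
  by apply: pre_mono => x [e es ex]; exact: sA ex.
elim: s us sep {sA} => [_ _|e s IH /= /andP[es us] sep].
  by rewrite big_nil; exact: pre_ge0.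
rewrite big_cons EFinD.
apply: (@le_trans _ _ (hausdorff1_pre delta (segment (a e) (b e) `|` S s))); last first.
  apply: pre_mono => x [ex|[e' e's e'x]]; first by exists e; rewrite ?mem_head.
  by exists e' => //; rewrite inE e's orbT.
apply: le_trans (pre_sep _); last first.
  move=> x y ex [e' e's e'y]; apply: (sep e e') => //; rewrite ?mem_head ?inE ?e's ?orbT//.
  by apply: contraNneq es => ->.
apply: leeD; first exact: segment_pre_ge.
apply: IH => // e1 e2 x y h1 h2; apply: sep; rewrite inE ?h1 ?h2 orbT//.
Qed.

Lemma hausdorff1_segment (a b : R * R) : hausdorff1 (segment a b) = (enorm (b - a))%:E.
Proof.
apply/eqP; rewrite eq_le; apply/andP; split.
  have := @hausdorff1_upper unit [:: tt] (fun=> a) (fun=> b) (segment a b).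
  by rewrite big_seq1; apply => x ex; exists tt.
exact: le_trans (segment_pre_ge 1 a b) (pre_le_hausdorff1 _ ltr01).
Qed.
End HausdorffMeasure.

(** * Cells of the dual lattice *)

Section Cells.
Context {R : realType}.
Implicit Types (x y : R * R) (j k : 'Z_6) (a b : int * int).
Local Notation s3 := (Num.sqrt (3 : R)).

(** The form along the side: the edges of the cells, unlike those of the hexagons, are
    perpendicular to the lattice directions. *)
Definition tn j x : R := dot x (tang j).

Lemma tnD j x y : tn j (x + y) = tn j x + tn j y.
Proof. by rewrite /tn /dot /=; ring. Qed.
Lemma tnZ j (c : R) x : tn j (c *: x) = c * tn j x.
Proof. by rewrite /tn /dot /= /GRing.scale /=; ring. Qed.
Lemma tnN j x : tn j (- x) = - tn j x.
Proof. by rewrite /tn /dot /=; ring. Qed.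
Lemma tnB j x y : tn j (x - y) = tn j x - tn j y.
Proof. by rewrite tnD tnN. Qed.

Lemma tn_rot j x : tn j x = lin j (x.2, - x.1).
Proof. by rewrite /tn /lin /tang /perp /dot /=; ring. Qed.

Lemma tn1 j x : tn (j - 1) x = tn j x - tn (j + 1) x.
Proof. by rewrite !tn_rot lin1. Qed.
Lemma tn2 j x : tn (j + 2) x = tn (j + 1) x - tn j x.
Proof. by rewrite !tn_rot lin2. Qed.
Lemma tn3 j x : tn (j + 3) x = - tn j x.
Proof. by rewrite !tn_rot lin3. Qed.
Lemma tn4 j x : tn (j + 4) x = - tn (j + 1) x.
Proof. by rewrite !tn_rot lin4. Qed.
Lemma tn5 j x : tn (j + 5) x = tn j x - tn (j + 1) x.
Proof. by rewrite !tn_rot lin5. Qed.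

Lemma tn_inj j x y : tn j x = tn j y -> tn (j + 1) x = tn (j + 1) y -> x = y.
Proof.
rewrite !tn_rot => e0 e1; have [] := lin_inj e0 e1.
by case: x y {e0 e1} => [a b] [c d] /= -> /oppr_inj ->.
Qed.

Lemma tn_enorm j x : `|tn j x| <= enorm x.
Proof.
rewrite tn_rot (le_trans (lin_enorm _ _))// /enorm /dot /= mulrNN addrC //.
Qed.

Lemma tn_continuous j : continuous (tn j).
Proof.
move=> x; rewrite /tn /dot; apply: cvgD.
  by apply: cvgM; [exact: cvg_fst|exact: cvg_cst].
by apply: cvgM; [exact: cvg_snd|exact: cvg_cst].
Qed.

Lemma tn_nrm j : tn j (nrm R j) = 0.
Proof. by rewrite /tn /tang /perp /dot /=; ring. Qed.

Lemma tn_nrm1 j : tn j (nrm R (j + 1)) = s3 / 2.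
Proof. by rewrite -(lin1_tang j) /lin /tn /dot; ring. Qed.

Lemma tn1_nrm j : tn (j + 1) (nrm R j) = - (s3 / 2).
Proof.
have [n0 n1 n2 n3 [n4 n5]] := nrmE (R := R); have sq := @s3_sq R.
by move: j; apply: Z6_ind;
  rewrite /tn /tang /perp /dot /= ?n0 ?n1 ?n2 ?n3 ?n4 ?n5 /=; lra.
Qed.

Lemma tn_nrm_le i j : tn i (nrm R j) <= s3 / 2.
Proof.
have s0 := @s3_gt0 R.
by move: i; apply: (@Z6_all _ j); rewrite ?tn2 ?tn3 ?tn4 ?tn5 ?tn_nrm ?tn1_nrm; lra.
Qed.

(** The cell is given as a convex hull of six points; each of its points is written as
    a convex combination of two consecutive ones and the centre, which is the midpoint of two
    opposite ones. *)
Lemma cell_tn x : cell x <-> forall j, tn j x <= 1 / 2.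
Proof.
have s0 := @s3_gt0 R; have sq := @s3_sq R.
split=> [[w [w0 w1] <-] i|H].
  rewrite tnZ (_ : tn i _ = \sum_j w j * tn i (nrm R j)); last first.
    rewrite (big_morph (tn i) (tnD i) (id1 := 0)); last by rewrite /tn /dot /=; ring.
    by apply: eq_bigr => j _; rewrite tnZ.
  apply: (@le_trans _ _ (s3 / 3 * \sum_j w j * (s3 / 2))).
    apply: ler_wpM2l; first by rewrite divr_ge0// ltW.
    by apply: ler_sum => j _; rewrite ler_wpM2l// tn_nrm_le.
  by rewrite -mulr_suml w1; lra.
have [j [j0 j1]] : exists j, 0 <= tn j x /\ tn (j + 1) x <= 0.
  have := tn2 0 x; have := tn3 0 x; have := tn4 0 x; have := tn5 0 x; rewrite !add0r => e5 e4 e3 e2.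
  have [u0|u0] := leP 0 (tn 0 x).
    have [u1|u1] := leP (tn 1 x) 0; first by exists 0; rewrite add0r.
    have [u2|u2] := leP (tn 2 x) 0.
      by exists 1; rewrite ltW//; split => //; rewrite (_ : 1 + 1 = 2 :> 'Z_6)//; apply/eqP.
    by exists 2; rewrite ltW//; split => //; rewrite (_ : 2 + 1 = 3 :> 'Z_6) ?e3; [lra|apply/eqP].
  have [u1|u1] := leP 0 (tn 1 x).
    by exists 3; rewrite e3; split; [lra|rewrite (_ : 3 + 1 = 4 :> 'Z_6) ?e4; [lra|apply/eqP]].
  have [u2|u2] := leP 0 (tn 2 x).
    by exists 4; rewrite e4; split; [lra|rewrite (_ : 4 + 1 = 5 :> 'Z_6) ?e5; [lra|apply/eqP]].
  by exists 5; rewrite e5; split; [lra|rewrite (_ : 5 + 1 = 0 :> 'Z_6); [lra|apply/eqP]].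
pose al := - tn (j + 1) x * 2; pose be := tn j x * 2.
have rr : 0 <= 1 - al - be.
  by have := H (j - 1); rewrite tn1 /al /be; lra.
have al0 : 0 <= al by rewrite /al; lra.
have be0 : 0 <= be by rewrite /be; lra.
pose om (k : 'Z_6) : R := nth 0 [:: al + (1 - al - be) / 2; be; 0; (1 - al - be) / 2; 0; 0] k.
exists (fun k => om (k - j)).
  split.
    by move=> k; move: (k - j); apply: Z6_ind; rewrite /om /=; lra.
  rewrite -(sum_Z6_shift _ j) (eq_bigr om); last by move=> k _; rewrite addrK.
  by rewrite sum_Z6 /om /=; field.
rewrite -(sum_Z6_shift _ j) (eq_bigr (fun k => om k *: nrm R (k + j))); last first.
  by move=> k _; rewrite addrK.
rewrite sum_Z6 /om /= !scale0r !addr0 add0r (addrC 1 j) (addrC 3 j).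
apply: (@tn_inj j); rewrite tnZ !tnD !tnZ.
  have -> : tn j (nrm R (j + 3)) = 0.
    have := tn_nrm (j + 3); rewrite tn3; lra.
  by rewrite tn_nrm tn_nrm1 /be; nra.
have -> : tn (j + 1) (nrm R (j + 3)) = s3 / 2.
  have := tn1_nrm (j + 3); rewrite (Z6E j) tn4; lra.
by rewrite tn1_nrm tn_nrm /al; nra.
Qed.

Lemma cell_atP (eps : R) i x : 0 < eps ->
  cell_at eps i x <-> forall j, tn j (x - i) <= eps / 2.
Proof.
move=> e0; split=> [[y /cell_tn H <-] j|H].
  by rewrite addrC addKr tnZ; have := H j; rewrite -(ler_pM2l e0); lra.
exists (eps^-1 *: (x - i)); last by rewrite scalerA divff ?gt_eqF// scale1r subrKC.
by apply/cell_tn => j; rewrite tnZ mulrC ler_pdivrMr//; have := H j; lra.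
Qed.

Definition latt (eps : R) a : R * R :=
  eps *: (a.1%:~R *: eta1 R + a.2%:~R *: eta2 R).

Lemma lattD eps a b : latt eps (a + b) = latt eps a + latt eps b.
Proof.
by rewrite /latt -scalerDr /= !intrD !scalerDl addrACA.
Qed.
Lemma lattN eps a : latt eps (- a) = - latt eps a.
Proof. by rewrite /latt -scalerN /= !intrN !scaleNr opprD. Qed.
Lemma lattB eps a b : latt eps (a - b) = latt eps a - latt eps b.
Proof. by rewrite lattD lattN. Qed.

Lemma lin_latt eps a j : lin j (latt eps a) = eps * (s3 / 2) * (hform j a)%:~R.
Proof.
have [n0 n1 n2 n3 [n4 n5]] := linE (latt eps a).
move: j; apply: Z6_ind; rewrite ?n0 ?n1 ?n2 ?n3 ?n4 ?n5 /hform /latt /eta1 /eta2 /= /GRing.scale /=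
  ?intrN ?intrD; lra.
Qed.

(** The values of the normalized forms at lattice points, see [cn_latt]. *)
Definition tform j a : int := hform (j + 1) a + hform (j + 2) a.

Lemma tformE j a : tform j a = 2 * hform (j + 1) a - hform j a.
Proof. by rewrite /tform form2; ring. Qed.

Lemma s3_tn j x : s3 * tn j x = lin (j + 1) x + lin (j + 2) x.
Proof.
have sq1 : s3 * s3 * x.1 = 3 * x.1 by rewrite s3_sq.
have sq2 : s3 * s3 * x.2 = 3 * x.2 by rewrite s3_sq.
rewrite tn_rot lin2; have [n0 n1 n2 n3 [n4 n5]] := linE (x.2, - x.1).
have [m0 m1 m2 m3 [m4 m5]] := linE x.
by move: j; apply: Z6_ind; rewrite /= ?n0 ?n1 ?n2 ?n3 ?n4 ?n5 ?m0 ?m1 ?m2 ?m3 ?m4 ?m5 /=; lra.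
Qed.

Lemma tn_latt eps a j : tn j (latt eps a) = eps / 2 * (tform j a)%:~R.
Proof.
have s0 : s3 != 0 by rewrite gt_eqF// s3_gt0.
by apply: (mulfI s0); rewrite s3_tn !lin_latt /tform intrD; ring.
Qed.

Lemma lattice_latt eps : lattice eps = range (latt eps).
Proof. by []. Qed.
End Cells.

Section CellForms.
Context {R : realType}.
Variable eps : R.
Hypothesis eps0 : 0 < eps.
Implicit Types (x y : R * R) (j k : 'Z_6) (a b c : int * int).
Local Notation s3 := (Num.sqrt (3 : R)).

(** Normalized so that a cell has half-width 1 and neighbouring centres are at
    distance 2. *)
Definition cn j x : R := tn j x * (2 / eps).

Lemma cnE j x : cn j x = tn j x * (2 / eps).
Proof. by []. Qed.

Lemma cnD j x y : cn j (x + y) = cn j x + cn j y.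
Proof. by rewrite /cn tnD mulrDl. Qed.
Lemma cnB j x y : cn j (x - y) = cn j x - cn j y.
Proof. by rewrite /cn tnB mulrBl. Qed.
Lemma cn2 j x : cn (j + 2) x = cn (j + 1) x - cn j x.
Proof. by rewrite /cn tn2 mulrBl. Qed.
Lemma cn3 j x : cn (j + 3) x = - cn j x.
Proof. by rewrite /cn tn3 mulNr. Qed.
Lemma cn4 j x : cn (j + 4) x = - cn (j + 1) x.
Proof. by rewrite /cn tn4 mulNr. Qed.
Lemma cn5 j x : cn (j + 5) x = cn j x - cn (j + 1) x.
Proof. by rewrite /cn tn5 mulrBl. Qed.
Lemma cn_latt j a : cn j (latt eps a) = (tform j a)%:~R.
Proof. by rewrite /cn tn_latt; field; rewrite gt_eqF. Qed.
Lemma cn_inj j x y : cn j x = cn j y -> cn (j + 1) x = cn (j + 1) y -> x = y.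
Proof.
have e0 : 2 / eps != 0 by rewrite mulf_neq0// invr_eq0 gt_eqF.
by move=> /(mulIf e0) h0 /(mulIf e0) h1; exact: tn_inj h0 h1.
Qed.
Lemma cn_continuous j : continuous (cn j).
Proof. by move=> x; apply: cvgMl; exact: tn_continuous. Qed.
Lemma cn_le_enorm j x : `|cn j x| <= enorm x * (2 / eps).
Proof.
rewrite /cn normrM [X in _ * X]gtr0_norm ?divr_gt0// ler_wpM2r ?tn_enorm//.
by rewrite divr_ge0// ltW.
Qed.

Lemma tformD j a b : tform j (a + b) = tform j a + tform j b.
Proof. by rewrite /tform !formD; ring. Qed.
Lemma tformN j a : tform j (- a) = - tform j a.
Proof. by rewrite /tform !formN; ring. Qed.
Lemma Z6F j : (j + 1 + 2 = j + 3) * (j + 2 + 2 = j + 4) * (j + 1 + 3 = j + 4) *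
  (j + 2 + 3 = j + 5).
Proof. by move: j; apply: Z6_ind; do !split; apply/eqP. Qed.
Lemma tform1 j a : tform (j + 1) a = hform (j + 1) a - 2 * hform j a.
Proof. by rewrite /tform !(Z6E j) !(Z6F j) form3 form2; ring. Qed.
Lemma tform2 j a : tform (j + 2) a = - hform (j + 1) a - hform j a.
Proof. by rewrite /tform !(Z6E j) !(Z6F j) form3 form4; ring. Qed.
Lemma tform3 j a : tform (j + 3) a = - tform j a.
Proof. by rewrite /tform !(Z6E j) form4 form1 form2; ring. Qed.
Lemma tform4 j a : tform (j + 4) a = - tform (j + 1) a.
Proof. by rewrite -(Z6F j).1.2 tform3. Qed.
Lemma tform5 j a : tform (j + 5) a = - tform (j + 2) a.
Proof. by rewrite -(Z6F j).2 tform3. Qed.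

Definition incell a x := forall j, cn j x <= 1 + (tform j a)%:~R.

Lemma cell_at_incell a x : cell_at eps (latt eps a) x <-> incell a x.
Proof.
have H j : (tn j (x - latt eps a) <= eps / 2) <-> (cn j x <= 1 + (tform j a)%:~R).
  have e : cn j (x - latt eps a) = cn j x - (tform j a)%:~R by rewrite cnB cn_latt.
  have h2 : (cn j (x - latt eps a) <= 1) = (tn j (x - latt eps a) * 2 <= eps).
    by rewrite /cn mulrA ler_pdivrMr// mul1r.
  split=> h.
    have : cn j (x - latt eps a) <= 1 by rewrite h2; lra.
    by rewrite e; lra.
  have : cn j (x - latt eps a) <= 1 by rewrite e; lra.
  by rewrite h2; lra.
by split=> [/(cell_atP _ _ eps0) h j|h]; [exact/H|apply/(cell_atP _ _ eps0) => j; exact/H].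
Qed.

Lemma incell_closed a : closed (incell a).
Proof.
rewrite (_ : incell a = \bigcap_(j in [set: 'Z_6]) (cn j @^-1` [set r | r <= 1 + (tform j a)%:~R])).
  apply: closed_bigI => j _; apply: closed_comp => [x _|]; first exact: cn_continuous.
  exact: closed_le.
by apply/seteqP; split => x /= H j; [move=> _|]; exact: H.
Qed.

Definition reg (Z : set (int * int)) : set (R * R) := cells eps (latt eps @` Z).

Lemma regP Z x : reg Z x <-> exists2 a, Z a & incell a x.
Proof.
split=> [[_ [a Za <-] /cell_at_incell ax]|[a Za ax]]; first by exists a.
by exists (latt eps a); [exists a|exact/cell_at_incell].
Qed.

(** Rounding down the lattice coordinates of the point leaves the four corners of a
    parallelogram as candidate centres. *)
Lemma tile x : exists a, incell a x.
Proof.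
pose P := (2 * cn 0 x - cn 1 x) / 3; pose Q := (cn 0 x - 2 * cn 1 x) / 3.
have key (p q : int) : `|2 * (P - p%:~R) - (Q - q%:~R)| <= 1 ->
    `|(P - p%:~R) - 2 * (Q - q%:~R)| <= 1 ->
    `|(P - p%:~R) + (Q - q%:~R)| <= 1 -> exists a, incell a x.
  rewrite !ler_norml => /andP[a1 a2] /andP[b1 b2] /andP[c1 c2].
  exists (ptof 0 q p).
  have h0 : hform 0 (ptof 0 q p) = q by exact: form_ptof.
  have h1 : hform (0 + 1) (ptof 0 q p) = p by exact: form_ptof1.
  apply: (@Z6_all _ 0); rewrite ?cn2 ?cn3 ?cn4 ?cn5 ?tform3 ?tform4 ?tform5
    ?tform2 ?tform1 ?tformE ?h0 ?h1 ?add0r ?(intrN, intrD, intrM); move: a1 a2 b1 b2 c1 c2; rewrite /P /Q; lra.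
have := floor_itv P; have := floor_itv Q.
set p := Num.floor P; set q := Num.floor Q => /andP[q0 q1] /andP[p0 p1].
rewrite !intrD in p1 q1.
pose f := P - p%:~R; pose g := Q - q%:~R.
have f0 : 0 <= f < 1 by apply/andP; split; rewrite /f; lra.
have g0 : 0 <= g < 1 by apply/andP; split; rewrite /g; lra.
move: f0 g0 => /andP[f0 f1] /andP[g0 g1].
have H (dp dq : int) : `|2 * (f - dp%:~R) - (g - dq%:~R)| <= 1 ->
    `|(f - dp%:~R) - 2 * (g - dq%:~R)| <= 1 ->
    `|(f - dp%:~R) + (g - dq%:~R)| <= 1 -> exists a, incell a x.
  have e1 : P - (p + dp)%:~R = f - dp%:~R by rewrite intrD /f; ring.
  have e2 : Q - (q + dq)%:~R = g - dq%:~R by rewrite intrD /g; ring.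
  by move=> h1 h2 h3; apply: (key (p + dp) (q + dq)); rewrite e1 e2.
have [fg|fg] := leP (f + g) 1.
  have [a1|a1] := leP (2 * f - g) 1; last first.
    by apply: (H 1 0); rewrite ler_norml; apply/andP; split; lra.
  have [a2|a2] := leP (2 * g - f) 1; last first.
    by apply: (H 0 1); rewrite ler_norml; apply/andP; split; lra.
  by apply: (H 0 0); rewrite ler_norml; apply/andP; split; lra.
have [a1|a1] := leP (-1) (2 * f - g - 1); last first.
  by apply: (H 0 1); rewrite ler_norml; apply/andP; split; lra.
have [a2|a2] := leP (-1) (2 * g - f - 1); last first.
  by apply: (H 1 0); rewrite ler_norml; apply/andP; split; lra.
by apply: (H 1 1); rewrite ler_norml; apply/andP; split; lra.
Qed.

Lemma tform_eq0 a : (forall j, tform j a <= 1) -> a = 0.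
Proof.
move=> H; have := H 0; have := H (0 + 1); have := H (0 + 2); have := H (0 + 3).
have := H (0 + 4); have := H (0 + 5).
rewrite tform3 tform4 tform5 tform2 tform1 tformE => h5 h4 h3 h2 h1 h0.
have [e0 e1] : hform 0 a = 0 /\ hform (0 + 1) a = 0.
  move: h0 h1 h2 h3 h4 h5; clear; move: (hform (0 + 1) a) (hform 0 a) => p q.
  by split; lia.
by apply: (@form_inj 0); rewrite ?e0 ?e1.
Qed.

(** This makes the index set of a union of cells well defined. *)
Lemma incell_center a b : incell a (latt eps b) -> a = b.
Proof.
move=> H; apply/esym/eqP; rewrite -subr_eq0; apply/eqP; apply: tform_eq0 => j.
have := H j; rewrite cn_latt -[1]/(1%:~R) -intrD ler_int tformD tformN.
by rewrite lerBlDr.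
Qed.

Lemma reg_cell Z a : cell_at eps (latt eps a) `<=` reg Z <-> Z a.
Proof.
split=> [H|Za x ax]; last by apply/regP; exists a => //; exact/cell_at_incell.
have /H/regP[b Zb /incell_center <-//] : cell_at eps (latt eps a) (latt eps a).
by apply/cell_at_incell => j; rewrite cn_latt lerDr.
Qed.

Lemma reg_inj Z Z' : reg Z = reg Z' -> Z = Z'.
Proof.
by move=> e; apply/seteqP; split => a /reg_cell; rewrite ?e; [|rewrite -e]; move/reg_cell.
Qed.

Definition epoint a j (t : R) : R * R :=
  latt eps a + (eps / s3) *: (nrm R (j + 1) - t *: nrm R j).

Let s3n0 : s3 != 0. Proof. by rewrite gt_eqF// s3_gt0. Qed.

Lemma cn_epoint a j t : cn j (epoint a j t) = (tform j a)%:~R + 1.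
Proof.
rewrite cnD cn_latt; congr (_ + _); rewrite /cn tnZ tnB tnZ tn_nrm tn_nrm1.
by field; rewrite s3n0 gt_eqF.
Qed.

Lemma cn1_epoint a j t : cn (j + 1) (epoint a j t) = (tform (j + 1) a)%:~R + t.
Proof.
rewrite cnD cn_latt; congr (_ + _); rewrite /cn tnZ tnB tnZ tn_nrm tn1_nrm.
by field; rewrite s3n0 gt_eqF.
Qed.

Lemma cnZ j (r : R) x : cn j (r *: x) = r * cn j x.
Proof. by rewrite /cn tnZ mulrA. Qed.

Lemma epoint_segment a j (s t r : R) :
  epoint a j s + r *: (epoint a j t - epoint a j s) = epoint a j (s + r * (t - s)).
Proof.
apply: (@cn_inj j); rewrite cnD cnZ cnB ?cn_epoint ?cn1_epoint; ring.
Qed.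

Lemma enorm_edge a j (s t : R) :
  enorm (epoint a j t - epoint a j s) = eps / s3 * `|t - s|.
Proof.
have -> : epoint a j t - epoint a j s = (eps / s3 * (s - t)) *: nrm R j.
  apply: (@cn_inj j); rewrite cnB cnZ ?cn_epoint ?cn1_epoint /cn ?tn_nrm ?tn1_nrm.
    by ring.
  by field; rewrite s3n0 gt_eqF.
rewrite enormZ enorm_nrm mulr1 normrM gtr0_norm ?divr_gt0 ?s3_gt0//.
by rewrite distrC.
Qed.

Lemma tform_dir j : tform j (dirv j) = 2.
Proof. by rewrite tformE form_dir form_dir1. Qed.
Lemma tform1_dir j : tform (j + 1) (dirv j) = 1.
Proof. by rewrite tform1 form_dir form_dir1. Qed.

Lemma tform_le2 c : c != 0 -> (forall j, tform j c <= 2) -> exists j, c = dirv j.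
Proof.
move=> c0 H; have := H 0; have := H (0 + 1); have := H (0 + 2); have := H (0 + 3).
have := H (0 + 4); have := H (0 + 5).
rewrite tform3 tform4 tform5 tform2 tform1 tformE => h5 h4 h3 h2 h1 h0.
have E p q : hform 0 c = q -> hform (0 + 1) c = p -> c = ptof 0 q p.
  by move=> e0 e1; apply: (@form_inj 0); rewrite ?form_ptof ?form_ptof1.
move: h0 h1 h2 h3 h4 h5 E; move: (hform (0 + 1) c) (hform 0 c) => p q h0 h1 h2 h3 h4 h5 E.
have {}E := E p q erefl erefl.
have cases : (p = 1 /\ q = 0) \/ (p = 0 /\ q = -1) \/ (p = -1 /\ q = -1) \/
    (p = -1 /\ q = 0) \/ (p = 0 /\ q = 1) \/ (p = 1 /\ q = 1) \/ (p = 0 /\ q = 0).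
  by move: h0 h1 h2 h3 h4 h5; clear; lia.
case: cases E => [[-> ->]|[[-> ->]|[[-> ->]|[[-> ->]|[[-> ->]|[[-> ->]|[-> ->]]]]]]] E.
- by exists 0; rewrite E.
- by exists 1; rewrite E.
- by exists 2; rewrite E.
- by exists 3; rewrite E.
- by exists 4; rewrite E.
- by exists 5; rewrite E.
by rewrite E eqxx in c0.
Qed.

(** If two different cells meet, all normalized forms of the difference of their centres are
    at most 2, which leaves only the six neighbours. *)
Lemma incell_edge a b x : a != b -> incell a x -> incell b x ->
  exists j, b = a + dirv j /\ segment (epoint a j 0) (epoint a j 1) x.
Proof.
move=> ab ax bx.
have [j bE] : exists j, b - a = dirv j.
  apply: tform_le2; first by rewrite subr_eq0 eq_sym.
  move=> j; have := ax j; have := bx (j + 3); rewrite cn3 tform3 tformD tformN => h1 h2.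
  rewrite -(ler_int R) intrD intrN; rewrite intrN in h1; lra.
have {}bE : b = a + dirv j by rewrite -bE subrKC.
exists j; split => //; exists (cn (j + 1) x - (tform (j + 1) a)%:~R).
  have := ax (j + 1); have := bx (j + 4); rewrite cn4 tform4 bE tformD tform1_dir => h1 h2.
  by move: h1; rewrite intrN intrD => h1; apply/andP; split; lra.
rewrite epoint_segment; apply: (@cn_inj j).
  rewrite cn_epoint; have := ax j; have := bx (j + 3); rewrite cn3 tform3 bE tformD tform_dir => h1 h2.
  by move: h1; rewrite intrN intrD => h1; lra.
by rewrite cn1_epoint; ring.
Qed.

Lemma int_ge_lt (z n : int) : n%:~R - 1 < z%:~R :> R -> n <= z.
Proof. by rewrite -[1]/(1%:~R) -intrB ltr_int; lia. Qed.
Lemma int_le_lt (z n : int) : z%:~R < n%:~R + 1 :> R -> z <= n.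
Proof. by rewrite -[1]/(1%:~R) -intrD ltr_int; lia. Qed.

(** A point of an edge away from its ends is at a definite distance from all cells but
    the two adjacent ones: by integrality a form that exceeds its bound for such a cell
    exceeds it by at least [th]. *)
Lemma edge_far (th t : R) a b j : 0 < th -> th <= t <= 1 - th -> b <> a -> b <> a + dirv j ->
  exists k, 1 + (tform k b)%:~R + th <= cn k (epoint a j t).
Proof.
move=> th0 /andP[t0 t1] ba bd; apply: contrapT => /forallNP H.
have {}H k : cn k (epoint a j t) < 1 + (tform k b)%:~R + th.
  by rewrite ltNge; apply/negP; exact: H.
pose c := b - a.
have bE k : tform k b = tform k a + tform k c by rewrite /c -tformD subrKC.
have tr2 e : tform (j + 2) e = tform (j + 1) e - tform j e.
  by rewrite tform2 tform1 tformE; ring.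
have H0 := H j; have H1 := H (j + 1); have H2 := H (j + 2); have H3 := H (j + 3).
have H4 := H (j + 4); have H5 := H (j + 5).
rewrite ?cn5 ?cn4 ?cn3 ?cn2 ?cn1_epoint ?cn_epoint ?tform5 ?tform4 ?tform3 ?tr2
  ?bE in H0 H1 H2 H3 H4 H5.
have E0 := tformE j c; have E1 := tform1 j c.
move: H0 H1 H2 H3 H4 H5 E0 E1; move: (tform j a) (tform (j + 1) a) => A0 A1.
move: (tform j c) (tform (j + 1) c) => C0 C1 H0 H1 H2 H3 H4 H5 E0 E1.
rewrite !(intrN, intrD) in H0 H1 H2 H3 H4 H5.
have g0 : 0 <= C0 by apply: int_ge_lt; rewrite mulr0z; lra.
have g3 : C0 <= 2 by apply: int_le_lt; rewrite -[2%:~R]/(2 : R); lra.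
have g1 : 0 <= C1 by apply: int_ge_lt; rewrite mulr0z; lra.
have g4 : C1 <= 1 by apply: int_le_lt; rewrite mulr1z; lra.
have g2 : -1 <= C1 - C0 by apply: int_ge_lt; rewrite intrD !intrN mulr1z; lra.
have g5 : C1 - C0 <= 0 by apply: int_le_lt; rewrite intrD intrN mulr0z; lra.
have [[p0 q0]|[p1 q0]] : (hform (j + 1) c = 0 /\ hform j c = 0) \/
    (hform (j + 1) c = 1 /\ hform j c = 0).
  move: g0 g1 g2 g3 g4 g5; rewrite E0 E1; clear.
  by move: (hform (j + 1) c) (hform j c) => p q; lia.
- apply: ba; apply/eqP; rewrite -subr_eq0 -/c; apply/eqP.
  by apply: (@form_inj j); rewrite ?p0 ?q0; move: (j); apply: Z6_ind.
- apply: bd; rewrite -(_ : c = dirv j) /c ?subrKC//.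
  by apply: (@form_inj j); rewrite ?form_dir ?form_dir1 ?p1 ?q0.
Qed.

End CellForms.

(** * Perimeter of a finite union of cells *)

Section BoundaryEdges.
Context {R : realType}.
Variable eps : R.
Hypothesis eps0 : 0 < eps.
Implicit Types (x y : R * R) (j k : 'Z_6) (a b c : int * int).
Local Notation s3 := (Num.sqrt (3 : R)).
Local Notation incell := (incell eps).
Local Notation reg := (reg eps).
Local Notation epoint := (epoint eps).
Local Notation cn := (cn eps).

Lemma near_seq (T : Type) (F : set_system T) {FF : Filter F} (I : eqType) (s : seq I) (P : I -> T -> Prop) :
  (forall i, i \in s -> \forall y \near F, P i y) ->
  \forall y \near F, forall i, i \in s -> P i y.
Proof.
elim: s => [_|i s IH H]; first by near=> y.
have H1 := H i (mem_head _ _).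
have H2 : \forall y \near F, forall i, i \in s -> P i y.
  by apply: IH => k ks; apply: H; rewrite inE ks orbT.
by apply: filterS2 H1 H2 => y h1 h2 k; rewrite inE => /orP[/eqP->//|]; exact: h2.
Unshelve. all: by end_near. Qed.

(** Only finitely many cells lie near [x], and each of them is closed. *)
Lemma near_cells x : \forall y \near x, forall b, incell b y -> incell b x.
Proof.
have [a0 ax] := tile eps x.
pose s : {fset int * int} := hexset (fun=> 9).
pose P (c : int * int) (y : R * R) := ~ incell (a0 + c) x -> ~ incell (a0 + c) y.
have HP c : c \in (s : seq _) -> \forall y \near nbhs x, P c y.
  move=> _; have [cx|cx] := pselect (incell (a0 + c) x); first by near=> y.
  have /closed_openC := incell_closed (eps := eps) (a := a0 + c).
  rewrite openE => /(_ x cx); apply: filterS => y /= cy _.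
  exact: cy.
have H1 := near_seq HP.
have H2 j : \forall y \near x, cn j y < cn j x + 1.
  by apply: (cvgr_lt (cn j x) (@cn_continuous R eps j x)); rewrite ltrDl.
have H2' : \forall y \near x, forall j, cn j y < cn j x + 1.
  near=> y; apply: (@Z6_ind (fun j => cn j y < cn j x + 1)); near: y; exact: H2.
near=> y; have h1 : forall c, c \in (s : seq _) -> P c y by near: y; exact: H1.
have h2 : forall j, cn j y < cn j x + 1 by near: y; exact: H2'.
move=> b bY; apply: contrapT => bx.
have bE : b = a0 + (b - a0) by rewrite subrKC.
apply: (h1 (b - a0)); rewrite -?bE//.
rewrite in_hexset; apply/inhexP => j; set c := b - a0 in bE *.
have tc i : tform i c <= 3.
  have := bY (i + 3); have := h2 i; have := ax i.
  rewrite cn3 tform3 bE tformD intrN intrD => u1 u2 u3.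
  have e3 : (3 : int)%:~R = 3 :> R by [].
  by apply: (int_le_lt eps0); rewrite e3; lra.
have := tc j; have := tc (j + 1); have := tc (j + 3); have := tc (j + 4).
rewrite tform3 tform4 tform1 tformE.
by move: (hform (j + 1) c) (hform j c) => p q; clear; lia.
Unshelve. all: by end_near. Qed.

Lemma interior_reg (Z : set (int * int)) x :
  (forall b, incell b x -> Z b) -> interior (reg Z) x.
Proof.
move=> H; near=> y; have hy : forall b, incell b y -> incell b x by near: y; exact: near_cells.
have [b bY] := tile eps y; apply/regP => //; exists b => //.
by apply: H; exact: hy.
Unshelve. all: by end_near. Qed.

Lemma reg_closed (Z : set (int * int)) : closed (reg Z).
Proof.
rewrite -openC openE => x xZ.
have : interior (reg (~` Z)) x.
  by apply: interior_reg => b bx Zb; apply: xZ; apply/regP => //; exists b.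
move=> _; near=> y; have hy : forall b, incell b y -> incell b x by near: y; exact: near_cells.
move=> /(regP eps0)[b Zb bY].
by apply: xZ; apply/regP => //; exists b => //; exact: hy.
Unshelve. all: by end_near. Qed.

(** A boundary point lies in a cell of [Z] and, by [interior_reg], in a cell not in
    [Z]; two such cells meet along an edge. *)
Lemma boundary_reg_sub (Z : set (int * int)) x : boundary (reg Z) x ->
  exists a j, [/\ Z a, ~ Z (a + dirv j) & segment (epoint a j 0) (epoint a j 1) x].
Proof.
move=> [cx nx]; have /closure_id Zc := reg_closed (Z := Z).
rewrite -Zc in cx; have /(regP eps0)[a Za ax] := cx.
have /existsNP[b /not_implyP[bx Zb]] : ~ forall b, incell b x -> Z b.
  by move=> H; apply: nx; exact: interior_reg.
have ab : a != b by apply: contra_notN Zb => /eqP <-.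
have [j [bE jx]] := incell_edge eps0 ab ax bx.
by exists a, j; split => //; rewrite -bE.
Qed.

Lemma edge_incell a j (t : R) : 0 <= t <= 1 -> incell a (epoint a j t).
Proof.
move=> /andP[t0 t1]; apply: (@Z6_all _ j);
  rewrite ?cn5 ?cn4 ?cn3 ?cn2 ?cn1_epoint ?cn_epoint// ?tform5 ?tform4 ?tform3.
- by lra.
- by lra.
- rewrite tform2 tform1 tformE !(intrD, intrN, intrM); lra.
- by rewrite intrN; lra.
- by rewrite intrN; lra.
- rewrite tform2 tform1 tformE !(intrD, intrN, intrM); lra.
Qed.

(** Near the interior of the edge, [edge_far] leaves no cell but the two adjacent
    ones. *)
Lemma boundary_reg_core (Z : set (int * int)) (th t : R) a j : 0 < th -> th <= t <= 1 - th ->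
  Z a -> ~ Z (a + dirv j) -> boundary (reg Z) (epoint a j t).
Proof.
move=> th0 tth Za Zb; have t01 : 0 <= t <= 1 by move: tth => /andP[? ?]; apply/andP; split; lra.
split.
  have /closure_id <- := reg_closed (Z := Z).
  by apply/regP => //; exists a => //; exact: edge_incell.
move=> /(nbhs_ray (tang j))[e e0 H].
pose r := Num.min (e / 2) (eps * th / 4).
have r0 : 0 < r by rewrite lt_min !divr_gt0// mulr_gt0.
have re : `|r| < e.
  rewrite gtr0_norm// gt_min; apply/orP; left.
  by rewrite ltr_pdivrMr// ltr_pMr// ltr1n.
have /(regP eps0)[b Zb' bx] := H r re.
have cr k : `|cn k (r *: tang j)| < th.
  apply: (le_lt_trans (cn_le_enorm eps0 _ _)).
  rewrite enormZ (_ : enorm (tang j) = 1); last first.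
    by rewrite -(enorm_nrm j) /enorm /tang /perp /dot /=; congr Num.sqrt; ring.
  rewrite mulr1 gtr0_norm// mulrA ltr_pdivrMr//.
  have : r <= eps * th / 4 by rewrite ge_min lexx orbT.
  have et : 0 < eps * th by rewrite mulr_gt0.
  by lra.
have cj : 0 < cn j (r *: tang j).
  rewrite cnZ mulr_gt0// /cn mulr_gt0 ?divr_gt0//.
  rewrite /tn (_ : dot _ _ = 1)//.
  by rewrite -[RHS](lin_nrm j) /lin /tang /perp /dot /=; ring.
have [ba|ba] := pselect (b = a).
  have := bx j; rewrite cnD cn_epoint// ba; lra.
have [bd|bd] := pselect (b = a + dirv j); first by apply: Zb; rewrite -bd.
have [k hk] := edge_far eps0 th0 tth ba bd.
have := bx k; rewrite cnD; have := cr k; rewrite ltr_norml => /andP[? ?]; lra.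
Qed.

Definition bedges (Z : {fset int * int}) : seq ('Z_6 * (int * int)) :=
  [seq (j, a) | j <- enum 'Z_6, a <- exits j Z].

Lemma bedgesP (Z : {fset int * int}) j a :
  (j, a) \in bedges Z = (a \in Z) && (a + dirv j \notin Z).
Proof.
apply/allpairsPdep/idP => [[j' [a' [_ + [-> ->]]]]|H]; first by rewrite in_exits.
by exists j, a; split => //; rewrite ?mem_enum// in_exits.
Qed.

Lemma bedges_uniq Z : uniq (bedges Z).
Proof.
apply: allpairs_uniq_dep => [|j _|]; [exact: enum_uniq|exact: fset_uniq|].
by move=> [j a] [j' a'] _ _ /= [-> ->].
Qed.

Lemma size_bedges Z : size (bedges Z) = bsize Z.
Proof. by rewrite /bedges size_allpairs_dep sumnE big_map big_enum. Qed.

(** The upper bound covers the boundary by its edges. For the lower bound the edges are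
    shortened by an arbitrarily small amount, which makes them separated. *)
Theorem perimeter_reg (Z : {fset int * int}) :
  perimeter (reg [set` Z]) = (eps / s3 * (bsize Z)%:R)%:E.
Proof.
have L0 : 0 < eps / s3 by rewrite divr_gt0// s3_gt0.
apply/eqP; rewrite eq_le; apply/andP; split.
  apply: (le_trans (@hausdorff1_upper R _ (bedges Z)
    (fun e => epoint e.2 e.1 0) (fun e => epoint e.2 e.1 1) _ _)).
    move=> x /boundary_reg_sub[a [j [Za Zb jx]]]; exists (j, a) => //.
    by rewrite bedgesP Za; apply/negP.
  rewrite lee_fin (eq_bigr (fun=> eps / s3)); last first.
    by move=> e _; rewrite enorm_edge// subr0 normr1 mulr1.
  by rewrite big_const_seq count_predT iter_addr_0 size_bedges mulr_natr.
apply/lee_addgt0Pr => d d0.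
pose B : R := (bsize Z)%:R.
have B0 : 0 <= B by rewrite /B.
pose th := Num.min (1 / 4) (d / (2 * (eps / s3) * (B + 1))).
have den : 0 < 2 * (eps / s3) * (B + 1) by rewrite !mulr_gt0// ltr_wpDl.
have th0 : 0 < th by rewrite lt_min !divr_gt0.
have th4 : th <= 1 / 4 by rewrite ge_min lexx.
have thd : th * (2 * (eps / s3) * (B + 1)) <= d.
  by rewrite -ler_pdivlMr// ge_min lexx orbT.
have core e (x : R * R) : segment (epoint e.2 e.1 th) (epoint e.2 e.1 (1 - th)) x ->
    exists2 t, th <= t <= 1 - th & x = epoint e.2 e.1 t.
  move=> [r /andP[r0 r1] <-]; rewrite epoint_segment//.
  by exists (th + r * (1 - th - th)) => //; apply/andP; split; nra.
have low : ((\sum_(e <- bedges Z) enorm (epoint e.2 e.1 (1 - th) - epoint e.2 e.1 th))%:E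
    <= perimeter (reg [set` Z]))%E.
  apply: (@hausdorff1_lower R _ (bedges Z) (fun e => epoint e.2 e.1 th)
    (fun e => epoint e.2 e.1 (1 - th)) (th * eps / 4)).
  - by rewrite divr_gt0// mulr_gt0.
  - exact: bedges_uniq.
  - move=> [j a] x; rewrite bedgesP => /andP[Za Zb] /core[t tth ->] /=.
    by apply: (boundary_reg_core th0 tth) => //; exact/negP.
  - move=> [j a] [j' a'] x y; rewrite !bedgesP => /andP[Za Zb] /andP[Za' Zb'] ne.
    move=> /core[t tth ->] /core[t' tth' ->] /=.
    have t01 : 0 <= t' <= 1 by move: tth' => /andP[? ?]; apply/andP; split; lra.
    have far b : incell b (epoint a' j' t') -> b <> a -> b <> a + dirv j ->
        th * eps / 4 < enorm (epoint a j t - epoint a' j' t').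
      move=> by' ba bd; have [k hk] := edge_far eps0 th0 tth ba bd.
      have := by' k => hk'; have : th <= enorm (epoint a j t - epoint a' j' t') * (2 / eps).
        apply: le_trans (cn_le_enorm eps0 k _); rewrite cnB.
        by apply: le_trans (ler_norm _); lra.
      rewrite mulrA ler_pdivlMr//; have : 0 < th * eps by rewrite mulr_gt0.
      lra.
    have ia : incell a' (epoint a' j' t') by exact: edge_incell.
    have ib : incell (a' + dirv j') (epoint a' j' t').
      have := @edge_incell (a' + dirv j') (j' + 3) (1 - t').
      rewrite (_ : epoint (a' + dirv j') (j' + 3) (1 - t') = epoint a' j' t').
        by apply; move: t01 => /andP[? ?]; apply/andP; split; lra.
      apply: (@cn_inj R eps eps0 j').
        have := cn_epoint eps0 (a' + dirv j') (j' + 3) (1 - t').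
        rewrite cn3 tform3 tformD tform_dir cn_epoint// intrN intrD; lra.
      have := cn1_epoint eps0 (a' + dirv j') (j' + 3) (1 - t').
      rewrite (Z6E j') cn4 tform4 tformD tform1_dir cn1_epoint// intrN intrD; lra.
    have [aa|aa] := eqVneq a' a.
      apply: (far _ ib) => [h|].
        by move: Zb'; rewrite h Za.
      rewrite aa => /addrI dd; move: ne; rewrite aa xpair_eqE eqxx andbT => /eqP; apply.
      by apply/esym; move: dd; move: (j) (j'); apply: Z6_ind; apply: Z6_ind.
    apply: (far _ ia) => [h|h]; first by rewrite h eqxx in aa.
    by move: Zb; rewrite -h Za'.
rewrite -leeBlDr//; apply: le_trans low; rewrite -EFinB lee_fin.
rewrite (eq_bigr (fun=> eps / s3 * (1 - 2 * th))); last first.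
  move=> e _; rewrite enorm_edge// (_ : 1 - th - th = 1 - 2 * th); last by ring.
  by rewrite ger0_norm//; lra.
rewrite big_const_seq count_predT iter_addr_0 size_bedges -[leRHS]mulr_natr -/B.
have : 0 <= th * (eps / s3) by rewrite mulr_ge0// ltW.
move: thd; set L := eps / s3; nra.
Qed.
End BoundaryEdges.

(** * Area of a cell *)

Section Area.
Context {R : realType}.
Variable eps : R.
Hypothesis eps0 : 0 < eps.
Implicit Types (x y : R * R) (j k : 'Z_6) (a b c : int * int).
Local Notation s3 := (Num.sqrt (3 : R)).
Local Notation incell := (incell eps).
Local Notation reg := (reg eps).
Local Notation cn := (cn eps).
Local Notation T2 := (measurableTypeR R * measurableTypeR R)%type.
Let mu : {measure set T2 -> \bar R} :=
  (@lebesgue_measure R \x @lebesgue_measure R)%E.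

Lemma cn_measurable j : measurable_fun [set: T2] (cn j : T2 -> R).
Proof.
rewrite (_ : cn j = (fun x => tn j x * (2 / eps))); last exact/funext/cnE.
rewrite /tn /dot; apply: measurable_funM; last exact: measurable_cst.
apply: measurable_funD; apply: measurable_funM => //; exact: measurable_cst.
Qed.

(** The points belonging to the cell [a] only. *)
Definition opencell a x := forall j, cn j x < 1 + (tform j a)%:~R.

Lemma measurable_incell a : measurable (incell a : set T2).
Proof.
rewrite (_ : incell a = \bigcap_(j in [set: 'Z_6]) (setT `&` cn j @^-1` `]-oo, 1 + (tform j a)%:~R])).
  apply: fin_bigcap_measurable => // j _; apply: cn_measurable => //; exact: measurable_itv.
apply/seteqP; split => x /= H j; first by split => //=; rewrite in_itv/=; exact: H.
by have [_] := H j I; rewrite /= in_itv.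
Qed.

Lemma measurable_opencell a : measurable (opencell a : set T2).
Proof.
rewrite (_ : opencell a = \bigcap_(j in [set: 'Z_6]) (setT `&` cn j @^-1` `]-oo, 1 + (tform j a)%:~R[)).
  apply: fin_bigcap_measurable => // j _; apply: cn_measurable => //; exact: measurable_itv.
apply/seteqP; split => x /= H j; first by split => //=; rewrite in_itv/=; exact: H.
by have [_] := H j I; rewrite /= in_itv.
Qed.

Let half (p u : R) : R := (eps - `|u - p|) / s3.

Let s30 : 0 < s3 := s3_gt0.

(** The cell as the region between two graphs over an interval, the form suited to
    integration. *)
Lemma incell_coord a x : let p := latt eps a in
  incell a x <-> `|x.1 - p.1| <= eps / 2 /\ `|x.2 - p.2| <= half p.1 x.1.
Proof.
move=> p; pose y := x - p.
have H j : (cn j x <= 1 + (tform j a)%:~R) = (tn j y * 2 <= eps).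
  rewrite -(cn_latt eps0) -lerBlDr -cnB cnE mulrA ler_pdivrMr// mul1r//.
have [n0 n1 n2 n3 [n4 n5]] := linE (y.2, - y.1).
have [e1 e2] : x.1 - p.1 = y.1 /\ x.2 - p.2 = y.2 by [].
rewrite /half e1 e2 !ler_pdivlMr//; clearbody y.
have -> : incell a x <-> [/\ tn 0 y * 2 <= eps, tn 1 y * 2 <= eps, tn 2 y * 2 <= eps &
   [/\ tn 3 y * 2 <= eps, tn 4 y * 2 <= eps & tn 5 y * 2 <= eps]].
  rewrite -!H; split=> [h|[? ? ? [? ? ?]]]; last by apply: Z6_ind.
  by split; [..|split]; exact: h.
rewrite !tn_rot n0 n1 n2 n3 n4 n5 /=.
have -> : s3 / 2 * y.2 = s3 * y.2 / 2 by ring.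
have -> : `|y.2| * s3 = `|s3 * y.2| by rewrite normrM mulrC gtr0_norm.
move: (eps) (s3 * y.2) (y.1) => e z w; clear.
split=> [[? ? ? [? ? ?]]|[]].
  split; first by case: (lerP 0 w) => w0; [rewrite ger0_norm|rewrite ltr0_norm]; lra.
  have [w0|w0] := leP 0 w.
    by rewrite (ger0_norm w0) ler_norml; apply/andP; split; lra.
  by rewrite (ltr0_norm w0) ler_norml; apply/andP; split; lra.
have := ler_norm w; have := ler_norm (- w); rewrite normrN.
move=> w1 w2 w3; rewrite ler_norml => /andP[z1 z2].
by split; [lra..|split; lra].
Qed.

Lemma opencell_coord a x : let p := latt eps a in
  `|x.1 - p.1| < eps / 2 -> `|x.2 - p.2| < half p.1 x.1 -> opencell a x.
Proof.
move=> p; pose y := x - p.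
have H j : (cn j x < 1 + (tform j a)%:~R) = (tn j y * 2 < eps).
  rewrite -(cn_latt eps0) -ltrBlDr -cnB cnE mulrA ltr_pdivrMr// mul1r//.
have [e1 e2] : x.1 - p.1 = y.1 /\ x.2 - p.2 = y.2 by [].
rewrite /half e1 e2 !ltr_pdivlMr//; clearbody y.
have [n0 n1 n2 n3 [n4 n5]] := linE (y.2, - y.1).
have -> : `|y.2| * s3 = `|s3 * y.2| by rewrite normrM mulrC gtr0_norm.
have := ler_norm y.1; have := ler_norm (- y.1); rewrite normrN.
move=> w1 w2 w3; rewrite ltr_norml => /andP[z1 z2].
have e : s3 / 2 * y.2 = s3 * y.2 / 2 by ring.
by apply: Z6_ind; rewrite H tn_rot ?(n0, n1, n2, n3, n4, n5) /= ?e; move: (s3 * y.2) (y.1) (eps) w1 w2 w3 z1 z2; clear => *; lra.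
Qed.

Lemma opencell_incell a : opencell a `<=` incell a.
Proof. by move=> x h j; exact/ltW/h. Qed.

Lemma integral_affine (c d s t : R) : s < t ->
  (\int[@lebesgue_measure R]_(u in `[s, t]) (c + d * u)%:E =
   (c * (t - s) + d * (t ^+ 2 - s ^+ 2) / 2)%:E)%E.
Proof.
move=> st; pose F u : R := c * u + d / 2 * u ^+ 2.
have dF (u : R) : is_derive u 1 F (c + d * u).
  by rewrite /F; apply: is_derive_eq; rewrite /GRing.scale /=; field.
have cF : continuous F.
  by move=> u; apply: differentiable_continuous; apply/derivable1_diffP.
rewrite (@continuous_FTC2 _ _ F)//.
- by rewrite -EFinB /F; congr EFin; field.
- apply: continuous_subspaceT => u; apply: cvgD; first exact: cvg_cst.
  by apply: cvgM; [exact: cvg_cst|exact: cvg_id].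
- split => //.
  + exact/cvg_at_right_filter/cF.
  + exact/cvg_at_left_filter/cF.
- by move=> u _; rewrite derive1E; apply: derive_val.
Qed.

Lemma tent_measurable (c p : R) (D : set (measurableTypeR R)) :
  measurable_fun D (fun u : measurableTypeR R => c - `|u - p|).
Proof.
apply: measurable_funTS; apply: (@continuous_measurable_fun R (fun u => c - `|u - p|)) => u.
apply: cvgB; first exact: cvg_cst.
by apply: cvg_norm; apply: cvgB; [exact: cvg_id|exact: cvg_cst].
Qed.

(** The integral of the height of the cell. *)
Lemma integral_tent (p h : R) : 0 < h ->
  (\int[@lebesgue_measure R]_(u in `[(p - h)%R, (p + h)%R]) (h *+ 2 - `|u - p|)%:E =
   (3 * h ^+ 2)%:E)%E.
Proof.
move=> h0; pose f (u : R) := (h *+ 2 - `|u - p|)%:E.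
have mf D : measurable_fun D (f : measurableTypeR R -> \bar R).
  by apply/measurable_EFinP; exact: tent_measurable.
have -> : `[p - h, p + h]%classic = (`[p - h, p[ `|` `[p, p + h])%classic.
  by apply: itv_bndbnd_setU; rewrite bnd_simp; lra.
rewrite ge0_integral_setU//=; last 2 first.
- move=> x [] /=; rewrite in_itv/= lee_fin => /andP[? ?].
    by rewrite ltr0_norm; lra.
  by rewrite ger0_norm; lra.
- rewrite disj_set2E; apply/eqP/seteqP; split => // u [] /=; rewrite !in_itv/=.
  by move=> /andP[_ ?] /andP[? _]; lra.
rewrite integral_itv_bndo_bndc; last exact: mf.
have -> : (\int[@lebesgue_measure R]_(u in `[(p - h)%R, p]) f u)%E =
    (\int[@lebesgue_measure R]_(u in `[(p - h)%R, p]) (h *+ 2 - p + 1 * u)%:E)%E.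
  apply: eq_integral => u /set_mem /=; rewrite in_itv/= => /andP[? ?]; congr EFin.
  by rewrite ler0_norm; lra.
have -> : (\int[@lebesgue_measure R]_(u in `[p, (p + h)%R]) f u)%E =
    (\int[@lebesgue_measure R]_(u in `[p, (p + h)%R]) (h *+ 2 + p + (-1) * u)%:E)%E.
  apply: eq_integral => u /set_mem /=; rewrite in_itv/= => /andP[? ?]; congr EFin.
  by rewrite ger0_norm; lra.
rewrite integral_affine; last lra.
rewrite integral_affine; last lra.
by rewrite -EFinD; congr EFin; field.
Qed.

(** Stated for all sets between the open and the closed cell, which yields both areas
    and hence that the difference is negligible. *)
Lemma area_between a (C : set T2) : measurable C ->
  opencell a `<=` C -> C `<=` incell a -> mu C = (s3 / 2 * eps ^+ 2)%:E.
Proof.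
move=> mC oC Ci; set p := latt eps a.
pose D : set (measurableTypeR R) := `[p.1 - eps / 2, p.1 + eps / 2]%classic.
pose g (u : measurableTypeR R) : \bar R := ((2 / s3)%:E * (eps / 2 *+ 2 - `|u - p.1|)%:E)%E.
have mg A : measurable_fun A g.
  apply/measurable_EFinP/measurable_funM; first exact: measurable_cst.
  exact: tent_measurable.
have gE u : g u = (half p.1 u *+ 2)%:E.
  by rewrite /g -EFinM; congr EFin; rewrite /half; field; rewrite gt_eqF.
have -> : mu C = (\int[@lebesgue_measure R]_u (@lebesgue_measure R (xsection C u)))%E by [].
have DE u : D u <-> `|u - p.1| <= eps / 2.
  rewrite /D /= in_itv/= ler_norml.
  by split=> /andP[d1 d2]; apply/andP; split; lra.
rewrite (@ge0_ae_eq_integral _ _ _ _ _ _ (g \_ D))//=.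
- rewrite -integral_mkcond ge0_integralZl//.
  + rewrite integral_tent; last by rewrite divr_gt0.
    rewrite -EFinM; congr EFin.
    move: (s3) s30 (s3_sq : s3 * s3 = 3) => r r0 q.
    by rewrite -q; field; rewrite gt_eqF.
  + exact: measurable_itv.
  + by apply/measurable_EFinP; exact: tent_measurable.
  + by move=> u /DE uD; rewrite lee_fin subr_ge0 (le_trans uD)// mulr2n lerDl divr_ge0// ltW.
- exact: measurable_fun_xsection.
- exact: (proj1 (measurable_restrictT g (measurable_itv _)) (mg _)).
- move=> u _; rewrite /patch; case: ifPn => // /set_mem /DE uD; rewrite gE.
  by rewrite lee_fin mulrn_wge0// divr_ge0 ?(ltW s30)// subr_ge0 (le_trans uD)// ler_piMr ?(ltW eps0)// invf_le1 ?ler1n.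
exists [set p.1 - eps / 2; p.1 + eps / 2]; split.
- exact: measurableU.
- by apply: countable_lebesgue_measure0; apply: finite_set_countable.
move=> u /= H; have [->|u1] := eqVneq u (p.1 - eps / 2); first by left.
have [->|u2] := eqVneq u (p.1 + eps / 2); first by right.
case: H => _.
rewrite /patch; case: ifPn => [/set_mem|/negP uD'].
  move=> /DE uD.
  have {}uD : `|u - p.1| < eps / 2.
    rewrite lt_neqAle uD andbT; apply: contraNneq u1 => e.
    have [w0|w0] := leP 0 (u - p.1).
      by move: e u2; rewrite ger0_norm// => <-; rewrite addrC subrK eqxx.
    by move: e; rewrite ltr0_norm// => <-; apply/eqP; ring.
  have w0 := normr_ge0 (u - p.1).
  have h0 : 0 < half p.1 u by rewrite divr_gt0//; lra.
  have sub1 : `]p.2 - half p.1 u, p.2 + half p.1 u[%classic `<=` xsection C u.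
    move=> v /=; rewrite in_itv/= => /andP[v1 v2]; apply/mem_set.
    by apply: oC; apply: opencell_coord => //=; rewrite ltr_norml; apply/andP; split; lra.
  have sub2 : xsection C u `<=` `[p.2 - half p.1 u, p.2 + half p.1 u]%classic.
    move=> v /set_mem /=; rewrite in_itv/= => /Ci/(incell_coord _ _).1 [_ /=].
    by rewrite ler_norml => /andP[? ?]; apply/andP; split; lra.
  have mX : measurable (xsection C u) by exact: measurable_xsection.
  have lI (b c : bool) : @lebesgue_measure R [set` Interval (BSide b (p.2 - half p.1 u)) (BSide c (p.2 + half p.1 u))] = g u.
    rewrite lebesgue_measure_itv /= lte_fin ifT; last lra.
    by rewrite gE -EFinB; congr EFin; ring.
  have L1 := le_measure (@lebesgue_measure R) (mem_set mX) (mem_set (measurable_itv _)) sub2.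
  have L2 := le_measure (@lebesgue_measure R) (mem_set (measurable_itv _)) (mem_set mX) sub1.
  by apply/eqP; rewrite eq_le -{1}(lI true false) -{1}(lI false true) L1 L2.
rewrite (_ : xsection C u = set0) ?measure0//.
apply/seteqP; split => // v /set_mem /= /Ci/(incell_coord _ _).1 [/= h _].
by apply: uD'; apply/mem_set/DE.
Qed.

Lemma area_incell a : mu (incell a) = (s3 / 2 * eps ^+ 2)%:E.
Proof. exact: area_between (measurable_incell a) (@opencell_incell a) _. Qed.

Lemma area_opencell a : mu (opencell a) = (s3 / 2 * eps ^+ 2)%:E.
Proof. exact: area_between (measurable_opencell a) _ (@opencell_incell a). Qed.

Lemma area_rim a : mu (incell a `\` opencell a) = 0%E.
Proof.
have fin : (mu (incell a) < +oo)%E by rewrite area_incell ltry.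
apply: eq_trans (measureD (measurable_incell a) (measurable_opencell a) fin) _.
rewrite setIidr; last exact: opencell_incell.
have -> : (mu (incell a) - mu (opencell a))%E = 0%E; last by [].
by rewrite area_incell area_opencell -EFinB subrr.
Qed.
End Area.

(** * The energy of a union of cells *)

Section Depth.
Implicit Types (a b c : int * int) (j k : 'Z_6).

(** The dual norm in units of [3 eps / 4], see [dual_norm_latt]. *)
Definition hnorm a : nat := \max_(j : 'Z_6) `|hform j a|%N.

Lemma hnorm_ge j a : (`|hform j a| <= hnorm a)%N.
Proof. exact: (leq_bigmax_cond j). Qed.

Lemma hnorm_le a (n : nat) : (forall j, (`|hform j a| <= n)%N) -> (hnorm a <= n)%N.
Proof. by move=> h; apply/bigmax_leqP => j _. Qed.

Lemma hform_muln j a (n : nat) : hform j (a *+ n) = hform j a *+ n.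
Proof.
elim: n => [|n IH]; last by rewrite !mulrS formD IH.
by rewrite !mulr0n; have := formD j 0 0; rewrite addr0; move: (hform j 0); clear; lia.
Qed.

Lemma hnorm_eq0 a b : hnorm (a - b) = 0%N -> a = b.
Proof.
move=> h.
have z j : hform j a = hform j b.
  by have := hnorm_ge j (a - b); rewrite h formD formN; move: (hform j a) (hform j b); clear; lia.
exact: (@form_inj 0).
Qed.

Variable F : {fset int * int}.

Lemma other_side b : F != fset0 -> exists n : nat,
  `[< exists2 c, (c \in F) != (b \in F) & hnorm (b - c) = n >].
Proof.
move=> /fset0Pn[c0 c0F].
suff [c cP] : exists c, (c \in F) != (b \in F) by exists (hnorm (b - c)); apply/asboolP; exists c.
case: (boolP (b \in F)) => bF; last by exists c0; rewrite c0F.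
have [n nE] : exists n, n = (\sum_(c <- F) absz c.1)%N by eexists.
exists (n.+1%:Z, 0 : int); rewrite eqb_id; apply/negP => cF.
have : (absz n.+1%:Z <= n)%N by rewrite [leqRHS]nE (big_fsetD1 _ cF) /= leq_addr.
by rewrite absz_nat ltnn.
Qed.

Hypothesis F0 : F != fset0.

(** The discrete distance of the cell [b] from the cells on the other side of the boundary of
    [F], in the same units. *)
Definition depth b : nat := ex_minn (other_side b F0).

Lemma depth_le b c : (c \in F) != (b \in F) -> (depth b <= hnorm (b - c)%R)%N.
Proof.
by rewrite /depth; case: ex_minnP => n _ h cb; apply: h; apply/asboolP; exists c.
Qed.

Lemma depth_attained b : exists2 c, (c \in F) != (b \in F) & hnorm (b - c) = depth b.
Proof. by rewrite /depth; case: ex_minnP => n /asboolP. Qed.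

Lemma depth_gt0 b : (1 <= depth b)%N.
Proof.
have [c cb <-] := depth_attained b; rewrite lt0n; apply: contraNneq cb => /hnorm_eq0 ->.
by rewrite eqxx.
Qed.
End Depth.

(** In a hexagon the distance to the complement is attained in the direction of the
    nearest side. *)
Lemma depthP (m : 'Z_6 -> int) (F0 : hexset m != fset0) x (r : nat) : inhex m x ->
  reflect (forall j, hform j x + r%:Z <= m j + 1) (r <= depth F0 x)%N.
Proof.
move=> mx; apply: (iffP idP) => [rd j|H].
  rewrite leNgt; apply/negP => lt.
  have mxj := (inhexP _ _ mx) j.
  pose n := absz (m j + 1 - hform j x)%R.
  have nE : n%:Z = m j + 1 - hform j x by rewrite /n; move: mxj; clear; lia.
  pose c := x + dirv (j - 1) *+ n.
  have cF : c \notin hexset m.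
    rewrite in_hexset; apply/negP => /inhexP/(_ j); rewrite /c formD hform_muln.
    have := form_dir1 (j - 1); rewrite subrK => ->.
    by move: nE; rewrite natz; clear; lia.
  have := depth_le F0 (b := x) (c := c); rewrite (negbTE cF) in_hexset mx => /(_ isT) dc.
  have : (hnorm (x - c)%R <= n)%N.
    apply: hnorm_le => k; rewrite /c opprD addNKr formN hform_muln.
    have : (hform k (dirv (j - 1)) == 0) || (hform k (dirv (j - 1)) == 1) || (hform k (dirv (j - 1)) == -1).
      by move: k; apply: Z6_ind; move: (j - 1); apply: Z6_ind.
    by move=> /orP[/orP[]|] /eqP->; rewrite ?mul0rn ?mulNrn ?natz; clear; lia.
  by move: rd dc lt nE; clear; lia.
have [c + <-] := depth_attained F0 x; rewrite !in_hexset mx => cF.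
have [j jc] : exists j, m j < hform j c.
  apply/existsP; move: cF; apply: contraNT; rewrite negb_exists => /forallP h.
  by rewrite eqb_id; apply/inhexP => k; have := h k; rewrite -leNgt.
have := H j; have := hnorm_ge j (x - c); rewrite formD formN.
by move: jc; clear; lia.
Qed.

Section Energy.
Context {R : realType}.
Variable eps : R.
Hypothesis eps0 : 0 < eps.
Implicit Types (x y : R * R) (j k : 'Z_6) (a b c : int * int).
Local Notation incell := (incell eps).
Local Notation opencell := (opencell eps).
Local Notation reg := (reg eps).
Local Notation cn := (cn eps).
Local Notation T2 := (measurableTypeR R * measurableTypeR R)%type.
Local Notation mu := ((@lebesgue_measure R \x @lebesgue_measure R)%E : {measure set T2 -> \bar R}).

(** Here [3 / 4 = (sqrt 3 / 2) ^ 2]: one factor comes from the normalization of the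
    dual norm, one from the distance between neighbouring rows. *)
Lemma dual_norm_latt a b :
  dual_norm (latt eps a - latt eps b) = 3 / 4 * eps * (hnorm (a - b))%:R.
Proof.
have e j : `|lin j (latt eps a - latt eps b)| = eps * (s3 / 2) * (absz (hform j (a - b)))%:R.
  rewrite -lattB lin_latt normrM ger0_norm ?mulr_ge0 ?divr_ge0 ?ltW//.
  by rewrite natr_absz intr_norm.
rewrite /dual_norm -/(nrm R 1) -/(nrm R 2) -/(nrm R 0).
have -> : perp (eta1 R) = nrm R 1 by [].
have -> : perp (eta2 R) = nrm R 2 by [].
have -> : perp (eta3 R) = nrm R 0 by [].
have -> : hnorm (a - b) = maxn (absz (hform 1 (a - b))) (maxn (absz (hform 2 (a - b))) (absz (hform 0 (a - b)))).
  apply/eqP; rewrite eqn_leq; apply/andP; split.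
    have f3 : hform 3 (a - b) = - hform 0 (a - b) := form3 0 _.
    have f4 : hform 4 (a - b) = - hform 1 (a - b) := form3 1 _.
    have f5 : hform 5 (a - b) = - hform 2 (a - b).
      by rewrite (_ : 5 = 2 + 3) ?form3//; exact/val_inj.
    by apply: hnorm_le; apply: Z6_ind; rewrite ?(f3, f4, f5) ?abszN ?leq_max ?leqnn ?orbT.
  by rewrite !geq_max !hnorm_ge.
rewrite -!/(lin _ _) !e -!maxr_pMr ?mulr_ge0 ?divr_ge0 ?ltW//.
rewrite mulrA [s3 / 2 * _]mulrCA -!natr_max.
have -> : eps * (s3 / 2 * (s3 / 2)) = 3 / 4 * eps.
  by have := @s3_sq R; move: (s3) => r q; rewrite -[3]q; field.
by [].
Qed.

(** Two cells meet only along edges. *)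
Lemma opencell_unique a b x : opencell a x -> incell b x -> a = b.
Proof.
move=> ax bx; apply/eqP; apply/negP => /negP ab.
have [j [bE [t _ xE]]] := incell_edge eps0 ab (opencell_incell ax) bx.
by have := ax j; rewrite -xE cnD cnZ cnB !cn_epoint// subrr mulr0 addr0 [1 + _]addrC ltxx.
Qed.

Lemma opencell_reg Z a x : opencell a x -> reg Z x <-> Z a.
Proof.
move=> ax; split=> [/(regP eps0)[b Zb /(opencell_unique ax) ->]//|Za].
by apply/(regP eps0); exists a => //; exact: opencell_incell.
Qed.

Variable F : {fset int * int}.
Hypothesis F0 : F != fset0.
Local Notation dist := (discrete_dist eps (reg [set` F])).

(** The discrete distance with cells replaced by their indices. On an edge the infimum
    runs over several cells [a]. *)
Lemma distE x : dist x = ereal_inf [set d | exists a c, [/\ incell a x,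
   (c \in F) <> `[< reg [set` F] x >] & d = (3 / 4 * eps * (hnorm (a - c))%:R)%:E]].
Proof.
rewrite /discrete_dist; congr ereal_inf; apply/seteqP; split => d.
  move=> [_ [_ [[a _ <-] [c _ <-] /(cell_at_incell eps0) ax [h1 h2] ->]]].
  exists a, c; split => //; last by rewrite -dual_norm_latt.
  move=> cF; have [Fx|Fx] := pselect (reg [set` F] x).
    by apply: (h2 Fx); apply/reg_cell => //=; rewrite cF; exact/asboolP.
  have /(reg_cell eps0)/= := h1 Fx; rewrite cF => /asboolP.
  by [].
move=> [a [c [ax cF ->]]]; exists (latt eps a), (latt eps c); split.
- by rewrite lattice_latt; exists a.
- by rewrite lattice_latt; exists c.
- exact/(cell_at_incell eps0).
- split=> Fx; first by apply/(reg_cell eps0) => /=; apply/negPn/negP => /negbTE cn; apply: cF; rewrite cn; apply/esym/asboolPn.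
  by move=> /(reg_cell eps0)/= cc; apply: cF; rewrite cc; apply/esym/asboolP.
- by rewrite dual_norm_latt.
Qed.

Lemma dist_ge0 x : (0 <= dist x)%E.
Proof.
rewrite distE; apply: le_ereal_inf_tmp => _ [a [c [_ _ ->]]].
by rewrite lee_fin !mulr_ge0// ltW.
Qed.

Lemma dist_opencell b x : opencell b x -> dist x = (3 / 4 * eps * (depth F0 b)%:R)%:E.
Proof.
move=> bx; have Fx : `[< reg [set` F] x >] = (b \in F).
  by apply/idP/idP => [/asboolP/(opencell_reg _ bx)|h]//; apply/asboolP/(opencell_reg _ bx).
have e0 : 0 <= 3 / 4 * eps by rewrite mulr_ge0// ltW.
rewrite distE; apply/eqP; rewrite eq_le; apply/andP; split.
  apply: ereal_inf_lbound; have [c cb <-] := depth_attained F0 b.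
  exists b, c; split => //; first exact: opencell_incell.
  by rewrite Fx; apply/eqP.
apply: le_ereal_inf_tmp => _ [a [c [ax cF ->]]].
rewrite lee_fin ler_wpM2l// ler_nat -(opencell_unique bx ax); apply: depth_le.
by rewrite -Fx; apply/eqP.
Qed.

Lemma measurable_reg (Z : set (int * int)) : measurable (reg Z : set T2).
Proof.
rewrite (_ : reg Z = \bigcup_a (if `[< Z a >] then incell a else set0)).
  apply: countable_bigcupT_measurable => // a; case: ifP => // _; exact: measurable_incell.
apply/seteqP; split => x.
  by move=> /(regP eps0)[a Za ax]; exists a => //; rewrite ifT//; apply/asboolP.
by move=> [a _]; case: ifP => // /asboolP Za ax; apply/(regP eps0); exists a.
Qed.

(** The sublevel sets are countable unions of cells intersected with [reg F] or its
    complement. *)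
Lemma measurable_dist (D : set T2) : measurable_fun D (dist : T2 -> \bar R).
Proof.
apply: measurable_funTS; apply: (measurability _ (ErealGenInftyO.measurableE R)) => //.
move=> /= _ [_ [r ->] <-]; rewrite setTI.
rewrite (_ : _ @^-1` _ = \bigcup_(ac : (int * int) * (int * int))
  (if 3 / 4 * eps * (hnorm (ac.1 - ac.2))%:R < r then
     incell ac.1 `&` (if ac.2 \in F then ~` reg [set` F] else reg [set` F]) else set0)).
  apply: countable_bigcupT_measurable => // ac; case: ifP => // _.
  apply: measurableI; first exact: measurable_incell.
  by case: ifP => _; [apply: measurableC|]; exact: measurable_reg.
apply/seteqP; split => x /=.
  rewrite in_itv/= distE => /ereal_inf_lt[_ [a [c [ax cF ->]]]]; rewrite lte_fin => lt.
  exists (a, c) => //=; rewrite lt; split => //; case: ifPn => cc.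
    by move=> /= Fx; apply: cF; rewrite cc; apply/esym/asboolP.
  by apply: contrapT => Fx; apply: cF; rewrite (negbTE cc); apply/esym/asboolPn.
move=> [[a c] _ /=]; case: ifP => // lt [ax cF]; rewrite in_itv/=.
apply: (@le_lt_trans _ _ (3 / 4 * eps * (hnorm (a - c))%:R)%:E); last by rewrite lte_fin.
rewrite distE; apply: ereal_inf_lbound; exists a, c; split => //.
move: cF; case: ifPn => cc cF.
  by move/esym/asboolP.
by rewrite (_ : `[< _ >] = true)//; apply/asboolP.
Qed.

(** The union of all edges, a null set outside of which a point belongs to only one
    cell. *)
Definition rims : set T2 := \bigcup_a (incell a `\` opencell a).

Lemma measurable_rims : measurable rims.
Proof.
apply: countable_bigcupT_measurable => // a; apply: measurableD.
  exact: measurable_incell.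
exact: measurable_opencell.
Qed.

Lemma rims_null : mu rims = 0%E.
Proof.
apply/(@negligibleP _ _ _ mu _ measurable_rims).
rewrite /rims (_ : \bigcup_a _ = \bigcup_(n in [set: nat]) (oapp (fun a => incell a `\` opencell a) set0 (choice.unpickle n : option (int * int)))).
  apply: negligible_bigcup => n; case: choice.unpickle => [a|] /=; last exact: negligible_set0.
  apply/negligibleP; last exact: area_rim.
  by apply: measurableD; [exact: measurable_incell|exact: measurable_opencell].
apply/seteqP; split => x [a _ ax]; first by exists (choice.pickle a); [exact: I|rewrite choice.pickleK; exact: ax].
by move: ax; case: choice.unpickle => //= b bx; exists b.
Qed.

(** On each open cell the distance is constant. *)
Lemma integral_opencells (s : seq (int * int)) : uniq s ->
  (\int[mu]_(x in \big[setU/set0]_(b <- s) opencell b) dist x =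
   (s3 / 2 * eps ^+ 2 * (3 / 4 * eps) * (\sum_(b <- s) depth F0 b)%:R)%:E)%E.
Proof.
move=> us; rewrite ge0_integral_bigsetU//=.
- rewrite natr_sum mulr_sumr -sumEFin; apply: eq_bigr => b _.
  transitivity (\int[mu]_(x in opencell b) cst (3 / 4 * eps * (depth F0 b)%:R)%:E x)%E.
    by apply: eq_integral => x /set_mem /dist_opencell.
  rewrite integral_cst; last exact: measurable_opencell.
  have -> : mu (opencell b) = (s3 / 2 * eps ^+ 2)%:E by exact: area_opencell.
  by rewrite -EFinM; congr EFin; ring.
- by move=> b; exact: measurable_opencell.
- by move=> a b _ _ [x [ax bx]]; exact: (opencell_unique ax (opencell_incell bx)).
- exact: measurable_dist.
- by move=> x _; exact: dist_ge0.
Qed.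

Definition discrepancy (Z : set (int * int)) : set T2 :=
  (reg Z `\` reg [set` F]) `|` (reg [set` F] `\` reg Z).

Lemma measurable_discrepancy Z : measurable (discrepancy Z).
Proof. by apply: measurableU; apply: measurableD; exact: measurable_reg. Qed.

Lemma discrepancy_opencell Z x b : opencell b x ->
  discrepancy Z x <-> (Z b <-> b \notin F).
Proof.
move=> bx; have z := opencell_reg Z bx; have f := opencell_reg [set` F] bx.
rewrite /discrepancy /=; split.
  move=> [[/z h1 h2]|[/f /= h1 h2]]; split => //.
  - by move=> _; apply/negP => /f.
  - by move=> Zb; case: h2; apply/z.
  - by rewrite h1.
move=> [h1 h2]; have [bF|bF] := boolP (b \in F).
  by right; split; [exact/f|move=> /z/h1; rewrite bF].
by left; split; [exact/z/h2|move=> /f /=; rewrite (negbTE bF)].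
Qed.

Lemma integral_discrepancy (Z : {fset int * int}) :
  (\int[mu]_(x in discrepancy [set` Z]) dist x =
   (s3 / 2 * eps ^+ 2 * (3 / 4 * eps) *
     (\sum_(b <- (Z `\` F)%fset) depth F0 b + \sum_(b <- (F `\` Z)%fset) depth F0 b)%:R)%:E)%E.
Proof.
rewrite (@ge0_negligible_integral _ _ _ _ _ rims)//; last 5 first.
- exact: measurable_rims.
- exact: measurable_discrepancy.
- exact: measurable_dist.
- by move=> x _; exact: dist_ge0.
- exact: rims_null.
rewrite -big_cat /= -integral_opencells; last first.
  rewrite cat_uniq !fset_uniq /= andbT; apply/hasPn => b; rewrite !in_fsetD => /andP[bZ bF].
  by rewrite bF.
congr (integral _ _ _); rewrite -bigcup_seq; apply/seteqP; split => x.
  move=> [Dx nx]; have [b bx] := tile eps x.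
  have ox : opencell b x by apply: contrapT => h; apply: nx; exists b.
  exists b => //=; have /(discrepancy_opencell _ ox)[/= h1 h2] := Dx.
  rewrite mem_cat !in_fsetD; have [bF|bF] := boolP (b \in F) => /=.
    by rewrite andbT; apply/negP => bZ; have := h1 bZ; rewrite bF.
  by rewrite andbF orbF; exact: h2.
move=> [b /=]; rewrite mem_cat !in_fsetD => bb bx; split.
  apply/(discrepancy_opencell _ bx) => /=; move: bb.
  by case: (b \in Z); case: (b \in F).
move=> [a _ [ax nax]]; apply: nax.
by rewrite -(opencell_unique bx ax).
Qed.

(** Used to exclude unions of infinitely many cells, which have infinite energy. *)
Lemma integral_discrepancy_ge (Z : set (int * int)) (W : {fset int * int}) :
  [set` W] `<=` Z `\` [set` F] ->
  ((s3 / 2 * eps ^+ 2 * (3 / 4 * eps) * (#|` W|)%:R)%:E <=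
   \int[mu]_(x in discrepancy Z) dist x)%E.
Proof.
move=> WZ; apply: (@le_trans _ _ (\int[mu]_(x in \big[setU/set0]_(b <- W) opencell b) dist x)%E).
  rewrite integral_opencells ?fset_uniq// lee_fin ler_wpM2l//.
    by rewrite !mulr_ge0 ?divr_ge0 ?exprn_ge0 ?ltW// s3_gt0.
  have -> : #|` W| = (\sum_(b <- W) 1)%N by rewrite big_const_seq count_predT iter_addn_0 mul1n.
  rewrite ler_nat; apply: leq_sum => b _.
  exact: depth_gt0.
apply: ge0_subset_integral.
- by rewrite -bigcup_seq; apply: fin_bigcup_measurable => // b _; exact: measurable_opencell.
- exact: measurable_discrepancy.
- exact: measurable_dist.
- by move=> x _; exact: dist_ge0.
- rewrite -bigcup_seq => x [b /= /WZ[/= Zb bF] bx].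
  apply/(discrepancy_opencell _ bx); split => // _; exact/negP.
Qed.
End Energy.

Lemma perimeter_ge0 {R : realType} (A : set (R * R)) : (0 <= perimeter A)%E.
Proof.
apply: (@le_trans _ _ (hausdorff1_pre 1 (boundary A))); last by apply: ereal_sup_ubound; exists 1 => /=.
apply: le_ereal_inf_tmp => _ [U _ <-]; apply: nneseries_ge0 => n _ _.
by apply: ereal_sup_ubound; left.
Qed.

(** The factor [9 eps / (8 gam)] is the quotient of the area of a cell times
    [3 eps / 4], divided by [gam * eps], and the length [eps / sqrt 3] of an
    edge. *)
Lemma minimizer_minimal {R : realType} (gam eps : R) (m : 'Z_6 -> int) (F0 : hexset m != fset0) E :
  0 < gam -> 0 < eps -> minimizer (gam * eps) eps (reg eps [set` hexset m]) E ->
  exists2 Z : {fset int * int}, E = reg eps [set` Z] &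
    minimal (9 * eps / (8 * gam)) m (depth F0) Z.
Proof.
move=> gam0 eps0 [[I Il ->] Emin]; have s30 := @s3_gt0 R.
pose Z := [set a | I (latt eps a)].
have IZ : I = latt eps @` Z.
  apply/seteqP; split => [p Ip|_ [a Za <-]//].
  by have := Il _ Ip; rewrite lattice_latt => -[a _ aE]; exists a => //; rewrite /Z/= aE.
rewrite IZ -/(reg eps Z) in Emin *.
have adm (G : {fset int * int}) : admissible eps (reg eps [set` G]).
  by exists (latt eps @` [set` G]) => // _ [a _ <-]; rewrite lattice_latt; exists a.
have enE (G : {fset int * int}) : energy (gam * eps) eps (reg eps [set` G]) (reg eps [set` hexset m]) =
    (eps / s3 * total (9 * eps / (8 * gam)) m (depth F0) G)%:E.
  rewrite /energy perimeter_reg// (integral_discrepancy eps0 F0) -EFinM -EFinD; congr EFin.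
  rewrite /total /cost; move: (\sum_(b <- _) _ + _)%N => n.
  have := @s3_sq R; move: (s3) s30 => r r0 q.
  have -> : r / 2 * eps ^+ 2 * (3 / 4 * eps) = 9 / 8 * eps ^+ 3 / r.
    have -> : 9 / 8 = (r * r) * (r * r) / 8 :> R by rewrite q; field.
    by rewrite -q; field; rewrite gt_eqF.
  by field; rewrite !gt_eqF.
have [Zfin|Zinf] := pselect (finite_set Z); last first.
  exfalso; have := Emin _ (adm (hexset m)); rewrite enE.
  set r := (X in (_ <= X%:E)%E); rewrite /energy => le.
  pose c := s3 / 2 * eps ^+ 2 * (3 / 4 * eps).
  have c0 : 0 < c by rewrite /c !mulr_gt0 ?divr_gt0 ?exprn_gt0.
  have inf : infinite_set (Z `\` [set` hexset m]) by apply: infinite_setD => //; exact: finite_fset.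
  have [W WZ Wn] := infinite_set_fset (Num.truncn (r * (gam * eps) / c)).+1 inf.
  have := integral_discrepancy_ge eps0 F0 WZ; rewrite -/c => ge.
  have : ((gam * eps)^-1%:E * (c * (#|` W|)%:R)%:E <= r%:E)%E.
    apply: le_trans le; apply: le_trans (leeDr _ _); last first.
      exact: perimeter_ge0.
    by rewrite lee_wpmul2l// lee_fin invr_ge0 mulr_ge0// ltW.
  rewrite -EFinM lee_fin ler_pdivrMl ?mulr_gt0// => h.
  have : (#|` W|)%:R <= r * (gam * eps) / c by rewrite ler_pdivlMr// mulrC [r * _]mulrC.
  apply/negP; rewrite -ltNge.
  by apply: (lt_le_trans (truncnS_gt _)); rewrite ler_nat.
have [G ZG] : exists G : {fset int * int}, Z = [set` G] by exists (fset_set Z); rewrite fset_setK.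
rewrite {}ZG in Emin *; exists G => // G'; have := Emin _ (adm G').
by rewrite !enE lee_fin ler_pM2l// divr_gt0.
Qed.

(** * Hausdorff distance, sides and envelopes of hexagons *)

Section Hausdorff.
Context {R : realType}.
Implicit Types (h : 'Z_6 -> R) (x y : R * R) (j : 'Z_6).

Lemma vertex_hexagon h j : (forall i, 0 < rlen h i) -> hexagon h (vertex h j).
Proof.
move=> hl; apply: (proj1 (proj2 (hexagon_side j (vertex h j) hl) _)).
by exists 1; [rewrite /= lexx ler01|rewrite scale1r addrC subrK].
Qed.

Lemma edist_lt x (A : set (R * R)) (e : R) : (edist_set x A < e%:E)%E ->
  exists2 a, A a & enorm (x - a) < e.
Proof. by move=> /ereal_inf_lt[_ [a Aa <-]]; rewrite lte_fin; exists a. Qed.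

(** The form [j] is 1-Lipschitz and attains its maximum [h j] at a vertex. *)
Lemma hausdorff_hexagon h h' (e : R) j : (forall i, 0 < rlen h i) -> (forall i, 0 < rlen h' i) ->
  (hausdorff_dist (hexagon h) (hexagon h') < e%:E)%E -> `|h j - h' j| < e.
Proof.
have half (g g' : 'Z_6 -> R) : (forall i, 0 < rlen g i) ->
    (ereal_sup [set edist_set a (hexagon g') | a in hexagon g] < e%:E)%E -> g j - g' j < e.
  move=> gl lt; have vg := vertex_hexagon j gl.
  have /edist_lt[a ag ae] : (edist_set (vertex g j) (hexagon g') < e%:E)%E.
    by apply: le_lt_trans lt; apply: ereal_sup_ubound; exists (vertex g j).
  have := lin_enorm j (vertex g j - a); rewrite linB lin_vertex => h1.
  have := le_lt_trans (le_trans (ler_norm _) h1) ae; have := ag j; lra.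
move=> hl hl'; rewrite /hausdorff_dist gt_max => /andP[h1 h2].
by have := half _ _ hl h1; have := half _ _ hl' h2; rewrite ltr_norml => ? ?; apply/andP; split; lra.
Qed.

(** Shrinking by the factor [1 - d / c] maps each of the hexagons into the other. *)
Lemma hausdorff_hexagon_le h h' (c M d : R) : 0 < c -> d <= c ->
  (forall j, c <= h j <= M) -> (forall j, c <= h' j <= M) -> (forall j, `|h j - h' j| <= d) ->
  (hausdorff_dist (hexagon h) (hexagon h') <= (24 * M / c * d)%:E)%E.
Proof.
move=> c0 dc hM hM' hd.
have d0 : 0 <= d by apply: le_trans (hd 0); exact: normr_ge0.
have half (g g' : 'Z_6 -> R) : (forall j, c <= g j <= M) -> (forall j, c <= g' j <= M) ->
   (forall j, g j - g' j <= d) ->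
  (ereal_sup [set edist_set a (hexagon g') | a in hexagon g] <= (24 * M / c * d)%:E)%E.
  move=> gM gM' gd; apply: ub_ereal_sup => _ [a ag <-].
  have bg : hexagon g' ((1 - d / c) *: a).
    move=> j; rewrite linZ; have := ag j; have := gd j; have /andP[g1 _] := gM j; have /andP[g2 _] := gM' j.
    have t0 : 0 <= d / c by rewrite divr_ge0// ltW.
    have t1 : d / c <= 1 by rewrite ler_pdivrMr// mul1r.
    have tc : d / c * c = d by rewrite divfK// gt_eqF.
    move: (d / c) t0 t1 tc (lin j a) => t t0 t1 tc l g3 g4.
    have [l0|l0] := leP 0 l; last by nra.
    have : (1 - t) * l <= (1 - t) * g j by apply: ler_wpM2l => //; lra.
    have : t * c <= t * g j by apply: ler_wpM2l.
    by rewrite mulrBl mul1r; lra.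
  apply: (@le_trans _ _ (enorm (a - (1 - d / c) *: a))%:E).
    by apply: ereal_inf_lbound; exists ((1 - d / c) *: a).
  rewrite lee_fin (_ : a - _ = (d / c) *: a); last by rewrite scalerBl scale1r opprB addrC subrK.
  rewrite enormZ ger0_norm ?divr_ge0 ?(ltW c0)//.
  rewrite (_ : 24 * M / c * d = d / c * (24 * M)); last by ring.
  apply: ler_wpM2l; first by rewrite divr_ge0// ltW.
  apply: (le_trans (hexagon_enorm ag)).
  have : \sum_(j : 'Z_6) `|g j| <= \sum_(j : 'Z_6) M.
    by apply: ler_sum => j _; have /andP[g1 g2] := gM j; rewrite ger0_norm//; lra.
  rewrite [X in _ <= X](_ : _ = 6 * M); last by rewrite sumr_const card_ord mulr_natl.
  by move=> h1; lra.
rewrite /hausdorff_dist ge_max; apply/andP; split; apply: half => // j;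
  by have := hd j; rewrite ler_norml => /andP[? ?]; lra.
Qed.

(** The projection of the origin onto the line of the side is [h j *: nrm R j]. *)
Lemma side_dist_vertex h j : (forall i, 0 < rlen h i) -> 0 <= h j ->
  side_dist (nrm R j) (segment (vertex h (j - 1)) (vertex h j)) = h j.
Proof.
move=> hl h0; rewrite /side_dist.
suff -> : edist_set 0 [set x | exists2 y, segment (vertex h (j - 1)) (vertex h j) y & dot (x - y) (nrm R j) = 0] = (h j)%:E by [].
apply/eqP; rewrite eq_le; apply/andP; split.
  apply: ereal_inf_lbound; exists (h j *: nrm R j).
    exists (vertex h j); first by exists 1; [rewrite /= lexx ler01|rewrite scale1r addrC subrK].
    by rewrite -/(lin _ _) linB linZ lin_nrm lin_vertex mulr1 subrr.
  by rewrite sub0r enormN enormZ enorm_nrm mulr1 ger0_norm.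
apply: le_ereal_inf_tmp => _ [x [y /(hexagon_side _ _ hl)[_ yj] dxy] <-].
have /eqP : lin j (x - y) = 0 by [].
rewrite linB yj subr_eq0 => /eqP xj.
by rewrite lee_fin sub0r enormN -xj; apply: le_trans (lin_enorm j x); exact: ler_norm.
Qed.

Lemma side_length_vertex h j : (forall i, 0 < rlen h i) ->
  side_length (segment (vertex h (j - 1)) (vertex h j)) = 2 / s3 * rlen h j.
Proof.
move=> hl; rewrite /side_length hausdorff1_segment /= vertex_diff enormZ.
have -> : enorm (tang j : R * R) = 1.
  by rewrite -(enorm_nrm j) /enorm /tang /perp /dot /= mulrNN addrC.
by rewrite mulr1 ger0_norm// mulr_ge0 ?divr_ge0 ?(ltW (hl j)) ?sqrtr_ge0.
Qed.

Lemma hexagon_sym h : (forall j, h (j + 3) = h j) -> origin_symmetric (hexagon h).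
Proof.
move=> hs; have H x : hexagon h x -> hexagon h (- x).
  by move=> hx j; rewrite linN -lin3 -hs; exact: hx.
apply/seteqP; split => [_ [x hx <-]|x hx]; first exact: H.
by exists (- x); [exact: H|rewrite opprK].
Qed.

End Hausdorff.

Section Envelope.
Context {R : realType}.
Variable eps : R.
Hypothesis eps0 : 0 < eps.
Implicit Types (h : 'Z_6 -> R) (x y : R * R) (j : 'Z_6) (m : 'Z_6 -> int) (a : int * int).
Local Notation reg := (reg eps).

(** The positions of the sides of the envelope: [sqrt 3 / 2] is the distance between
    rows and [sqrt 3 / 3] the radius of a cell, in units of [eps]. *)
Definition env m j : R := eps * (s3 / 2 * (m j)%:~R + s3 / 3).

Lemma rlen_env m j : rlen (env m) j = eps * (s3 / 2 * (slen m j - 1)%:~R + s3 / 3).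
Proof. by rewrite /rlen /env /slen !(intrD, intrN); field. Qed.

Lemma rlen_env_gt0 m : (forall j, 1 <= slen m j) -> forall j, 0 < rlen (env m) j.
Proof.
move=> ml j; rewrite rlen_env mulr_gt0//; have s30 := @s3_gt0 R.
apply: ltr_wpDl; last by rewrite divr_gt0.
apply: mulr_ge0; first by rewrite divr_ge0// ltW.
by rewrite ler0z subr_ge0.
Qed.

Lemma lin_tn j x : lin j x = s3 / 3 * (tn (j - 1) x + tn (j - 2) x).
Proof.
have sq := @s3_sq R; have h1 := s3_tn (j - 1) x; have h2 := s3_tn (j - 2) x.
have e : lin j x = (s3 * tn (j - 1) x + s3 * tn (j - 2) x) / 3.
  rewrite h1 h2 !subrK (_ : j - 1 + 2 = j + 1); last by rewrite -addrA; congr (_ + _); exact/val_inj.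
  by rewrite (_ : j - 2 + 1 = j - 1) ?lin1; [field|rewrite -addrA; congr (_ + _); exact/val_inj].
by rewrite e; field.
Qed.

(** The extreme point of the cell in the direction [nrm j] is one of its
    vertices. *)
Lemma cell_hexagon h a : cell_at eps (latt eps a) `<=` hexagon h <->
  forall j, eps * (s3 / 2 * (hform j a)%:~R + s3 / 3) <= h j.
Proof.
have s30 := @s3_gt0 R; have sq := @s3_sq R.
split=> [H j|H x /(cell_atP _ _ eps0) ax j].
  have := H (latt eps a + (eps * s3 / 3) *: nrm R j).
  rewrite cell_atP// => /(_ _)/(_ j); rewrite linD linZ lin_nrm mulr1 lin_latt.
  have -> : eps * (s3 / 2 * (hform j a)%:~R + s3 / 3) = eps * (s3 / 2) * (hform j a)%:~R + eps * s3 / 3 by field.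
  apply => i; rewrite addrC addKr tnZ.
  have := tn_nrm_le (R := R) i j => h1.
  apply: (@le_trans _ _ (eps * s3 / 3 * (s3 / 2))).
    by apply: ler_wpM2l => //; rewrite !mulr_ge0 ?invr_ge0 ?ltW.
  by rewrite (_ : eps * s3 / 3 * (s3 / 2) = eps * (s3 * s3) / 6); [rewrite sq; lra|field].
apply: le_trans (H j); rewrite -[x](subrK (latt eps a)) linD lin_latt.
have := ax (j - 1); have := ax (j - 2); rewrite lin_tn => h1 h2.
have : s3 / 3 * (tn (j - 1) (x - latt eps a) + tn (j - 2) (x - latt eps a)) <= s3 / 3 * eps.
  by apply: ler_wpM2l; [rewrite divr_ge0 ?ltW|lra].
lra.
Qed.

Lemma cell_env m a : cell_at eps (latt eps a) `<=` hexagon (env m) <-> a \in hexset m.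
Proof.
rewrite cell_hexagon in_hexset; have s30 := @s3_gt0 R.
split=> [H|/inhexP H j].
  apply/inhexP => j; have := H j; rewrite /env ler_pM2l// lerD2r ler_pM2l ?divr_gt0//.
  by rewrite ler_int.
by rewrite /env ler_pM2l// lerD2r ler_pM2l ?divr_gt0// ler_int.
Qed.

(** Every side of the envelope touches a vertex of some cell. *)
Lemma env_envelope m : (forall j, 1 <= slen m j) ->
  wulff_envelope (reg [set` hexset m]) (hexagon (env m)).
Proof.
move=> ml; split.
- by apply/wulff_hexagonP; exists (env m) => //; exact: rlen_env_gt0.
- by move=> x /(regP eps0)[a /= /cell_env am /(cell_at_incell eps0)]; exact: am.
move=> K /wulff_hexagonP[h hl ->] H x xm j; apply: le_trans (xm j) _.
have := top_line j ml.
move=> /imfsetP[a /= am aj].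
have /cell_hexagon/(_ j) : cell_at eps (latt eps a) `<=` hexagon h.
  by apply: subset_trans H; apply/(reg_cell eps0).
by rewrite -aj.
Qed.

Lemma reg_discrete_hexagon m : (forall j, 1 <= slen m j) ->
  discrete_hexagon eps (reg [set` hexset m]).
Proof.
move=> ml; exists (hexagon (env m)).
  by apply/wulff_hexagonP; exists (env m) => //; exact: rlen_env_gt0.
apply: (congr1 (cells eps)); apply/seteqP; split => [_ [a /= /cell_env am <-]|p [pl pm]].
  by split => //; rewrite lattice_latt; exists a.
by move: pl pm; rewrite lattice_latt => -[a _ <-] /cell_env am; exists a.
Qed.

(** The largest values of the six forms on the cells give a presentation in which all
    constraints are attained, so that no side is empty. *)
Lemma discrete_hexagon_reg E : discrete_hexagon eps E ->
  E = set0 \/ exists2 m, E = reg [set` hexset m] &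
    forall j, 1 <= slen m j /\ exists2 a, a \in hexset m & hform j a = m j.
Proof.
move=> [_ /wulff_hexagonP[h hl ->] ->]; have s30 := @s3_gt0 R.
pose m0 j := Num.floor ((h j - eps * (s3 / 3)) / (eps * (s3 / 2))).
have m0P a : cell_at eps (latt eps a) `<=` hexagon h <-> a \in hexset m0.
  have e j : (eps * (s3 / 2 * (hform j a)%:~R + s3 / 3) <= h j) = (hform j a <= m0 j).
    rewrite /m0 floor_ge_int_tmp ler_pdivlMr ?mulr_gt0 ?divr_gt0//.
    by rewrite mulrDr -lerBrDr mulrA [leLHS]mulrC.
  rewrite cell_hexagon in_hexset; split=> [H|/inhexP H j]; last by rewrite e.
  by apply/inhexP => j; rewrite -e.
have -> : cells eps [set i | lattice eps i /\ cell_at eps i `<=` hexagon h] = reg [set` hexset m0].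
  apply: (congr1 (cells eps)); apply/seteqP; split => [p [pl pm]|_ [a /= /m0P am <-]].
    by move: pl pm; rewrite lattice_latt => -[a _ <-] /m0P am; exists a.
  by split => //; rewrite lattice_latt; exists a.
have [->|/fset0Pn[x0 x0m]] := eqVneq (hexset m0) fset0.
  by left; apply/seteqP; split => // x /(regP eps0)[a].
right.
have top j : exists M : int, (forall x : int * int, x \in hexset m0 -> hform j x <= M) /\
    exists2 x : int * int, x \in hexset m0 & hform j x = M.
  pose y0 : hexset m0 := [` x0m]%fset.
  have [y _ ymax] := @Order.TotalTheory.arg_maxP _ _ (hexset m0) y0 xpredT (fun z : hexset m0 => hform j (val z)) isT.
  by exists (hform j (val y)); split => [x xI|]; [exact: (ymax [` xI]%fset)|exists (val y) => //; exact: valP].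
have [m /all_and2[mub mat]] := choice top.
have mE : hexset m = hexset m0.
  apply/fsetP => a; rewrite in_hexset; apply/inhexP/idP => [H|am j]; last exact: mub.
  rewrite in_hexset; apply/inhexP => j; apply: le_trans (H j) _.
  by have [x + <-] := mat j; rewrite in_hexset => /inhexP.
exists m => [|j]; first by rewrite mE.
rewrite mE; split => //; have [x xm xj] := mat j.
have := mub (j - 1) _ xm; have := mub (j + 1) _ xm; rewrite form1 xj /slen.
by move: (hform (j + 1) x) (m j) (m (j - 1)) (m (j + 1)); clear; lia.
Qed.

Lemma reg_sym m : (forall j, exists2 a, a \in hexset m & hform j a = m j) ->
  origin_symmetric (reg [set` hexset m]) -> forall j, m (j + 3) = m j.
Proof.
move=> mat sym; have H j : m j <= m (j + 3).
  have [a am <-] := mat j.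
  have : reg [set` hexset m] (- latt eps a).
    rewrite -sym; exists (latt eps a) => //; apply/(regP eps0); exists a => // k.
    by rewrite cn_latt// lerDr.
  rewrite -lattN => /(regP eps0)[b bm /(incell_center eps0) e].
  by move: bm; rewrite /= e in_hexset => /inhexP/(_ (j + 3)); rewrite formN form3 opprK.
move=> j; apply/eqP; rewrite eq_le H andbT.
by have := H (j + 3); rewrite -addrA (_ : 3 + 3 = 0 :> 'Z_6) ?addr0//; exact/val_inj.
Qed.

(** There are disjoint hexagons. *)
Lemma empty_no_envelope W : ~ wulff_envelope (set0 : set (R * R)) W.
Proof.
move=> [/wulff_hexagonP[h hl ->] _ H].
have v0 := vertex_hexagon 0 hl; set x := vertex h 0 in v0.
(* a point far enough from [x] for a hexagon around it to avoid [x] *)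
pose p := x + 3 *: nrm R 0.
have Kw : wulff_hexagon (hexagon (fun j => lin j p + 1)).
  by apply/wulff_hexagonP; exists (fun j => lin j p + 1) => // j; rewrite /rlen lin1; lra.
have /(_ _ v0 3) := H _ Kw (@sub0set _ _).
have l3 y : lin 3 y = - lin 0 y by exact: (lin3 0).
by rewrite !l3 /p linD linZ lin_nrm; lra.
Qed.

Lemma envelope_unique (E W W' : set (R * R)) : wulff_envelope E W -> wulff_envelope E W' -> W = W'.
Proof.
by move=> [w1 w2 w3] [v1 v2 v3]; apply/seteqP; split; [exact: w3|exact: v3].
Qed.
End Envelope.

(** * The discrete evolution *)

(** The constraints of a hexagon without empty sides are determined by its points. *)
Lemma hexset_inj (m m' : 'Z_6 -> int) : (forall j, 1 <= slen m j) -> (forall j, 1 <= slen m' j) ->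
  hexset m = hexset m' -> forall j, m j = m' j.
Proof.
have half (p q : 'Z_6 -> int) j : (forall j, 1 <= slen p j) -> (forall j, 1 <= slen q j) ->
    hexset p = hexset q -> p j <= q j.
  move=> pl ql pq; have := top_line j pl; rewrite pq.
  by rewrite lines_hexset// => /andP[].
by move=> ml ml' mm j; apply/eqP; rewrite eq_le !half.
Qed.

(** Excludes ties between different numbers of edges and different costs. *)
Definition irrational_ratio {R : realType} (lam : R) :=
  forall a b : int, a%:~R + lam * b%:~R = 0 -> b = 0.

Section Step.
Context {R : realType}.

(** The depths [K0] and [K] depend only on the lower bound [c0] for the scaled
    lengths: at a depth [p] at most half the length, a line weighs at least [p * c0 / 2]
    in units of [1 / lam]. *)
Lemma step_constants (c0 : R) : 0 < c0 -> exists K0 K : nat, exists2 l0 : R, 0 < l0 &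
  [/\ (0 < K0)%N, (K0 <= K)%N &
  forall lam : R, 0 < lam -> lam <= l0 -> forall n : nat, c0 <= lam * n%:R ->
  [/\ (2 * K + 1 < n)%N, 6 <= lam * (K0 * (n + 1 - K0))%N%:R,
      6 * (12 * K0%:R + 1) < lam * (K * (n + 1 - K))%N%:R & lam * (K * K)%N%:R < 1]].
Proof.
move=> c00; pose K0 := (Num.truncn (12 / c0)).+1.
(* from half of the length, [6 <= p * c0 / 2] for [p = K0] and
   [6 * (12 * K0 + 1) < p * c0 / 2] for [p = K] *)
pose K := (K0 + (Num.truncn (12 * (12 * K0%:R + 1) / c0)).+1)%N.
have K0c : 12 < K0%:R * c0 by rewrite -ltr_pdivrMr// truncnS_gt.
have Kc : 12 * (12 * K0%:R + 1) < K%:R * c0.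
  rewrite -ltr_pdivrMr//; apply: (lt_le_trans (truncnS_gt _)).
  by rewrite ler_nat /K leq_addl.
have K0K : (K0 <= K)%N by rewrite /K leq_addr.
have K0_gt0 : (0 < K0)%N by [].
exists K0, K; move: K0 K K0c Kc K0K K0_gt0 => K0 K K0c Kc K0K K0_gt0.
exists (Num.min (c0 / (2 * K%:R + 2)) (1 / (2 * (K * K)%N%:R))).
  by rewrite lt_min !divr_gt0 ?ltr0n ?muln_gt0 ?(leq_trans K0_gt0 K0K)//; rewrite ?ltr_wpDl// mulr_gt0 ?ltr0n ?muln_gt0 ?(leq_trans K0_gt0 K0K).
split => // lam lam0; rewrite le_min => /andP[l1 l2] n cn.
have Kn : (2 * K + 1 < n)%N.
  have h : lam * (2 * K%:R + 2) <= c0 by rewrite -ler_pdivlMr// ltr_wpDl.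
  have : (2 * K + 2)%N%:R <= n%:R :> R.
    rewrite -(ler_pM2l lam0); apply: le_trans cn; apply: le_trans h.
    by rewrite natrD natrM.
  by rewrite ler_nat; lia.
have half (p : nat) : (p <= K)%N -> p%:R * c0 / 2 <= lam * (p * (n + 1 - p))%N%:R.
  move=> pK; have : n%:R / 2 <= (n + 1 - p)%N%:R :> R.
    rewrite ler_pdivrMr// -natrM ler_nat; lia.
  rewrite natrM => h; have p0 : 0 <= p%:R :> R by rewrite ler0n.
  apply: (@le_trans _ _ (p%:R * (lam * (n%:R / 2)))).
    by rewrite -mulrA; apply: ler_wpM2l => //; lra.
  by rewrite mulrCA; apply: ler_wpM2l; [exact: ltW|apply: ler_wpM2l].
split => //.
- by have := half _ K0K; lra.
- by have := half _ (leqnn K); lra.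
- have k0 : 0 < (K * K)%N%:R :> R by rewrite ltr0n muln_gt0 (leq_trans K0_gt0 K0K).
  have : lam * (2 * (K * K)%N%:R) <= 1 by rewrite -ler_pdivlMr// mulr_gt0.
  by move: k0; move: (lam) lam0 ((K * K)%N%:R : R) => l l0 k k0; nra.
Qed.

Lemma step (c0 : R) : 0 < c0 -> exists K : nat, exists2 l0 : R, 0 < l0 &
  forall (gam eps : R) (m : 'Z_6 -> int) E, 0 < gam -> 0 < eps ->
  let lam := 9 * eps / (8 * gam) in lam <= l0 -> irrational_ratio lam ->
  (forall j, c0 <= lam * (slen m j)%:~R) -> (forall j, m (j + 3) = m j) ->
  minimizer (gam * eps) eps (reg eps [set` hexset m]) E ->
  exists m' : 'Z_6 -> int, [/\ E = reg eps [set` hexset m'], forall j, 1 <= slen m' j,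
    forall j, m' (j + 3) = m' j &
    forall j, [/\ m j - K%:Z <= m' j <= m j,
      lam * ((m j - m' j)%:~R * (slen m j - 2 * K%:Z)%:~R) <= 2 &
      2 <= lam * ((m j - m' j + 1)%:~R * (slen m j + K%:Z)%:~R)]].
Proof.
move=> c00; have [K0 [K [l0 l00 [K00 K0K HK]]]] := step_constants c00.
exists K, l0 => // gam eps m E gam0 eps0 lam laml0 notie mlen msym Emin.
have lam0 : 0 < lam by rewrite divr_gt0 ?mulr_gt0.
pose n := absz (Num.ceil (c0 / lam)).
have nE : n%:Z = Num.ceil (c0 / lam).
  by rewrite /n gez0_abs// -(ler_int R) (le_trans _ (ceil_ge _))// divr_ge0 ?ltW.
have cn : c0 <= lam * n%:R.
  by rewrite mulrC -ler_pdivrMr// (_ : n%:R = n%:Z%:~R)// nE ceil_ge.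
have [Kn h0 h1 h2] := HK _ lam0 laml0 n cn.
have len j : n%:Z <= slen m j.
  by rewrite nE ceil_le_int_tmp ler_pdivrMr// mulrC.
have ml j : 1 <= slen m j by move: (len j) Kn; clear; lia.
have F0 : hexset m != fset0.
  have := top_line 0 ml.
  by move=> /imfsetP[a /= am _]; apply/fset0Pn; exists a.
have [Z EZ Zmin] := minimizer_minimal F0 gam0 eps0 Emin.
have d1 := depth_gt0 F0; have dP := depthP F0.
have [M [ZM Mb Mat]] := minimal_hexset lam0 d1 dP Zmin len K00 K0K Kn h0 h1 h2.
have Ml j : 1 <= slen M j.
  have := len j; have := Mb j; have := Mb (j - 1); have := Mb (j + 1); rewrite /slen.
  by move: Kn (M j) (M (j - 1)) (M (j + 1)) (m j) (m (j - 1)) (m (j + 1)); clear; lia.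
exists M; split => //; first by rewrite EZ ZM.
  exact: (minimal_sym lam0 d1 dP Zmin notie msym ZM Ml).
move=> j; have [r1 r2] := minimal_rate lam0 d1 dP Zmin len K00 K0K Kn j ZM Mb.
by split => //; have := Mb j; clear; lia.
Qed.

Variables (gam : R) (h0 : 'Z_6 -> R).
Hypothesis gam0 : 0 < gam.
Hypothesis h0l : forall j, 0 < rlen h0 j.

(** What is known of the first [n] steps at scale [eps], in terms of the positions
    [m k j] of the sides; [c1] bounds the lengths from below and [K] bounds the number
    of rows lost in one step. *)
Record state (K : nat) (c1 eps : R) (D : nat -> set (R * R)) (n : nat) (m : nat -> 'Z_6 -> int) : Prop := State {
  state_reg : forall k, (k <= n)%N -> D k = reg eps [set` hexset (m k)];
  state_len : forall k j, (k <= n)%N -> 1 <= slen (m k) j;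
  state_sym : forall k j, (k <= n)%N -> m k (j + 3) = m k j;
  state_start : forall j, `|env eps (m 0%N) j - h0 j| < eps;
  state_big : forall k j, (k <= n)%N -> c1 <= eps * (slen (m k) j)%:~R;
  state_step : forall k j, (k < n)%N -> m k j - K%:Z <= m k.+1 j <= m k j;
  state_rate : forall k j, (k < n)%N -> let lam := 9 * eps / (8 * gam) in
    lam * ((m k j - m k.+1 j)%:~R * (slen (m k) j - 2 * K%:Z)%:~R) <= 2 /\
      2 <= lam * ((m k j - m k.+1 j + 1)%:~R * (slen (m k) j + K%:Z)%:~R)
}.

(** The Hausdorff distance of the envelopes controls the positions of the sides by
    [hausdorff_hexagon]. *)
Lemma initial_state eps E : 0 < eps -> discrete_hexagon eps E -> origin_symmetric E ->
  (exists2 W, wulff_envelope E W & (hausdorff_dist W (hexagon h0) < eps%:E)%E) ->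
  exists m, [/\ E = reg eps [set` hexset m], forall j, 1 <= slen m j,
    forall j, m (j + 3) = m j & forall j, `|env eps m j - h0 j| < eps].
Proof.
move=> eps0 Eh Es [W EW Wd].
have [E0|[m Em ml]] := discrete_hexagon_reg eps0 Eh.
  by rewrite E0 in EW; have [] := empty_no_envelope EW.
have ml1 j : 1 <= slen m j by have [] := ml j.
have mat j : exists2 a, a \in hexset m & hform j a = m j by have [] := ml j.
exists m; split => //; first by apply: (reg_sym eps0 mat); rewrite -Em.
move=> j; have := env_envelope eps0 ml1; rewrite -Em => /(envelope_unique EW) WE.
by rewrite WE in Wd; apply: (hausdorff_hexagon j _ h0l Wd); exact: rlen_env_gt0.
Qed.

(** As long as the scaled lengths exceed [c1], each step moves each side by at most [K]
    rows. This costs at most [2 K eps] of length in a time [gam * eps]; hence a time [T] independent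
    of [eps] during which the lengths stay above [c1]. The bound [K] depends on
    [c1], which is fixed first. *)
Lemma evolution : exists (K : nat) (c1 T e0 : R), [/\ 0 < c1, 0 < T, 0 < e0 &
  forall (eps : R) (D : nat -> set (R * R)), 0 < eps -> eps <= e0 ->
  irrational_ratio (9 * eps / (8 * gam)) ->
  discrete_hexagon eps (D 0%N) -> origin_symmetric (D 0%N) ->
  (exists2 W, wulff_envelope (D 0%N) W & (hausdorff_dist W (hexagon h0) < eps%:E)%E) ->
  (forall k, (1 <= k)%N -> minimizer (gam * eps) eps (D k.-1) (D k)) ->
  exists m, forall n, n%:R * (gam * eps) <= T -> state K c1 eps D n m].
Proof.
have s30 := @s3_gt0 R.
have [l l0 hl] : exists2 l : R, 0 < l & forall j, l <= rlen h0 j.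
  (* the shortest side *)
  pose i := [arg min_(i < (0 : 'Z_6)) rlen h0 i]%O; exists (rlen h0 i) => // j.
  by rewrite /i; case: arg_minP => // k _; apply.
pose c1 := l / s3.
have c10 : 0 < c1 by rewrite divr_gt0.
have c00 : 0 < 9 / (8 * gam) * c1 by rewrite mulr_gt0 ?divr_gt0 ?mulr_gt0.
have [K [l1 l10 HK]] := step c00.
exists K, c1, (gam * (c1 / (4 * (K%:R + 1)))).
exists (Num.min (l / 12) (l1 / (9 / (8 * gam)))).
have K1 : 0 < K%:R + 1 :> R by rewrite ltr_wpDl.
split => //; first by rewrite mulr_gt0// divr_gt0// mulr_gt0.
  by rewrite lt_min !divr_gt0// mulr_gt0.
move=> eps D eps0; rewrite le_min => /andP[el el1] notie Dh Ds DW Dmin.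
pose ok E (m : 'Z_6 -> int) := E = reg eps [set` hexset m] /\ forall j, 1 <= slen m j.
have /choice[m mP] k : exists m, (exists m', ok (D k) m') -> ok (D k) m.
  by have [[m' h]|h] := pselect (exists m', ok (D k) m'); [exists m'|exists (fun=> 0) => /h].
have uniq k m' : ok (D k) m' -> m k =1 m'.
  move=> h; have [h1 h2] := mP k (ex_intro _ _ h); case: h => h3 h4.
  apply: hexset_inj => //; apply/fsetP => a.
  by have /(reg_inj eps0)/seteqP[s1 s2] := etrans (esym h1) h3; apply/idP/idP => [/s1|/s2].
have [m0 [m0E m0l m0s m0d]] := initial_state eps0 Dh Ds DW.
have e0 := uniq 0%N m0 (conj m0E m0l).
have mm0 : m 0%N = m0 by apply/funext.
have start j : 3 / 2 * c1 <= eps * (slen (m 0%N) j)%:~R.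
  have h : 3 / 4 * l <= rlen (env eps (m 0%N)) j.
    have := m0d j; have := m0d (j - 1); have := m0d (j + 1); have := hl j.
    rewrite /rlen mm0 !ltr_norml => ? /andP[? ?] /andP[? ?] /andP[? ?]; lra.
  have : 2 / s3 * (3 / 4 * l) <= 2 / s3 * rlen (env eps (m 0%N)) j.
    by apply: ler_wpM2l => //; rewrite divr_ge0// ltW.
  rewrite rlen_env intrB.
  have -> : 2 / s3 * (3 / 4 * l) = 3 / 2 * c1 by rewrite /c1; field; rewrite gt_eqF.
  have -> : 2 / s3 * (eps * (s3 / 2 * ((slen (m 0%N) j)%:~R - 1) + s3 / 3)) =
    eps * (slen (m 0%N) j)%:~R - eps / 3 by field; rewrite gt_eqF.
  lra.
have main n : n%:R * (gam * eps) <= gam * (c1 / (4 * (K%:R + 1))) ->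
   [/\ state K c1 eps D n m & forall j, m 0%N j - n%:Z * K%:Z <= m n j <= m 0%N j].
  elim: n => [|n IH] nT.
    split; last by move=> j; rewrite mul0r subr0 lexx.
    split=> // [k|k j|k j|j|k j]; rewrite ?leqn0 ?mm0//.
    - by move=> /eqP->; rewrite mm0.
    - by move=> /eqP->; rewrite mm0.
    - by move=> /eqP->; rewrite mm0.
    - by move=> /eqP->; apply: le_trans (start j); lra.
  have [|st dec] := IH.
    by apply: le_trans nT; rewrite ler_pM2r ?mulr_gt0// ler_nat.
  have big j : 9 / (8 * gam) * c1 <= 9 * eps / (8 * gam) * (slen (m n) j)%:~R.
    rewrite (_ : 9 * eps / (8 * gam) * (slen (m n) j)%:~R = 9 / (8 * gam) * (eps * (slen (m n) j)%:~R)).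
      by rewrite ler_pM2l ?divr_gt0 ?mulr_gt0//; exact: (state_big st).
    by field; rewrite gt_eqF.
  have lamle : 9 * eps / (8 * gam) <= l1.
    rewrite (_ : 9 * eps / (8 * gam) = 9 / (8 * gam) * eps); last by field; rewrite gt_eqF.
    by rewrite mulrC -ler_pdivlMr ?divr_gt0 ?mulr_gt0.
  have := Dmin n.+1 isT; rewrite /= (state_reg st (leqnn n)) => Emin.
  have msym j := state_sym st j (leqnn n).
  have [m' [m'E m'l m's m'r]] := HK gam eps (m n) _ gam0 eps0 lamle notie big msym Emin.
  have mm' : m n.+1 = m' by apply/funext; apply: uniq; split.
  have dec' j : m 0%N j - n.+1%:Z * K%:Z <= m n.+1 j <= m 0%N j.
    have := dec j; have [] := m'r j; rewrite mm' => + _ _.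
    move: (m' j) (m n j) (m 0%N j) => a b c; clear.
    have -> : n.+1%:Z * K%:Z = n%:Z * K%:Z + K%:Z by rewrite -addn1 PoszD mulrDl mul1r.
    by move: (n%:Z * K%:Z) => p; lia.
  have cs k : (k <= n.+1)%N -> (k <= n)%N \/ k = n.+1.
    by rewrite leq_eqVlt ltnS => /orP[/eqP|]; [right|left].
  split => //; split.
  - by move=> k /cs[kn|->]; [exact: (state_reg st)|rewrite mm'].
  - by move=> k j /cs[kn|->]; [exact: (state_len st)|rewrite mm'].
  - by move=> k j /cs[kn|->]; [exact: (state_sym st)|rewrite mm'].
  - exact: (state_start st).
  - move=> k j /cs[kn|->]; first exact: (state_big st).
    have sl : slen (m 0%N) j - 2 * (n.+1%:Z * K%:Z) <= slen (m n.+1) j.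
      have := dec' (j - 1); have := dec' (j + 1); have := dec' j; rewrite /slen.
      by move: (n.+1%:Z * K%:Z) (m n.+1 j) (m n.+1 (j - 1)) (m n.+1 (j + 1)) (m 0%N j)
        (m 0%N (j - 1)) (m 0%N (j + 1)); clear; lia.
    have : eps * (slen (m 0%N) j - 2 * (n.+1%:Z * K%:Z))%:~R <= eps * (slen (m n.+1) j)%:~R.
      by rewrite ler_pM2l// ler_int.
    apply: le_trans; rewrite intrB !intrM mulrBr.
    have nT' : n.+1%:R * eps <= c1 / (4 * (K%:R + 1)).
      by rewrite -(ler_pM2l gam0); apply: le_trans nT; rewrite mulrCA.
    have : n.+1%:R * eps * (K%:R + 1) <= c1 / 4.
      rewrite -ler_pdivlMr//; apply: (le_trans nT'); rewrite (_ : c1 / (4 * (K%:R + 1)) = c1 / 4 / (K%:R + 1))//.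
      by field; rewrite gt_eqF.
    have : 0 <= n.+1%:R * eps by rewrite mulr_ge0// ltW.
    have := start j; rewrite -!pmulrn.
    move: (eps * (slen (m 0%N) j)%:~R) => u; move: (n.+1%:R : R) (K%:R : R) => p q h1 h2 h3.
    rewrite (_ : eps * (2 * (p * q)) = 2 * (p * eps * (q + 1)) - 2 * (p * eps)); last by ring.
    lra.
  - move=> k j; rewrite ltnS leq_eqVlt => /orP[/eqP->|kn]; last exact: (state_step st).
    by rewrite mm'; have [] := m'r j.
  - move=> k j; rewrite ltnS leq_eqVlt => /orP[/eqP->|kn]; last exact: (state_rate st).
    by rewrite mm'; have [] := m'r j.
by exists m => n /main[].
Qed.
End Step.

(** * Selection of a convergent sequence of motions *)

(** The limit is the supremum of the values exceeded along the ultrafilter. *)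
Lemma ultra_lim (R : realType) (U : set_system nat) (f : nat -> R) (M : R) : UltraFilter U ->
  (forall n, `|f n| <= M) -> exists l, forall r, 0 < r -> U [set n | `|f n - l| < r].
Proof.
move=> UU fM; pose S := [set y : R | U [set n | y <= f n]].
have fb n : - M <= f n <= M by rewrite -ler_norml.
have S0 : S (- M).
  by apply: (@filterS _ _ _ setT) => [n _|]; [have /andP[] := fb n|exact: filterT].
have Sub : ubound S M.
  move=> y /= Sy; rewrite leNgt; apply/negP => My.
  have [n /= yn] := filter_ex Sy.
  by have /andP[_ +] := fb n; lra.
have supS : has_sup S by split; [exists (- M)|exists M].
exists (sup S) => r r0.
have [y Sy ry] := sup_adherent r0 supS.
have nS : ~ S (sup S + r / 2).
  by move=> /(ub_le_sup (proj2 supS)); lra.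
have U2 : U (~` [set n | sup S + r / 2 <= f n]).
  by have [] := in_ultra_setVsetC [set n | sup S + r / 2 <= f n] UU.
apply: filterS (filterI Sy U2) => n /= [h1 /negP]; rewrite -ltNge => h2.
by rewrite ltr_norml; apply/andP; split; lra.
Qed.

Section Helly.
Context {R : realType} {J : finType}.
Variables (X : nat -> J -> R -> R) (e : nat -> R) (T A B M : R).
Hypothesis T0 : 0 < T.
Hypothesis A0 : 0 <= A.
Hypothesis e_cvg : e n @[n --> \oo] --> (0 : R).
Hypothesis X_start : forall n j, `|X n j 0| <= M.
Hypothesis X_noninc : forall n j s t, 0 <= s -> s <= t -> t <= T -> X n j t <= X n j s.
Hypothesis X_lip : forall n j s t, 0 <= s -> s <= t -> t <= T ->
  X n j s - X n j t <= A * (t - s) + B * e n.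

Lemma e_bounded : exists E, forall n, `|B * e n| <= E.
Proof.
have [E [_ HE]] : bounded_fun e by apply: cvg_seq_bounded; apply/cvg_ex; exists 0.
have h n : `|e n| <= E + 1 by apply: (HE (E + 1)) => //; lra.
by exists (`|B| * (E + 1)) => n; rewrite normrM ler_wpM2l.
Qed.

(** The limits along an ultrafilter exist at every time and inherit the Lipschitz bound.
    By monotonicity, closeness on a fine finite net of times gives closeness at all times,
    so that the indices that are uniformly close to the limit belong to the ultrafilter. *)
Lemma helly_selection : exists (phi : nat -> nat) (s : J -> R -> R), forall p,
  `|e (phi p)| <= p.+1%:R^-1 /\
  forall j t, 0 <= t <= T -> `|X (phi p) j t - s j t| <= p.+1%:R^-1.
Proof.
have [U [UU Uoo]] := ultraFilterLemma (@eventually_filter).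
have [E HE] := e_bounded.
have /choice[s sP] (jt : J * R) : exists l, 0 <= jt.2 <= T ->
    forall r, 0 < r -> U [set n | `|X n jt.1 jt.2 - l| < r].
  case: jt => j t /=; have [/andP[t0 tT]|tn] := boolP (0 <= t <= T); last by exists 0.
  have [l lP] : exists l, forall r, 0 < r -> U [set n | `|X n j t - l| < r].
    apply: (@ultra_lim _ _ _ (M + (A * T + E))) => // n.
    have := X_start n j; have := HE n; have := X_noninc n j (lexx 0) t0 tT.
    have := X_lip n j (lexx 0) t0 tT; have : A * (t - 0) <= A * T by apply: ler_wpM2l => //; lra.
    by rewrite !ler_norml => h1 h2 h3 /andP[h4 h5] /andP[h6 h7]; apply/andP; split; lra.
  by exists l => _.
have Ue r : 0 < r -> U [set n | `|e n| < r].
  move=> r0; apply: Uoo; move/cvgrPdist_lt: e_cvg => /(_ _ r0).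
  by apply: filterS => n /=; rewrite sub0r normrN.
have slip j t u : 0 <= t -> t <= u -> u <= T ->
    s (j, u) <= s (j, t) /\ s (j, t) - s (j, u) <= A * (u - t).
  move=> t0 tu uT.
  have H r : 0 < r -> s (j, u) <= s (j, t) + r /\ s (j, t) - s (j, u) <= A * (u - t) + r.
    move=> r0; have r3 : 0 < r / 3 by lra.
    have r4 : 0 < r / 3 / (`|B| + 1) by rewrite divr_gt0// ltr_wpDl.
    have h1 := sP (j, t) (introT andP (conj t0 (le_trans tu uT))) _ r3.
    have h2 := sP (j, u) (introT andP (conj (le_trans t0 tu) uT)) _ r3.
    have [n /= [[n1 n2] n3]] := filter_ex (filterI (filterI h1 h2) (Ue _ r4)).
    have := X_noninc n j t0 tu uT; have := X_lip n j t0 tu uT.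
    have : B * e n <= r / 3.
      apply: le_trans (ler_norm _) _; rewrite normrM.
      apply: (@le_trans _ _ ((`|B| + 1) * `|e n|)); first by rewrite ler_wpM2r// lerDl.
      by rewrite mulrC -ler_pdivlMr ?ltr_wpDl// ltW.
    by move: n1 n2; rewrite !ltr_norml => /andP[? ?] /andP[? ?] ? ? ?; split; lra.
  by split; apply/ler_addgt0Pr => r /H[].
suff /choice[phi phiP] (p : nat) : exists n, `|e n| <= p.+1%:R^-1 /\
    forall j t, 0 <= t <= T -> `|X n j t - s (j, t)| <= p.+1%:R^-1.
  by exists phi, (fun j t => s (j, t)).
set r := p.+1%:R^-1; have r0 : 0 < r by rewrite invr_gt0.
(* a mesh on which the limit varies by at most [r / 2] *)
pose N := (Num.truncn (A * T / (r / 2))).+1.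
have NA : A * (T / N%:R) <= r / 2.
  have : A * T / (r / 2) < N%:R by exact: truncnS_gt.
  have n0 : 0 < N%:R :> R by [].
  by rewrite ltr_pdivrMr ?divr_gt0// mulrA ler_pdivrMr//; lra.
have N0 : 0 < N%:R :> R by [].
pose tt (i : nat) : R := T / N%:R * i%:R.
have tt_in i : (i <= N)%N -> 0 <= tt i <= T.
  move=> iN; rewrite /tt mulr_ge0 ?divr_ge0 ?(ltW T0)//=.
  by rewrite mulrAC ler_pdivrMr// ler_pM2l// ler_nat.
have net : U [set n | forall i, i \in iota 0 N.+1 -> forall j, j \in enum J ->
    `|X n j (tt i) - s (j, tt i)| < r / 2].
  apply: near_seq => i; rewrite mem_iota /= add0n ltnS => iN.
  by apply: near_seq => j _; apply: (sP (j, tt i)); [exact: tt_in|lra].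
have [n [n1 n2]] := filter_ex (filterI net (Ue _ r0)).
exists n; split; first exact: ltW.
move=> j t /andP[t0 tT].
have n1' i : (i <= N)%N -> `|X n j (tt i) - s (j, tt i)| < r / 2.
  by move=> iN; apply: n1; rewrite ?mem_iota ?mem_enum.
pose i := Num.truncn (t * N%:R / T).
have ti : tt i <= t < tt i.+1.
  have := truncn_itv (_ : 0 <= t * N%:R / T); rewrite -/i => /(_ _)/andP[].
    by rewrite !mulr_ge0 ?invr_ge0// ltW.
  rewrite ler_pdivlMr// ltr_pdivrMr// => h1 h2; apply/andP; split.
    by rewrite /tt mulrAC ler_pdivrMr// mulrC.
  by rewrite /tt mulrAC ltr_pdivlMr// [ltRHS]mulrC.
have /andP[ti1 ti2] := ti.
have iN : (i <= N)%N.
  rewrite -(ler_nat R) -(ler_pM2l (_ : 0 < T / N%:R)) ?divr_gt0//.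
  by apply: (le_trans ti1); rewrite divfK ?gt_eqF.
pose i' := minn i.+1 N.
have iN' : (i' <= N)%N by rewrite geq_minr.
have ti' : t <= tt i' /\ tt i' - tt i <= T / N%:R.
  rewrite /i'; have [h|h] := leqP i.+1 N.
    by split; [exact: ltW|rewrite /tt -mulrBr -natrB// subSnn mulr1].
  have -> : i = N by apply/eqP; rewrite eqn_leq iN -ltnS.
  by rewrite subrr divr_ge0 ?(ltW T0)// /tt divfK ?gt_eqF.
have [ti3 ti4] := ti'.
have /andP[a1 a2] := tt_in _ iN; have /andP[b1 b2] := tt_in _ iN'.
have := n1' _ iN; have := n1' _ iN'; rewrite !ltr_norml => /andP[? ?] /andP[? ?].
have := X_noninc n j a1 ti1 tT; have := X_noninc n j t0 ti3 b2.
have [s1 s2] := slip j _ _ a1 ti1 tT; have [s3 s4] := slip j _ _ t0 ti3 b2.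
have : A * (tt i' - tt i) <= A * (T / N%:R) by apply: ler_wpM2l.
have : A * (t - tt i) <= A * (tt i' - tt i) by apply: ler_wpM2l => //; lra.
have : A * (tt i' - t) <= A * (tt i' - tt i) by apply: ler_wpM2l => //; lra.
by move=> *; rewrite ler_norml; apply/andP; split; lra.
Qed.
End Helly.

(** * Properties of the limit motion *)

Lemma drop_steps (a : nat -> int) (lo hi : int) (k1 k2 : nat) : (k1 <= k2)%N ->
  (forall k, (k1 <= k < k2)%N -> lo <= a k - a k.+1 <= hi) ->
  lo * (k2%:Z - k1%:Z) <= a k1 - a k2 <= hi * (k2%:Z - k1%:Z).
Proof.
move=> /subnKC <-; elim: (k2 - k1)%N => [|n IH] H.
  by rewrite addn0 !subrr !mulr0 lexx.
have /andP[h1 h2] : lo * ((k1 + n)%N%:Z - k1%:Z) <= a k1 - a (k1 + n)%N <= hi * ((k1 + n)%N%:Z - k1%:Z).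
  by apply: IH => k kn; apply: H; lia.
have /andP[h3 h4] : lo <= a (k1 + n)%N - a (k1 + n).+1 <= hi by apply: H; lia.
have e : (k1 + n.+1)%N%:Z - k1%:Z = (k1 + n)%N%:Z - k1%:Z + 1 by lia.
rewrite e !mulrDr !mulr1 addnS; move: h1 h2 h3 h4; clear; lia.
Qed.

Section Limit.
Context {R : realType}.
Variables (gam : R) (h0 : 'Z_6 -> R) (K : nat) (c1 T : R).
Hypotheses (gam0 : 0 < gam) (c10 : 0 < c1) (T0 : 0 < T).

Definition clock (eps t : R) : nat := Num.truncn (t / (gam * eps)).

Lemma clock_le eps t : 0 < eps -> 0 <= t -> (clock eps t)%:R * (gam * eps) <= t.
Proof.
move=> eps0 t0; rewrite -ler_pdivlMr ?mulr_gt0//.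
by have := truncn_itv (_ : 0 <= t / (gam * eps)); case/(_ (divr_ge0 t0 (ltW (mulr_gt0 gam0 eps0))))/andP.
Qed.

Lemma clock_gt eps t : 0 < eps -> 0 <= t -> t < ((clock eps t)%:R + 1) * (gam * eps).
Proof.
move=> eps0 t0; rewrite -ltr_pdivrMr ?mulr_gt0// natr1.
by have := truncn_itv (_ : 0 <= t / (gam * eps)); case/(_ (divr_ge0 t0 (ltW (mulr_gt0 gam0 eps0))))/andP.
Qed.

Lemma clock_nat eps (k : nat) : 0 < eps -> clock eps (k%:R * (gam * eps)) = k.
Proof. by move=> eps0; rewrite /clock mulfK ?natrK// gt_eqF// mulr_gt0. Qed.

Lemma clock_mono eps s t : 0 < eps -> 0 <= s -> s <= t -> (clock eps s <= clock eps t)%N.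
Proof.
move=> eps0 s_ge0 st.
have := clock_le eps0 s_ge0; have := clock_gt eps0 (le_trans s_ge0 st) => h1 h2.
have : (clock eps s)%:R < (clock eps t)%:R + 1 :> R.
  by rewrite -(ltr_pM2r (mulr_gt0 gam0 eps0)); lra.
by rewrite natr1 ltr_nat ltnS.
Qed.

(** A side moving by between [lo] and [hi] rows per step has, up to one step, a speed
    between the corresponding multiples of [sqrt 3 / (2 gam)]. *)
Lemma drop_env eps (a : nat -> 'Z_6 -> int) j (lo hi : nat) s t : 0 < eps -> 0 <= s -> s <= t ->
  (forall k, (clock eps s <= k < clock eps t)%N -> lo%:Z <= a k j - a k.+1 j <= hi%:Z) ->
  s3 / 2 * lo%:R * ((t - s) / gam - eps) <= env eps (a (clock eps s)) j - env eps (a (clock eps t)) j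
    <= s3 / 2 * hi%:R * ((t - s) / gam + eps).
Proof.
move=> eps0 s_ge0 st H; have s30 := @s3_gt0 R.
have t_ge0 := le_trans s_ge0 st.
have kk := clock_mono eps0 s_ge0 st.
have /andP[] := drop_steps kk H.
have := clock_le eps0 s_ge0; have := clock_gt eps0 s_ge0.
have := clock_le eps0 t_ge0; have := clock_gt eps0 t_ge0.
rewrite -!(ler_int R) !intrM !intrB.
rewrite /env; move: (clock eps s) (clock eps t) kk {H} => k1 k2 kk.
move: (a k1 j) (a k2 j) => a1 a2; rewrite -!pmulrn => t1 t2 u1 u2.
have e : env eps = env eps by [].
rewrite -mulrBr opprD addrACA subrr addr0 -mulrBr.
move: (a1%:~R : R) (a2%:~R : R) => b1 b2 h1 h2.
have gE : forall x, x * (gam * eps) / gam = x * eps by move=> x; field; rewrite gt_eqF.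
have l1 : (t - s) / gam - eps <= eps * (k2%:R - k1%:R).
  have : (t - s) / gam <= ((k2%:R + 1) * (gam * eps) - k1%:R * (gam * eps)) / gam.
    by rewrite ler_pM2r ?invr_gt0//; lra.
  by rewrite -mulrBl gE; lra.
have l2 : eps * (k2%:R - k1%:R) <= (t - s) / gam + eps.
  have : (k2%:R * (gam * eps) - (k1%:R + 1) * (gam * eps)) / gam <= (t - s) / gam.
    by rewrite ler_pM2r ?invr_gt0//; lra.
  by rewrite -mulrBl gE; lra.
have s20 : 0 <= s3 / 2 :> R by lra.
have -> : eps * (s3 / 2 * (b1 - b2)) = s3 / 2 * (eps * (b1 - b2)) by ring.
rewrite -[s3 / 2 * lo%:R * _]mulrA -[s3 / 2 * hi%:R * _]mulrA; apply/andP; split; apply: ler_wpM2l => //.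
  apply: le_trans (ler_wpM2l (ltW eps0) h1); rewrite mulrCA.
  by apply: ler_wpM2l.
apply: (le_trans (ler_wpM2l (ltW eps0) h2)); rewrite mulrCA.
by apply: ler_wpM2l.
Qed.

Variables (s : 'Z_6 -> R -> R) (e : nat -> R) (D : nat -> nat -> set (R * R))
  (m : nat -> nat -> 'Z_6 -> int).
Variable dl : nat -> R.
Hypothesis dl1 : forall p, 0 <= dl p <= 1.
Hypothesis dl_small : forall C r : R, 0 < r -> exists P, forall p, (P <= p)%N -> C * dl p < r.
Hypothesis e0 : forall p, 0 < e p.
Hypothesis e_small : forall p, e p <= dl p.
Hypothesis st : forall p k, k%:R * (gam * e p) <= T -> state gam h0 K c1 (e p) (D p) k (m p).
Hypothesis close : forall p j t, 0 <= t <= T ->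
  `|env (e p) (m p (clock (e p) t)) j - s j t| <= dl p.

Let s30 : 0 < s3 :> R := s3_gt0.

Let st_clock p t : 0 <= t <= T -> state gam h0 K c1 (e p) (D p) (clock (e p) t) (m p).
Proof. by move=> /andP[t0 tT]; apply: st; apply: le_trans tT; exact: clock_le. Qed.

Lemma le_inv (a b C : R) (P : nat) :
  (forall p, (P <= p)%N -> a <= b + C * dl p) -> a <= b.
Proof.
move=> H; apply/ler_addgt0Pr => r r0; have [Q HQ] := dl_small C r0.
have := HQ _ (leq_maxr P Q); have := H _ (leq_maxl P Q).
lra.
Qed.

Lemma limit_start j : s j 0 = h0 j.
Proof.
have T00 : 0 <= (0 : R) <= T by rewrite lexx ltW.
have H p : `|s j 0 - h0 j| <= 0 + 2 * dl p.
  have := close p j T00; rewrite /clock mul0r truncn0.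
  have := state_start (st_clock p T00) j; have := e_small p.
  have := ler_distD (env (e p) (m p 0%N) j) (s j 0) (h0 j).
  by rewrite (distrC (s j 0) (env _ _ _)); lra.
have := le_inv (P := 0%N) (fun p _ => H p).
by rewrite normr_le0 subr_eq0 => /eqP.
Qed.

Lemma limit_sym j t : 0 <= t <= T -> s (j + 3) t = s j t.
Proof.
move=> tT; have H p : `|s (j + 3) t - s j t| <= 0 + 2 * dl p.
  have := close p j tT; have := close p (j + 3) tT.
  rewrite /env (state_sym (st_clock p tT) _ (leqnn _)) -/(env _ _ _).
  have := ler_distD (env (e p) (m p (clock (e p) t)) j) (s (j + 3) t) (s j t).
  by rewrite (distrC (s (j + 3) t) (env _ _ _)); lra.
have := le_inv (P := 0%N) (fun p _ => H p).
by rewrite normr_le0 subr_eq0 => /eqP.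
Qed.

(** The side of the envelope is shorter by [e p / 3] than [e p] times the number of its
    cells. *)
Lemma rlen_close p j t : 0 <= t <= T ->
  `|e p * (slen (m p (clock (e p) t)) j)%:~R - e p / 3 - 2 / s3 * rlen (s^~ t) j| <= 4 * dl p.
Proof.
move=> tT.
have -> : e p * (slen (m p (clock (e p) t)) j)%:~R - e p / 3 =
    2 / s3 * rlen (env (e p) (m p (clock (e p) t))) j.
  by rewrite rlen_env intrB; field; rewrite gt_eqF.
rewrite -mulrBr normrM ger0_norm ?divr_ge0 ?(ltW s30)//.
have h : `|rlen (env (e p) (m p (clock (e p) t))) j - rlen (s^~ t) j| <= 3 * dl p.
  have := close p j tT; have := close p (j - 1) tT; have := close p (j + 1) tT.
  rewrite /rlen !ler_norml => /andP[? ?] /andP[? ?] /andP[? ?].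
  by apply/andP; split; lra.
apply: (le_trans (ler_wpM2l _ h)); first by rewrite divr_ge0// ltW.
have /andP[d0 _] := dl1 p; move: (dl p) d0 => w w0.
rewrite mulrA ler_wpM2r// mulrAC ler_pdivrMr//.
by have := @s3_sq R; move: (s3 : R) s30 => r r0 q; nra.
Qed.

Lemma limit_rlen j t : 0 <= t <= T -> c1 <= 2 / s3 * rlen (s^~ t) j.
Proof.
move=> tT; apply: (@le_inv _ _ 5 0%N) => p _.
have := rlen_close p j tT; have := state_big (st_clock p tT) j (leqnn _).
by have := e_small p; have := e0 p => ? ? ? /ler_normlP[? ?]; lra.
Qed.

Lemma limit_rlen_gt0 j t : 0 <= t <= T -> 0 < rlen (s^~ t) j.
Proof.
move=> tT; have := lt_le_trans c10 (limit_rlen j tT).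
by rewrite pmulr_rgt0 ?divr_gt0.
Qed.

Let A : R := s3 / 2 * K%:R / gam.

Lemma env_drop p j t u : 0 <= t -> t <= u -> u <= T ->
  0 <= env (e p) (m p (clock (e p) t)) j - env (e p) (m p (clock (e p) u)) j
    <= A * (u - t) + s3 / 2 * K%:R * e p.
Proof.
move=> t0 tu uT; have uT' : 0 <= u <= T by rewrite (le_trans t0 tu).
have := @drop_env (e p) (m p) j 0%N K t u (e0 p) t0 tu.
have h k : (clock (e p) t <= k < clock (e p) u)%N -> 0%N%:Z <= m p k j - m p k.+1 j <= K%:Z.
  move=> /andP[_ ku]; have := state_step (st_clock p uT') j ku.
  by move: (m p k j) (m p k.+1 j); clear; lia.
move=> /(_ h)/andP[]; rewrite mulr0 mul0r => -> /= h1; apply: (le_trans h1).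
by rewrite /A mulrDr lerD2r mulrA mulrAC.
Qed.

Lemma limit_drop j t u : 0 <= t -> t <= u -> u <= T -> 0 <= s j t - s j u <= A * (u - t).
Proof.
move=> t0 tu uT; have tT : 0 <= t <= T by rewrite t0 (le_trans tu).
have uT' : 0 <= u <= T by rewrite (le_trans t0 tu).
have K0 : 0 <= s3 / 2 * K%:R :> R by rewrite mulr_ge0 ?divr_ge0 ?(ltW s30).
have H p : [/\ `|env (e p) (m p (clock (e p) t)) j - s j t| <= dl p,
   `|env (e p) (m p (clock (e p) u)) j - s j u| <= dl p,
   0 <= env (e p) (m p (clock (e p) t)) j - env (e p) (m p (clock (e p) u)) j <= A * (u - t) + s3 / 2 * K%:R * e p
   & s3 / 2 * K%:R * e p <= s3 / 2 * K%:R * dl p].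
  by split; [exact: close|exact: close|exact: env_drop|exact: ler_wpM2l].
apply/andP; split.
  apply: (@le_inv _ _ 2 0%N) => p _.
  by have [/ler_normlP[? ?] /ler_normlP[? ?] /andP[? ?] ?] := H p; lra.
apply: (@le_inv _ _ (2 + s3 / 2 * K%:R) 0%N) => p _.
by have [/ler_normlP[? ?] /ler_normlP[? ?] /andP[? ?] ?] := H p; lra.
Qed.

Lemma limit_lipschitz j t u : 0 <= t <= T -> 0 <= u <= T -> `|s j t - s j u| <= A * `|t - u|.
Proof.
move=> /andP[t0 tT] /andP[u0 uT]; have [tu|ut] := leP t u.
  have /andP[h1 h2] := limit_drop j t0 tu uT.
  by rewrite ger0_norm// distrC ger0_norm// subr_ge0.
have /andP[h1 h2] := limit_drop j u0 (ltW ut) tT.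
by rewrite distrC ger0_norm// ger0_norm// subr_ge0 ltW.
Qed.

Lemma rlen_lipschitz j t u : 0 <= t <= T -> 0 <= u <= T ->
  `|2 / s3 * rlen (s^~ t) j - 2 / s3 * rlen (s^~ u) j| <= 4 * A * `|t - u|.
Proof.
move=> tT uT; rewrite -mulrBr normrM ger0_norm ?divr_ge0 ?(ltW s30)//.
have h : `|rlen (s^~ t) j - rlen (s^~ u) j| <= 3 * (A * `|t - u|).
  have := limit_lipschitz j tT uT; have := limit_lipschitz (j - 1) tT uT.
  have := limit_lipschitz (j + 1) tT uT; rewrite /rlen.
  move: (A * _) => w /ler_normlP[? ?] /ler_normlP[? ?] /ler_normlP[? ?].
  by rewrite ler_norml; apply/andP; split; lra.
have A0 : 0 <= A * `|t - u| by rewrite mulr_ge0// /A !mulr_ge0 ?invr_ge0 ?(ltW s30) ?(ltW gam0).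
apply: (le_trans (ler_wpM2l _ h)); first by rewrite divr_ge0// ltW.
rewrite -[4 * A * _]mulrA; move: (A * _) A0 => w w0.
rewrite mulrA ler_wpM2r// mulrAC ler_pdivrMr//.
by have := @s3_sq R; move: (s3 : R) s30 => r r0 q; nra.
Qed.

(** Rescaled, the two inequalities of [minimal_rate] say that
    [d * L <= alpha_hex * gam <= (d + 1) * L] up to errors of order [rho]. *)
Lemma rate_window (eps L rho : R) (d S : int) (lo hi : nat) : let lam := 9 * eps / (8 * gam) in
  0 < eps -> eps <= rho -> `|eps * S%:~R - L| <= rho -> 0 <= d -> 1 <= S ->
  alpha_hex R * gam < (hi%:R + 1) * (L - (2 * K%:R + 1) * rho) ->
  lo%:R * (L + (K%:R + 1) * rho) < alpha_hex R * gam ->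
  lam * (d%:~R * (S - 2 * K%:Z)%:~R) <= 2 -> 2 <= lam * ((d + 1)%:~R * (S + K%:Z)%:~R) ->
  lo%:Z <= d <= hi%:Z.
Proof.
move=> lam eps0 er /ler_normlP[SL1 SL2] d0 S1 Hhi Hlo r1 r2.
have ag0 : 0 < alpha_hex R * gam by rewrite mulr_gt0// /alpha_hex divr_gt0.
have K0 : 0 <= K%:R :> R by rewrite ler0n.
have Ke : K%:R * eps <= K%:R * rho by apply: ler_wpM2l.
have lamE (x y : R) : lam * (x * y) = 2 / (alpha_hex R * gam) * (x * (eps * y)).
  by rewrite /lam /alpha_hex; field; rewrite gt_eqF.
move: r1 r2; rewrite !lamE.
rewrite -[X in X <= 2]mulrAC -[X in 2 <= X]mulrAC ler_pdivrMr// ler_pdivlMr// !ler_pM2l// => r1 r2.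
rewrite intrB intrM in r1; rewrite !intrD in r2.
have d0' : 0 <= d%:~R :> R by rewrite ler0z.
have S1' : 1 <= S%:~R :> R by rewrite ler1z.
have w0 : 0 < L - (2 * K%:R + 1) * rho.
  by move: (lt_trans ag0 Hhi); rewrite pmulr_rgt0// ltr_wpDl.
apply/andP; split.
  rewrite leNgt; apply/negP => dlo.
  have : d%:~R + 1 <= lo%:R :> R.
    by rewrite -[1]/(1%:~R) -intrD (_ : lo%:R = lo%:Z%:~R)// ler_int; move: dlo; clear; lia.
  move=> dlt; have h : eps * (S%:~R + K%:R) <= L + (K%:R + 1) * rho by rewrite mulrDr; lra.
  have h' : 0 <= eps * (S%:~R + K%:R) by rewrite mulr_ge0 ?(ltW eps0)//; lra.
  have : (d%:~R + 1) * (eps * (S%:~R + K%:R)) <= lo%:R * (L + (K%:R + 1) * rho).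
    by apply: ler_pM => //; lra.
  by rewrite -pmulrn in r2; lra.
rewrite leNgt; apply/negP => dhi.
have dlt : hi%:R + 1 <= d%:~R :> R.
  by rewrite -[1]/(1%:~R) (_ : hi%:R = hi%:Z%:~R)// -intrD ler_int; move: dhi; clear; lia.
have h : L - (2 * K%:R + 1) * rho <= eps * (S%:~R - 2 * K%:R) by rewrite mulrBr; lra.
have : (hi%:R + 1) * (L - (2 * K%:R + 1) * rho) <= d%:~R * (eps * (S%:~R - 2 * K%:R)).
  by apply: ler_pM => //; rewrite ?ltW// ltr_wpDl.
by rewrite -pmulrn in r1; lra.
Qed.

(** For small steps and times close to [t], all lengths are close to [L], and
    [rate_window] applies to every step. *)
Lemma limit_speed j t (lo hi : nat) (L := 2 / s3 * rlen (s^~ t) j) : 0 <= t <= T ->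
  lo%:R * L < alpha_hex R * gam -> alpha_hex R * gam < (hi%:R + 1) * L ->
  exists2 eta : R, 0 < eta & forall u w, 0 <= u -> u <= w -> w <= T ->
    `|u - t| <= eta -> `|w - t| <= eta ->
    s3 / 2 * lo%:R / gam * (w - u) <= s j u - s j w <= s3 / 2 * hi%:R / gam * (w - u).
Proof.
move=> tT Hlo Hhi.
have A0 : 0 <= A by rewrite /A !mulr_ge0 ?invr_ge0 ?(ltW s30) ?(ltW gam0).
have [rho rho0 [rlo rhi]] : exists2 rho : R, 0 < rho &
   lo%:R * (L + (K%:R + 1) * rho) < alpha_hex R * gam /\
   alpha_hex R * gam < (hi%:R + 1) * (L - (2 * K%:R + 1) * rho).
  pose x1 := alpha_hex R * gam - lo%:R * L; pose x2 := (hi%:R + 1) * L - alpha_hex R * gam.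
  have x10 : 0 < x1 by rewrite subr_gt0.
  have x20 : 0 < x2 by rewrite subr_gt0.
  pose y1 : R := (lo%:R + 1) * (K%:R + 1); pose y2 : R := (hi%:R + 1) * (2 * K%:R + 1).
  have y10 : 0 < y1 by rewrite mulr_gt0// ltr_wpDl.
  have y20 : 0 < y2 by rewrite mulr_gt0// ltr_wpDl ?mulr_ge0.
  exists (Num.min (x1 / (2 * y1)) (x2 / (2 * y2))); first by rewrite lt_min !divr_gt0// mulr_gt0.
  set rho := Num.min _ _.
  have r1 : rho * (2 * y1) <= x1 by rewrite -ler_pdivlMr ?mulr_gt0// ge_min lexx.
  have r2 : rho * (2 * y2) <= x2 by rewrite -ler_pdivlMr ?mulr_gt0// ge_min lexx orbT.
  have rho0 : 0 < rho by rewrite lt_min !divr_gt0// mulr_gt0.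
  have K0 : 0 <= (K%:R + 1) * rho by rewrite mulr_ge0 ?addr_ge0 ?(ltW rho0).
  split.
    have : lo%:R * ((K%:R + 1) * rho) <= y1 * rho by rewrite /y1 -mulrA ler_wpM2r// lerDl.
    by rewrite mulrDr; move: r1 x10; rewrite /x1; lra.
  have : (hi%:R + 1) * ((2 * K%:R + 1) * rho) = y2 * rho by rewrite mulrA.
  by rewrite mulrBr; move: r2 x20; rewrite /x2; lra.
have r8 : 0 < rho / 8 by lra.
have A41 : 0 < 4 * A + 1 by rewrite ltr_wpDl// mulr_ge0.
have [P HP] := dl_small (5 + 4 * A * gam) r8.
exists (rho / 8 / (4 * A + 1)); first by rewrite divr_gt0.
move=> u w u0 uw wT ut wt.
have uT : 0 <= u <= T by rewrite u0 (le_trans uw).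
have wT' : 0 <= w <= T by rewrite (le_trans u0 uw).
have eta4 (x : R) : `|x| <= rho / 8 / (4 * A + 1) -> 4 * A * `|x| <= rho / 8.
  rewrite ler_pdivlMr// => h; apply: le_trans h.
  by rewrite mulrC ler_wpM2l// lerDl.
have main p : (P <= p)%N -> forall k, (clock (e p) u <= k < clock (e p) w)%N ->
    lo%:Z <= m p k j - m p k.+1 j <= hi%:Z.
  move=> /HP hp k /andP[k1 k2]; pose x := k%:R * (gam * e p).
  have ge : 0 < gam * e p by rewrite mulr_gt0.
  have xw : x <= w.
    apply: (le_trans _ (clock_le (e0 p) (le_trans u0 uw))).
    by rewrite ler_pM2r// ler_nat ltnW.
  have xu : u - gam * e p <= x.
    have := clock_gt (e0 p) u0; have : (clock (e p) u)%:R * (gam * e p) <= x by rewrite ler_pM2r// ler_nat.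
    by rewrite mulrDl mul1r; lra.
  have xT : 0 <= x <= T by rewrite mulr_ge0 ?(ltW ge)//= (le_trans xw).
  have xt : 4 * A * `|x - t| <= rho / 8 + 4 * A * gam * dl p.
    have h1 := eta4 _ ut; have h2 := eta4 _ wt.
    have h3 : `|x - t| <= Num.max `|u - t| `|w - t| + gam * e p.
      have m1 : `|u - t| <= Num.max `|u - t| `|w - t| by rewrite le_max lexx.
      have m2 : `|w - t| <= Num.max `|u - t| `|w - t| by rewrite le_max lexx orbT.
      move: m1 m2; rewrite !ler_norml => /andP[? ?] /andP[? ?]; apply/andP; split; lra.
    have A4 : 0 <= 4 * A by rewrite mulr_ge0.
    apply: (le_trans (ler_wpM2l A4 h3)); rewrite mulrDr; apply: lerD.
      by rewrite maxr_pMr// ge_max h1 h2.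
    rewrite -[leRHS]mulrA; apply: ler_wpM2l => //; apply: ler_wpM2l; first exact: ltW.
    exact: e_small.
  have stp := st_clock p xT; have stw := st_clock p wT'.
  have rc := rlen_close p j xT; rewrite /x clock_nat// -/x in rc stp.
  have rl := rlen_lipschitz j xT tT; rewrite -/L in rl.
  have [r1 r2] := state_rate stw j k2.
  apply: (@rate_window (e p) L rho _ (slen (m p k) j)) r1 r2 => //.
  - have := e_small p; move: hp; rewrite mulrDl; have /andP[d0 _] := dl1 p.
    have : 0 <= 4 * A * gam * dl p by rewrite mulr_ge0// mulr_ge0 ?(ltW gam0)// mulr_ge0.
    lra.
  - have := e_small p; have := e0 p; move: hp xt rc rl; rewrite mulrDl.
    move: (4 * A * gam * _) (4 * A * `|x - t|) (rlen (s^~ x) j) => y z l hp xt /ler_normlP[? ?] /ler_normlP[? ?] ? ?.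
    by rewrite ler_norml; apply/andP; split; lra.
  - by have := state_step stw j k2; move: (m p k j) (m p k.+1 j); clear; lia.
  - exact: (state_len stw j (ltnW k2)).
have C0 (n : nat) : 0 <= s3 / 2 * n%:R :> R by rewrite mulr_ge0 ?divr_ge0 ?(ltW s30).
have H p : (P <= p)%N -> [/\ `|env (e p) (m p (clock (e p) u)) j - s j u| <= dl p,
   `|env (e p) (m p (clock (e p) w)) j - s j w| <= dl p,
   s3 / 2 * lo%:R / gam * (w - u) - s3 / 2 * lo%:R * e p <=
     env (e p) (m p (clock (e p) u)) j - env (e p) (m p (clock (e p) w)) j
     <= s3 / 2 * hi%:R / gam * (w - u) + s3 / 2 * hi%:R * e p,
   s3 / 2 * lo%:R * e p <= s3 / 2 * lo%:R * dl p
   & s3 / 2 * hi%:R * e p <= s3 / 2 * hi%:R * dl p].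
  move=> Pp; split; [exact: close|exact: close| |exact: ler_wpM2l|exact: ler_wpM2l].
  have := drop_env (e0 p) u0 uw (main p Pp).
  by rewrite mulrBr mulrDr !mulrA ![_ / gam * (w - u)]mulrAC.
apply/andP; split.
  apply: (@le_inv _ _ (2 + s3 / 2 * lo%:R) P) => p /H[/ler_normlP[? ?] /ler_normlP[? ?] /andP[? ?] ? ?].
  lra.
apply: (@le_inv _ _ (2 + s3 / 2 * hi%:R) P) => p /H[/ler_normlP[? ?] /ler_normlP[? ?] /andP[? ?] ? ?].
lra.
Qed.

Lemma limit_hausdorff (r : R) : 0 < r -> exists P, forall p, (P <= p)%N -> forall t, 0 <= t <= T ->
  discrete_hexagon (e p) (D p (clock (e p) t)) /\
  exists2 W, wulff_envelope (D p (clock (e p) t)) W &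
    (hausdorff_dist W (hexagon (s^~ t)) < r%:E)%E.
Proof.
move=> r0.
pose c := s3 / 2 * c1 / 2; pose M := \sum_(j : 'Z_6) `|h0 j| + 1.
have c0 : 0 < c by rewrite !divr_gt0// mulr_gt0// divr_gt0.
have M0 : 0 < M by rewrite ltr_wpDl// sumr_ge0.
have h0M j : h0 j <= M - 1.
  by rewrite /M addrK (bigD1 j)//=; apply: (le_trans (ler_norm _)); rewrite lerDl sumr_ge0.
have [P1 HP1] := dl_small 1 c0.
have [P2 HP2] := dl_small (24 * M / c) r0.
have sM j t : 0 <= t <= T -> 2 * c <= s j t <= M - 1.
  move=> /[dup] tT /andP[t0 tT']; apply/andP; split; last first.
    by have /andP[+ _] := limit_drop j (lexx 0) t0 tT'; rewrite limit_start; have := h0M j; lra.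
  have h2 i : 2 * c <= rlen (s^~ t) i.
    have := limit_rlen i tT; rewrite mulrAC ler_pdivlMr// /c; lra.
  have := h2 (j + 1); have := h2 (j + 2); rewrite /rlen !(Z6E j) (limit_sym j tT).
  lra.
exists (maxn P1 P2) => p; rewrite geq_max => /andP[/HP1 p1 /HP2 p2] t tT.
have stp := st_clock p tT; set k := clock (e p) t in stp *.
have ml j : 1 <= slen (m p k) j := state_len stp j (leqnn _).
rewrite (state_reg stp (leqnn _)); split; first exact: reg_discrete_hexagon.
exists (hexagon (env (e p) (m p k))); first exact: env_envelope.
rewrite mul1r in p1.
have /andP[_ p3] := dl1 p.
apply: (@le_lt_trans _ _ (24 * M / c * dl p)%:E); last by rewrite lte_fin.
apply: hausdorff_hexagon_le => //; first exact: ltW.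
- by move=> j; have := close p j tT; have := sM j t tT; rewrite -/k ler_norml => /andP[? ?] /andP[? ?]; apply/andP; split; lra.
- by move=> j; have /andP[? ?] := sM j t tT; apply/andP; split; lra.
- by move=> j; exact: close.
Qed.
End Limit.

(** * Lipschitz monotone functions are almost everywhere differentiable *)

Section Stieltjes.
Context {R : realType}.
Variables (g : R -> R) (K : R).
Hypothesis g_nd : forall x y, x <= y -> g x <= g y.
Hypothesis g_lip : forall x y, x <= y -> g y - g x <= K * (y - x).

Let g_norm x y : `|g x - g y| <= K * `|x - y|.
Proof.
have [xy|xy] := leP x y.
  rewrite distrC ger0_norm ?subr_ge0 ?g_nd// distrC ger0_norm ?subr_ge0//.
  exact: g_lip.
rewrite !ger0_norm ?subr_ge0 ?g_nd ?(ltW xy)//; exact/g_lip/ltW.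
Qed.

Let g_cont : continuous g.
Proof.
move=> x; apply/cvgrPdist_lt => e e0; near=> y.
apply: (le_lt_trans (g_norm _ _)).
have K1 : 0 < `|K| + 1 by rewrite ltr_pwDr.
apply: (@le_lt_trans _ _ ((`|K| + 1) * `|x - y|)).
  by rewrite ler_wpM2r// (le_trans (ler_norm _))// lerDl.
rewrite -ltr_pdivlMl// mulrC; near: y.
by apply: cvgr_dist_lt => //; rewrite divr_gt0.
Unshelve. all: by end_near. Qed.

Let g_nd' : nondecreasing g. Proof. by move=> x y; exact: g_nd. Qed.
Let g_rc : right_continuous g.
Proof. by move=> x; apply: cvg_at_right_filter; exact: g_cont. Qed.

(** A copy of [g] that carries the structure of a cumulative function. *)
Definition cumulative_g : R -> R := g.
HB.instance Definition _ := isCumulative.Build R _ R cumulative_g g_nd' g_rc.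

Let nu : {measure set (measurableTypeR R) -> \bar R} := lebesgue_stieltjes_measure cumulative_g.

Lemma stieltjes_itv a b : a <= b -> nu `]a, b]%classic = (g b - g a)%:E.
Proof.
move=> ab; rewrite /nu/= /lebesgue_stieltjes_measure /measure_extension/=.
rewrite measurable_mu_extE//=; last exact: is_ocitv.
by rewrite wlength_itv_bnd.
Qed.

Hypothesis K0 : 0 < K.

(** The Lipschitz bound carries over from intervals to all sets, by covering. *)
Lemma stieltjes_le A : (nu A <= K%:E * lebesgue_measure A)%E.
Proof.
rewrite /nu/= /lebesgue_measure /lebesgue_stieltjes_measure /measure_extension/=.
rewrite /mu_ext -ereal_inf_pZl//.
apply: le_ereal_inf_tmp => _ [_ [F [mF AF] <-] <-].
apply: ereal_inf_le => /=.
exists (\sum_(k <oo) wlength cumulative_g (F k))%E; first by exists F.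
rewrite -nneseriesZl; last by move=> n _; exact: wlength_ge0.
apply: lee_nneseries; first by move=> n _ _; exact: wlength_ge0.
move=> n _; have /ocitvP[->|[[a b] /= ab ->]] := mF n.
  by rewrite !wlength0 mule0.
by have ab' := ltW ab; rewrite !wlength_itv_bnd//= -EFinM lee_fin g_lip.
Qed.

(** The Stieltjes measure of [g] is absolutely continuous with respect to the
    Lebesgue measure, so that [g] is the integral of its Radon-Nikodym derivative. *)
Lemma lipschitz_ae_derivable (T : R) :
  {ae (@lebesgue_measure R), forall t, 0 < t < T -> derivable g t (1:R)}.
Proof.
pose D : set (measurableTypeR R) := `]0, T]%classic.
have mD : measurable D by exact: measurable_itv.
have [T0|T0] := ltP T 0.
  by apply: aeW => t /andP[/ltW ? /lt_trans/(_ T0)]; rewrite ltNge => /negP.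
have nuD : (nu D < +oo)%E by rewrite stieltjes_itv// ltry.
pose nuD' : {finite_measure set _ -> \bar R} := mfrestr mD nuD.
have dom : nuD' `<< @lebesgue_measure R.
  apply/null_content_dominatesP => A mA A0; apply/eqP; rewrite eq_le measure_ge0 andbT.
  rewrite /nuD'/= /mfrestr /mrestr.
  apply: (le_trans (stieltjes_le _)); rewrite -(mule0 K%:E).
  rewrite lee_wpmul2l ?lee_fin ?(ltW K0)// -A0.
  by apply: le_measure => //; apply/mem_set => //; exact: measurableI.
have [f [f0 ffin intf nuE]] := radon_nikodym_sigma_finite dom.
have intfi A : measurable A -> (@lebesgue_measure R).-integrable A (EFin \o (fine \o f)).
  move=> mA; rewrite (_ : _ \o _ = f); first exact: integrableS intf.
  by apply/funext => x /=; rewrite fineK.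
have intft := intfi _ measurableT.
have locf := open_integrable_locally openT intft.
have /= := @FTC1 R (fine \o f) (BRight 0) (fun y => intfi _ (measurable_itv _)) locf.
apply: (@filterS _ _ (ae_filter_ringOfSetsType (@lebesgue_measure R))).
move=> t + /andP[t0 tT] => /(_ t0)[dF _].
have : derivable (fun y : R => \int[@lebesgue_measure R]_(u in [set` `]0%R, y]]) (fine \o f) u + g 0) t 1.
  exact: derivableD.
apply: near_eq_derivable; near=> y.
have y0 : 0 < y by near: y; exact: lt_nbhsr.
have yT : y < T by near: y; exact: lt_nbhsl.
rewrite /Rintegral (eq_integral f); last by move=> x _ /=; rewrite fineK.
rewrite -nuE; last exact: measurable_itv.
rewrite /nuD'/= /mfrestr /mrestr setIidl; last first.
  by move=> x; rewrite /D/= !in_itv/= => /andP[x0 xy]; rewrite x0 (le_trans xy)// ltW.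
by rewrite stieltjes_itv ?ltW//= subrK.
Unshelve. all: by end_near. Qed.
End Stieltjes.

(** * The velocity law *)

Lemma inv_small (R : realType) (C r : R) : 0 < r ->
  exists P, forall p, (P <= p)%N -> C * p.+1%:R^-1 < r.
Proof.
move=> r0; exists (Num.truncn (C / r)) => p Pp.
rewrite ltr_pdivrMr// mulrC -ltr_pdivrMr//; apply: (lt_le_trans (truncnS_gt _)).
by rewrite ler_nat.
Qed.

(** Compare the parities of the 2-adic valuations of [a ^ 2] and [2 * b ^ 2]. *)
Lemma sqrt2_irrational (R : realType) (a b : int) :
  a%:~R + Num.sqrt 2 * b%:~R = 0 :> R -> b = 0.
Proof.
move=> /eqP; rewrite addr_eq0 => /eqP ab.
have : a ^+ 2 = 2 * b ^+ 2.
  have e2 : (2 : int)%:~R = 2 :> R by rewrite (_ : (2 : int) = 2%N%:Z)// -pmulrn.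
  by apply: (@intr_inj R); rewrite !expr2 !intrM e2 ab mulrNN mulrACA -(expr2 (Num.sqrt _)) sqr_sqrtr ?ler0n.
move=> /(congr1 absz); rewrite abszM !abszX => h.
apply/eqP; rewrite -absz_eq0 -leqn0 leqNgt; apply/negP => b0.
have a0 : (0 < absz a)%N.
  by rewrite lt0n; apply: contraTneq b0 => a0; move: h; rewrite a0; case: (absz b) => // n; rewrite expnS; lia.
have := congr1 (logn 2) h; rewrite lognM ?expn_gt0 ?b0// !lognX (_ : logn 2 `|2| = 1%N)//.
by move: (logn 2 _) (logn 2 _) => x y; lia.
Qed.

Lemma irrational_scales (R : realType) (gam e0 : R) : 0 < gam -> 0 < e0 ->
  exists e : nat -> R, [/\ forall n, 0 < e n, forall n, e n <= e0,
    forall n, irrational_ratio (9 * e n / (8 * gam)) & e n @[n --> \oo] --> (0 : R)].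
Proof.
move=> gam0 e00; pose c : R := 8 * gam / 9 * Num.sqrt 2.
have c0 : 0 < c by rewrite mulr_gt0 ?divr_gt0 ?mulr_gt0 ?sqrtr_gt0.
have [N HN] := inv_small c e00.
exists (fun n => c * (n + N).+1%:R^-1); split=> [n|n|n a b|].
- by rewrite divr_gt0.
- by rewrite ltW// HN// leq_addl.
- rewrite (_ : 9 * (c * (n + N).+1%:R^-1) / (8 * gam) = Num.sqrt 2 / (n + N).+1%:R); last first.
    by rewrite /c; field; rewrite !gt_eqF// addrC natr1.
  move=> h; apply: (@sqrt2_irrational R (a * (n + N).+1%:Z)).
  have n0 : (n + N).+1%:R != 0 :> R by [].
  rewrite intrM -pmulrn; move: ((n + N).+1%:R : R) h n0 => x h x0.
  by rewrite -[RHS](mul0r x) -h mulrDl; congr (_ + _); field.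
apply/cvgrPdist_lt => r r0; have [P HP] := inv_small c r0.
exists P => // n /= Pn; rewrite sub0r normrN ger0_norm ?divr_ge0 ?(ltW c0)//.
by apply: HP; rewrite (leq_trans Pn)// leq_addr.
Qed.

Lemma derive_window (R : realType) (f : R -> R) (t eta a b : R) : 0 < eta -> derivable f t 1 ->
  (forall u w, u <= w -> `|u - t| <= eta -> `|w - t| <= eta ->
     a * (w - u) <= f u - f w <= b * (w - u)) ->
  a <= - derive1 f t <= b.
Proof.
move=> eta0 df H.
have key h : h != 0 -> `|h| <= eta -> - b <= h^-1 * (f (h + t) - f t) <= - a.
  move=> h0 he; have tt : `|t - t| <= eta by rewrite subrr normr0 ltW.
  have ht : `|h + t - t| <= eta by rewrite addrK.
  have [hp|hn] := ltP 0 h.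
    have := H _ _ (_ : t <= h + t) tt ht; rewrite lerDr => /(_ (ltW hp)).
    rewrite addrK => /andP[h1 h2]; rewrite mulrC ler_pdivlMr// ler_pdivrMr//.
    by apply/andP; split; lra.
  have hn' : h < 0 by rewrite lt_neqAle h0.
  have := H _ _ (_ : h + t <= t) ht tt; rewrite gerDr => /(_ hn).
  rewrite opprD addrCA subrr addr0 => /andP[h1 h2]; rewrite mulrC ler_ndivlMr// ler_ndivrMr//.
  by apply/andP; split; lra.
have cv : cvg (h^-1 *: (f (h + t) - f t) @[h --> (0 : R)^']).
  have e : (fun h : R => h^-1 *: ((f \o shift t) (h *: 1) - f t)) =
      (fun h => h^-1 *: (f (h + t) - f t)).
    by apply/funext => h /=; rewrite [h *: 1]mulr1.
  by have := df; rewrite /derivable e.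
have near_key : \forall h \near (0 : R)^', - b <= h^-1 *: (f (h + t) - f t) <= - a.
  near=> h; apply: key.
    by near: h; exact: nbhs_dnbhs_neq.
  by near: h; apply: dnbhs0_le.
have h1 : derive1 f t <= - a.
  by apply: limr_le => //; near=> h; have /andP[] : - b <= h^-1 *: (f (h + t) - f t) <= - a by near: h.
have h2 : - b <= derive1 f t.
  by apply: limr_ge => //; near=> h; have /andP[] : - b <= h^-1 *: (f (h + t) - f t) <= - a by near: h.
by move: (derive1 f t) h1 h2 => l h1 h2; apply/andP; split; lra.
Unshelve. all: by end_near. Qed.

(** When the quotient is an integer [n], the window is [n - 1], [n]. *)
Lemma velocity_law_window (R : realType) (gam L v : R) : 0 < gam -> 0 < L ->
  (forall lo hi : nat, lo%:R * L < alpha_hex R * gam -> alpha_hex R * gam < (hi%:R + 1) * L ->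
     s3 / 2 * lo%:R / gam <= v <= s3 / 2 * hi%:R / gam) ->
  velocity_law gam L v.
Proof.
move=> gam0 L0 H; rewrite /velocity_law; set q := _ / L.
have ag0 : 0 < alpha_hex R * gam by rewrite mulr_gt0// /alpha_hex divr_gt0.
have q0 : 0 < q by rewrite divr_gt0.
have qL : q * L = alpha_hex R * gam by rewrite divfK// gt_eqF.
split=> [qN|/natrP[n qn]].
  have /andP[f1 f2] := truncn_itv (ltW q0).
  have fl : (Num.floor q)%:~R = (Num.truncn q)%:R :> R.
    suff -> : Num.floor q = (Num.truncn q)%:Z by [].
    by apply: floor_def; rewrite intrD mulr1z -pmulrn natr1 f1 f2.
  have lt : (Num.truncn q)%:R < q.
    by rewrite lt_neqAle f1 andbT; apply: contraNneq qN => <-; exact: natr_nat.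
  have := H (Num.truncn q) (Num.truncn q); rewrite -qL !ltr_pM2r// natr1 => /(_ lt f2).
  rewrite fl => /andP[h1 h2]; apply/eqP; rewrite eq_le.
  by rewrite [gam^-1 * _]mulrC mulrA h1 h2.
have n0 : (0 < n)%N by rewrite -(ltr_nat R) -qn.
have := H n.-1 n; rewrite -qL qn !ltr_pM2r// ltr_nat prednK// leqnn ltrDl ltr01 => /(_ isT isT).
have -> : n.-1%:R = n%:R - 1 :> R by rewrite -[in RHS](prednK n0) -natr1 addrK.
have -> : alpha_hex R / L = gam^-1 * n%:R.
  by rewrite -qn /q; field; rewrite !gt_eqF.
by rewrite [gam^-1 * _]mulrC [gam^-1 * n%:R]mulrC !mulrA.
Qed.

Section Motion.
Context {R : realType}.
Variables (gam T A : R) (s : 'Z_6 -> R -> R).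
Hypotheses (gam0 : 0 < gam) (T0 : 0 < T).
Hypothesis s_sym : forall j t, 0 <= t <= T -> s (j + 3) t = s j t.
Hypothesis s_len : forall j t, 0 <= t <= T -> 0 < rlen (s^~ t) j.
Hypothesis s_drop : forall j t u, 0 <= t -> t <= u -> u <= T -> 0 <= s j t - s j u <= A * (u - t).
Hypothesis s_speed : forall j t (lo hi : nat), let L := 2 / s3 * rlen (s^~ t) j in 0 <= t <= T ->
  lo%:R * L < alpha_hex R * gam -> alpha_hex R * gam < (hi%:R + 1) * L ->
  exists2 eta : R, 0 < eta & forall u w, 0 <= u -> u <= w -> w <= T ->
    `|u - t| <= eta -> `|w - t| <= eta ->
    s3 / 2 * lo%:R / gam * (w - u) <= s j u - s j w <= s3 / 2 * hi%:R / gam * (w - u).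

Definition side i t : set (R * R) := segment (vertex (s^~ t) (i - 1)) (vertex (s^~ t) i).

(** At the times without derivative any value allowed by the law will do. *)
Definition speed i t : R :=
  if pselect (0 < t /\ derivable (s i) t 1) then - derive1 (s i) t
  else s3 / 2 * (gam^-1 * (Num.floor (alpha_hex R * gam / (2 / s3 * rlen (s^~ t) i)))%:~R).

Let s_pos j t : 0 <= t <= T -> 0 < s j t.
Proof.
by move=> tT; have := rlen_pos_width j (fun i => s_len i tT); rewrite s_sym//; lra.
Qed.

Lemma side_distE i t : 0 <= t <= T -> side_dist (nrm R i) (side i t) = s i t.
Proof.
by move=> tT; rewrite (side_dist_vertex (h := s^~ t))// => [k|]; [exact: s_len|exact/ltW/s_pos].
Qed.

Lemma side_lengthE i t : 0 <= t <= T -> side_length (side i t) = 2 / s3 * rlen (s^~ t) i.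
Proof. by move=> tT; rewrite side_length_vertex// => k; exact: s_len. Qed.

Lemma speed_law i t : 0 <= t < T -> velocity_law gam (side_length (side i t)) (speed i t).
Proof.
move=> /andP[t0 tT]; have tT' : 0 <= t <= T by rewrite t0 ltW.
have L0 : 0 < 2 / s3 * rlen (s^~ t) i by rewrite mulr_gt0 ?divr_gt0 ?s3_gt0 ?s_len.
rewrite side_lengthE// /speed; case: pselect => /= [[tp dt]|_]; last first.
  split=> // /natrP[n qn].
  have fl : Num.floor (n%:R : R) = n%:Z by rewrite -[n%:R]/(n%:Z%:~R) intrKfloor.
  rewrite qn fl -pmulrn.
  have -> : alpha_hex R / (2 / s3 * rlen (s^~ t) i) = gam^-1 * n%:R.
    by rewrite -qn; move: L0; move: (2 / s3 * _) => L L0; field; rewrite !gt_eqF.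
  rewrite lexx andbT !ler_wpM2l ?invr_ge0 ?divr_ge0 ?sqrtr_ge0 ?(ltW gam0)//.
  by rewrite gerBl.
apply: velocity_law_window => // lo hi h1 h2.
have [eta eta0 H] := s_speed tT' h1 h2.
apply: (@derive_window _ _ _ (Num.min eta (Num.min t (T - t)))) => //.
  by rewrite !lt_min eta0 tp subr_gt0 tT.
move=> u w uw; rewrite !le_min => /and3P[u1 u2 u3] /and3P[w1 w2 w3].
apply: H => //.
  by move: u2; rewrite ler_norml => /andP[? _]; lra.
by move: w3; rewrite ler_norml => /andP[_ ?]; lra.
Qed.

(** The positions are extended by constants beyond [0] and [T] to be monotone and
    Lipschitz on the whole line. *)
Lemma ae_derivable i : {ae (@lebesgue_measure R), forall t : R, 0 <= t < T ->
  0 < t /\ derivable (s i) t 1}.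
Proof.
pose cl (t : R) := Num.max 0 (Num.min t T).
have clT t : 0 <= cl t <= T by rewrite le_max lexx /= ge_max (ltW T0) ge_min lexx orbT.
have cl_mono x y : x <= y -> cl x <= cl y /\ cl y - cl x <= y - x.
  rewrite /cl => xy; rewrite /Num.max /Num.min.
  have T00 : 0 < T := T0.
  case: (ltP x T) => xT; case: (ltP y T) => yT; rewrite ?T00;
    [case: (ltP 0 x) => x0; case: (ltP 0 y) => y0|case: (ltP 0 x) => x0|case: (ltP 0 y) => y0|];
    by split; lra.
have cl_id t : 0 < t -> t < T -> cl t = t.
  by move=> t0 tT; rewrite /cl (min_idPl (ltW tT)) (max_idPr (ltW t0)).
have A0 : 0 <= A.
  by have /andP[h1 h2] := s_drop i (lexx 0) (ltW T0) (lexx T); rewrite -(pmulr_lge0 A T0); lra.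
pose g t := - s i (cl t).
have g_nd x y : x <= y -> g x <= g y.
  move=> xy; have [c1 c2] := cl_mono _ _ xy; have /andP[x0 _] := clT x; have /andP[_ yT] := clT y.
  by have /andP[+ _] := s_drop i x0 c1 yT; rewrite /g; lra.
have g_lip x y : x <= y -> g y - g x <= (A + 1) * (y - x).
  move=> xy; have [c1 c2] := cl_mono _ _ xy; have /andP[x0 _] := clT x; have /andP[_ yT] := clT y.
  have /andP[_ h] := s_drop i x0 c1 yT.
  have : A * (cl y - cl x) <= A * (y - x) by apply: ler_wpM2l.
  by rewrite /g mulrDl mul1r; lra.
have A1 : 0 < A + 1 by rewrite ltr_wpDl.
have ae1 := lipschitz_ae_derivable g_nd g_lip A1 T.
have ae2 : {ae (@lebesgue_measure R), forall t : R, t != 0}.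
  exists [set 0]; split; [exact: measurable_set1|exact: lebesgue_measure_set1|].
  by move=> t /= /negP; rewrite negbK => /eqP.
apply: (@filterS2 _ _ (ae_filter_ringOfSetsType _)) ae1 ae2 => t h1 h2 /andP[t0 tT].
have tp : 0 < t by rewrite lt_neqAle eq_sym h2.
split => //; have dg : derivable g t 1 by apply: h1; rewrite tp.
apply: (@near_eq_derivable _ _ _ (\- g)); last exact: derivableN.
have : \forall u \near t, 0 < u < T.
  by near=> u; apply/andP; split; near: u; [exact: lt_nbhsr|exact: lt_nbhsl].
by apply: filterS => u /andP[u0 uT]; rewrite /g /= opprK cl_id.
Unshelve. all: by end_near. Qed.

Let near_in t : 0 < t -> t < T -> \forall u \near t, 0 <= u <= T.
Proof.
move=> t0 tT; near=> u; apply/andP; split; apply: ltW; near: u.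
  exact: lt_nbhsr.
exact: lt_nbhsl.
Unshelve. all: by end_near. Qed.

Let s_is_derive i t : 0 < t /\ derivable (s i) t 1 -> is_derive t (1 : R) (s i) (- speed i t).
Proof.
move=> h; rewrite /speed; case: pselect => /= [[_ dt]|//].
by rewrite opprK derive1E; exact: derivableP.
Qed.

Lemma ae_side_dist i : {ae (@lebesgue_measure R), forall t : R, 0 <= t < T ->
  is_derive t (1 : R) (fun u : R => side_dist (nrm R i) (side i u) : R) (- speed i t)}.
Proof.
apply: (@filterS _ _ (ae_filter_ringOfSetsType _)) (ae_derivable i) => t h tT.
have [t0 dt] := h tT; have /andP[_ tT'] := tT.
apply: near_eq_is_derive (s_is_derive (conj t0 dt)).
by apply: filterS (near_in t0 tT') => u uT; rewrite side_distE.
Qed.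

Lemma ae_side_length i : {ae (@lebesgue_measure R), forall t : R, 0 <= t < T ->
  is_derive t (1 : R) (fun u : R => side_length (side i u) : R)
    (2 / s3 * (speed i t - (speed (i - 1) t + speed (i + 1) t)))}.
Proof.
apply: (@filterS3 _ _ (ae_filter_ringOfSetsType _)) (ae_derivable i) (ae_derivable (i - 1)) (ae_derivable (i + 1)).
move=> t h1 h2 h3 tT; have /andP[_ tT'] := tT; have [t0 _] := h1 tT.
have d1 := s_is_derive (h1 tT); have d2 := s_is_derive (h2 tT); have d3 := s_is_derive (h3 tT).
apply: (@near_eq_is_derive _ _ _ (fun u => 2 / s3 * (s (i - 1) u + s (i + 1) u - s i u))).
  by apply: filterS (near_in t0 tT') => u uT; rewrite side_lengthE.
apply: is_derive_eq; rewrite /GRing.scale /=; ring.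
Qed.
End Motion.

Theorem theorem3p5 (R : realType) (gam : R) (gam_gt0 : 0 < gam)
    (E0 : set (R * R))
    (E0_hex : wulff_hexagon E0) (E0_sym : origin_symmetric E0)
    (Ed : R -> nat -> set (R * R))
    (Ed0_hex : forall eps, 0 < eps -> discrete_hexagon eps (Ed eps 0%N))
    (Ed0_sym : forall eps, 0 < eps -> origin_symmetric (Ed eps 0%N))
    (Ed0_close : forall eps, 0 < eps ->
       exists2 W, wulff_envelope (Ed eps 0%N) W
                & (hausdorff_dist W E0 < eps%:E)%E)
    (Ed_min : forall eps, 0 < eps -> forall k : nat, (1 <= k)%N ->
       minimizer (gam * eps) eps (Ed eps k.-1) (Ed eps k)) :
  exists T : R, 0 < T /\
  exists (epsn : nat -> R) (E : R -> set (R * R))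
         (S : 'Z_6 -> R -> set (R * R)) (v : 'Z_6 -> R -> R),
    [/\ (forall n, 0 < epsn n) /\ epsn n @[n --> \oo] --> (0 : R),
        (* convergence of the envelopes, uniformly on compact sets of times *)
        forall C : set R, compact C -> C `<=` [set t | 0 <= t < T] ->
        forall r : R, 0 < r ->
        \forall n \near \oo, forall t, C t ->
          let En := Ed (epsn n) (Num.truncn (t / (gam * epsn n))) in
          discrete_hexagon (epsn n) En /\
          exists2 W, wulff_envelope En W & (hausdorff_dist W (E t) < r%:E)%E,
        (forall t, 0 <= t < T ->
          [/\ wulff_hexagon (E t), origin_symmetric (E t)
            & wulff_sides (E t) (fun i => S i t)]) /\
        E 0 = E0,
        (forall i t, 0 <= t < T ->
          velocity_law gam (side_length (S i t)) (v i t)) /\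
        (forall i, {ae (@lebesgue_measure R), forall t : R, 0 <= t < T ->
          is_derive t (1 : R) (fun u : R => side_dist (nrm R i) (S i u) : R)
            (- v i t)})
      & forall i, {ae (@lebesgue_measure R), forall t : R, 0 <= t < T ->
          is_derive t (1 : R) (fun u : R => side_length (S i u) : R)
            (2 / Num.sqrt 3 * (v i t - (v (i - 1) t + v (i + 1) t)))}].
Proof.
have /wulff_hexagonP[h0 h0l E0E] := E0_hex; rewrite {}E0E in E0_sym Ed0_close *.
have [K [c1 [T [eb [c10 T0 eb0 evol]]]]] := evolution gam_gt0 h0l.
have [e [e0 ele eirr ecvg]] := irrational_scales gam_gt0 eb0.
have /choice[m0 st0] n : exists m, forall k, k%:R * (gam * e n) <= T -> state gam h0 K c1 (e n) (Ed (e n)) k m.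
  by apply: evol => //; [exact: Ed0_hex|exact: Ed0_sym|exact: Ed0_close|exact: Ed_min].
pose X n j t := env (e n) (m0 n (clock gam (e n) t)) j.
pose M := \sum_(j : 'Z_6) `|h0 j| + eb.
have X0 n j : `|X n j 0| <= M.
  have z0 : 0%:R * (gam * e n) <= T by rewrite mul0r ltW.
  have := state_start (st0 n 0%N z0) j; rewrite /X /clock mul0r truncn0 => h1.
  have : `|h0 j| <= \sum_(j : 'Z_6) `|h0 j| by rewrite (bigD1 j)//= lerDl sumr_ge0.
  have := ele n; have := ler_normD (env (e n) (m0 n 0%N) j - h0 j) (h0 j); rewrite subrK /M.
  lra.
have A0 : 0 <= s3 / 2 * K%:R / gam by rewrite !mulr_ge0 ?invr_ge0 ?sqrtr_ge0 ?(ltW gam_gt0).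
have Xn n j t u : 0 <= t -> t <= u -> u <= T -> X n j u <= X n j t.
  by move=> t0 tu uT; have /andP[+ _] := env_drop gam_gt0 e0 st0 n j t0 tu uT; rewrite subr_ge0.
have Xl n j t u : 0 <= t -> t <= u -> u <= T -> X n j t - X n j u <= s3 / 2 * K%:R / gam * (u - t) + s3 / 2 * K%:R * e n.
  by move=> t0 tu uT; have /andP[_ +] := env_drop gam_gt0 e0 st0 n j t0 tu uT.
have [phi [s phiP]] := helly_selection T0 A0 ecvg X0 Xn Xl.
pose dl p : R := p.+1%:R^-1.
have dl1 p : 0 <= dl p <= 1 by rewrite /dl invr_ge0 ler0n invf_le1// ler1n.
have dl_small (C r : R) : 0 < r -> exists P, forall p, (P <= p)%N -> C * dl p < r := @inv_small R C r.
pose ep p := e (phi p).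
have ep0 p : 0 < ep p := e0 _.
have ep_small p : ep p <= dl p by have [h _] := phiP p; apply: le_trans h; exact: ler_norm.
have st p k : k%:R * (gam * ep p) <= T -> state gam h0 K c1 (ep p) (Ed (ep p)) k (m0 (phi p)) by exact: st0.
have close p j t : 0 <= t <= T -> `|env (ep p) (m0 (phi p) (clock gam (ep p) t)) j - s j t| <= dl p.
  by have [_] := phiP p; apply.
have ssym := limit_sym gam_gt0 dl_small ep0 st close.
have slen := limit_rlen_gt0 gam_gt0 c10 dl1 dl_small ep0 ep_small st close.
have sdrop := limit_drop gam_gt0 dl_small ep0 ep_small st close.
have sspeed := limit_speed gam_gt0 dl1 dl_small ep0 ep_small st close.
exists T; split => //; exists ep, (fun t => hexagon (s^~ t)), (side s), (speed gam s); split.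
- split => //; apply/cvgrPdist_lt => r r0; have [P HP] := dl_small 1 r r0.
  exists P => // n /= Pn; rewrite sub0r normrN gtr0_norm//.
  by apply: le_lt_trans (ep_small n) _; rewrite -[dl n]mul1r HP.
- move=> C _ CT r r0.
  have [P HP] := limit_hausdorff gam_gt0 c10 T0 dl1 dl_small ep0 ep_small st close r0.
  exists P => // n /= Pn t /CT /andP[t0 tT]; apply: HP => //.
  by rewrite t0 ltW.
- split=> [t /andP[t0 tT]|].
    have tT' : 0 <= t <= T by rewrite t0 ltW.
    have sl j := slen j t tT'.
    split; [exact: hexagon_wulff|by apply: hexagon_sym => j; exact: ssym|exact: hexagon_wulff_sides].
  congr hexagon; apply/funext => j.
  exact: (limit_start gam_gt0 T0 dl_small ep0 ep_small st close).
- split=> [i t tT|i]; first exact: (speed_law gam_gt0 slen sspeed).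
  exact: (ae_side_dist gam T0 ssym slen sdrop).
- by move=> i; exact: (ae_side_length gam T0 slen sdrop).
Qed.
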